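(* Fix a real number $0<p<1$ and an integer $t\ge 0$. Set $b:=1/(1-p)$ and \[ \alpha_{t,p}(n) := 2\log_b n + (t-2)\log_b\log_b n + \log_b\!\left(\frac{t^t}{t!^2}\right) + t\log_b\!\left(\frac{2bp}{e}\right) + 2\log_b\!\left(\frac{e}{2}\right)+1 . \] Then asymptotically almost surely (as $n\to\infty$) \[ \frac{n}{\alpha_{t,p}(n) -\frac{2}{\ln b} -1 + o(1)} \;\le\; \chi_t(G_{n,p}) \;\le\; \frac{n}{\alpha_{t,p}(n) -\frac{2}{\ln b} - 2 - o(1)} , \] where each $o(1)$ denotes a deterministic function of $n$ tending to $0$ as $n\to\infty$.
   Context: For a graph $G=(V,E)$, a vertex subset $S\subseteq V$ is called $t$-stable if the induced subgraph $G[S]$ has maximum degree at most $t$. A $t$-improper colouring of $G$ is a vertex colouring in which every colour class is a $t$-stable set, and the $t$-improper chromatic number $\chi_t(G)$ is the least number of colours in a $t$-improper colouring of $G$ (so $\chi_0$ is the usual chromatic number). $G_{n,p}$ is the random graph on vertex set $V_n=\{1,\dots,n\}$ in which each pair of distinct vertices is an edge with probability $p$, independently of all other pairs. An event holds asymptotically almost surely (a.a.s.) if its probability tends to $1$ as $n\to\infty$. Convention: $0^0=1$. *)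

(* Defs.v *)
From HB Require Import structures.
From mathcomp Require Import all_boot all_order all_algebra.
From mathcomp Require Import all_classical all_reals all_analysis.

Set Implicit Arguments.
Unset Strict Implicit.
Unset Printing Implicit Defensive.

Import Order.TTheory GRing.Theory Num.Theory.
Import numFieldNormedType.Exports.

Local Open Scope ring_scope.

Record sgraph (T : finType) := SGraph {
  edges :> {set {set T}};
  _ : [forall e in edges, #|e| == 2%N]
}.

HB.instance Definition _ (T : finType) := [isSub for @edges T].
HB.instance Definition _ (T : finType) := [Finite of sgraph T by <:].

Section ImproperColouring.
Variables (T : finType) (G : sgraph T).

(* [set v; v] is a singleton, hence not an edge, so u = v is not counted. *)
Definition induced_degree (S : {set T}) (v : T) : nat :=
  #|[set u in S | [set u; v] \in edges G]|.

Definition induced_max_degree (S : {set T}) : nat :=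
  (\max_(v in S) induced_degree S v)%N.

Definition t_stable (t : nat) (S : {set T}) : bool :=
  (induced_max_degree S <= t)%N.

Definition improper_colouring (t k : nat) (c : {ffun T -> 'I_k}) : bool :=
  [forall i : 'I_k, t_stable t [set v | c v == i]].

Definition improper_colourable (t k : nat) : bool :=
  [exists c : {ffun T -> 'I_k}, improper_colouring t c].

Lemma improper_colourable_card (t : nat) : improper_colourable t #|T|.
Proof.
apply/existsP; exists [ffun v => enum_rank v].
apply/forallP => i; apply/bigmax_leqP => v; rewrite inE ffunE => /eqP vi.
rewrite /induced_degree (_ : [set _ in _ | _] = finset.set0) ?cards0 //.
apply/finset.setP => u; rewrite !inE ffunE -vi (inj_eq enum_rank_inj).
apply/negP => /andP[/eqP -> ].
have := valP G => /forall_inP /(_ [set v; v]%SET) H /H.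
by rewrite finset.setUid cards1.
Qed.

Lemma ex_improper_colourable (t : nat) : exists k, improper_colourable t k.
Proof. by exists #|T|; exact: improper_colourable_card. Qed.

Definition improper_chromatic (t : nat) : nat :=
  ex_minn (ex_improper_colourable t).

End ImproperColouring.

Section RandomGraph.
Variables (R : realType) (p : R).

Definition Gnp_weight (n : nat) (G : sgraph 'I_n) : R :=
  \prod_(e : {set 'I_n} | #|e| == 2%N) (if e \in edges G then p else 1 - p).

Definition Gnp_prob (n : nat) (A : pred (sgraph 'I_n)) : R :=
  \sum_(G : sgraph 'I_n | A G) Gnp_weight G.

Definition Gnp_aas (A : forall n : nat, pred (sgraph 'I_n)) : Prop :=
  (Gnp_prob (A n) @[n --> \oo] --> (1 : R))%classic.

End RandomGraph.

Definition logb (R : realType) (b x : R) : R := ln x / ln b.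

Definition base (R : realType) (p : R) : R := 1 / (1 - p).

Definition alpha (R : realType) (t : nat) (p : R) (n : nat) : R :=
  let b := base p in
  let e := expR 1 in
  2 * logb b n%:R
  + (t%:R - 2) * logb b (logb b n%:R)
  + logb b (t%:R ^+ t / (t`!)%:R ^+ 2)
  + t%:R * logb b (2 * b * p / e)
  + 2 * logb b (e / 2)
  + 1.

(* Main.v *)
Require Import Defs.
From mathcomp Require Import all_boot all_order all_algebra.
From mathcomp Require Import all_classical all_reals all_analysis.
From mathcomp Require Import ring lra zify.
(* Requiring these again makes the finite-set lemma names take precedence over
   the homonymous ones of classical_sets. *)
From mathcomp Require Import fintype finset.

(** Write [beta] for [ln b]. A [k]-set is [t]-stable with probability
    [exp (- beta k (k - 1) / 2 + (t / 2) k ln k + kap k + o(k))]: weighting a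
    graph by the product of the falling factorials [t ^_ deg v] (the number of
    ways to attach its edges to [t] half-edges per vertex), the total weight
    of the graphs with [m] edges satisfies a two-sided recursion in [m].

    Upper bound. Janson's inequality, in its form for arbitrary monotone events
    and applied to a random subfamily of the [k]-sets, shows that a set of [m]
    vertices has no [t]-stable subset of size [alpha m - 1 - e] only with
    probability [exp (- m ^ (1 + c))]. This survives a union bound over all
    vertex subsets, so greedily removing such sets colours the graph; the
    average of [ln (i / n)] over [i <= n], which is about [- 1], produces the
    correction [- 2 / ln b].

    Lower bound. This is a first moment computation over partitions into [j]
    stable blocks. Each partition is counted [j!] times by sequences of blocks,
    and the sum over block sizes is bounded by its exponential generating
    function evaluated at the point where the maximal term sits at block size
    [alpha n - 2 / ln b - 1 + e]. *)

Set Implicit Arguments.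
Unset Strict Implicit.
Unset Printing Implicit Defensive.

Import Order.TTheory GRing.Theory Num.Theory.
Import numFieldNormedType.Exports.

Local Open Scope ring_scope.

(** * Random subsets and correlation inequalities *)

(** Among [m] vertices the expected number of [t]-stable [k]-sets is about [m ^ (alpha m - k)]. Size
    [alpha m - 1 - e] therefore leaves [m ^ (1 + e)] of them, and an exponent superlinear in [m] is
    what the union bound over up to [2 ^ n] vertex sets requires. Sizes are integers, so rounding
    costs up to one more; this is the whole gap between the two bounds. In the lower bound the [- 1]
    is produced by the division by [j!], and [2 / ln b] by the [- n] in Stirling's formula for [n!].
    For [t > 0] stability is not the absence of a fixed set of edges, so the joint probability for
    two overlapping sets has no product form; it is bounded crudely, in one way for small overlaps
    and in another for large ones. After rounding the expected number can reach about [m ^ (2 + e)],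
    where the correlation terms for the full family of [k]-sets may outweigh the mean; sampling
    lowers the mean to [m ^ (1 + e / 8)], where they are negligible. Errors are kept as explicit
    inequalities with a fixed slack [e]; the [o(1)] functions are extracted only at the end. *)

Lemma finset_ind (I : finType) (P : {set I} -> Prop) :
  P set0 -> (forall (e : I) (D : {set I}), e \notin D -> P D -> P (e |: D)%SET) ->
  forall D, P D.
Proof.
move=> P0 PU D; have [n] := ubnP #|D|; elim: n D => // n IH D /ltnSE leDn.
have [->//|/set0Pn[e eD]] := eqVneq D set0.
rewrite -(setD1K eD); apply: PU; first by rewrite !inE eqxx.
by apply: IH; apply: leq_trans leDn; rewrite [ltnRHS](cardsD1 e) eD.
Qed.

Section BernoulliSubsets.
Variables (R : realType) (I : finType).
Implicit Types (p : R) (D X Y A B : {set I}) (f g : {set I} -> R).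

(* [bexp p D f] is the expectation of [f X] for a random subset [X] of [D] that
   contains each element independently with probability [p]. *)
Definition bern p D X : R := \prod_(e in D) (if e \in X then p else 1 - p).

Definition bexp p D f : R := \sum_(X in powerset D) bern p D X * f X.

Definition depends_on (V : Type) A (f : {set I} -> V) :=
  forall X, f X = f (X :&: A)%SET.

Lemma sum_powersetU1 e D f : e \notin D ->
  \sum_(X in powerset (e |: D)%SET) f X =
  \sum_(X in powerset D) f (e |: X)%SET + \sum_(X in powerset D) f X.
Proof.
move=> eD; rewrite (bigID (fun X => e \in X)) /=; congr (_ + _).
  rewrite (reindex_onto (fun X => e |: X)%SET (fun X => X :\ e)%SET) /=; last first.
    by move=> X /andP[_ eX]; rewrite setD1K.
  apply: eq_bigl => X; rewrite !powersetE !inE eqxx andbT.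
  apply/andP/idP => [[XD /eqP h]|XD].
    apply/subsetP => x xX; have := subsetP XD x; rewrite !inE xX orbT => /(_ isT).
    by case/orP => // /eqP ?; subst x; move: xX; rewrite -h !inE eqxx.
  split; first by rewrite setUS.
  by rewrite setU1K //; apply: contra eD; apply/subsetP.
apply: eq_bigl => X; rewrite !powersetE; apply/andP/idP => [[XD eX]|XD].
  apply/subsetP => x xX; have := subsetP XD x; rewrite !inE xX => /(_ isT).
  by case/orP => // /eqP ?; subst x; move: eX; rewrite xX.
split; first by apply: subset_trans XD _; apply: subsetUr.
by apply: contra eD; apply/subsetP.
Qed.

Lemma bexp_set0 p f : bexp p set0 f = f set0.
Proof.
by rewrite /bexp powerset0 big_set1 /bern big_set0 mul1r.
Qed.

(** Conditioning on whether [e] is drawn. With [finset_ind] it reduces independence and correlation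
    statements to a two-point computation. *)
Lemma bexpU1 p e D f : e \notin D ->
  bexp p (e |: D)%SET f =
  p * bexp p D (fun X => f (e |: X)%SET) + (1 - p) * bexp p D f.
Proof.
move=> eD; rewrite /bexp sum_powersetU1 // !mulr_sumr; congr (_ + _);
  apply: eq_bigr => X; rewrite powersetE => XD; rewrite mulrA; congr (_ * _).
  rewrite /bern big_setU1 //= !inE eqxx; congr (_ * _); apply: eq_bigr => i iD.
  by rewrite !inE; case: eqP => // ie; subst i; rewrite iD in eD.
rewrite /bern big_setU1 //=; case: ifP => // eX.
by rewrite (subsetP XD) in eD.
Qed.

Lemma eq_bexp p D f g : (forall X, X \subset D -> f X = g X) ->
  bexp p D f = bexp p D g.
Proof. by move=> h; apply: eq_bigr => X; rewrite powersetE => /h ->. Qed.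

Lemma bexpD p D f g : bexp p D (fun X => f X + g X) = bexp p D f + bexp p D g.
Proof. by rewrite -big_split; apply: eq_bigr => X _; rewrite mulrDr. Qed.

Lemma bexpZ p D c f : bexp p D (fun X => c * f X) = c * bexp p D f.
Proof. by rewrite mulr_sumr; apply: eq_bigr => X _; rewrite mulrCA. Qed.

Lemma bexpN p D f : bexp p D (fun X => - f X) = - bexp p D f.
Proof. by rewrite -sumrN; apply: eq_bigr => X _; rewrite mulrN. Qed.

Lemma bexp_sum (J : Type) (r : seq J) (P : pred J) p D (f : J -> {set I} -> R) :
  bexp p D (fun X => \sum_(j <- r | P j) f j X) =
  \sum_(j <- r | P j) bexp p D (f j).
Proof. by rewrite exchange_big; apply: eq_bigr => X _; rewrite mulr_sumr. Qed.

Lemma bexp_cst p D c : bexp p D (fun=> c) = c.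
Proof.
elim/finset_ind: D => [|e D eD IH]; first by rewrite bexp_set0.
by rewrite bexpU1 // IH -mulrDl addrC subrK mul1r.
Qed.

Section Positive.
Variable p : R.
Hypothesis p01 : 0 <= p <= 1.

Lemma bern_ge0 D X : 0 <= bern p D X.
Proof.
case/andP: p01 => p0 p1; apply: prodr_ge0 => e _; case: ifP => // _.
by rewrite subr_ge0.
Qed.

Lemma ler_bexp D f g : (forall X, X \subset D -> f X <= g X) ->
  bexp p D f <= bexp p D g.
Proof.
move=> h; apply: ler_sum => X; rewrite powersetE => /h.
by apply: ler_wpM2l; apply: bern_ge0.
Qed.

Lemma bexp_ge0 D f : (forall X, X \subset D -> 0 <= f X) -> 0 <= bexp p D f.
Proof. by move=> h; rewrite -[leLHS](bexp_cst p D); apply: ler_bexp. Qed.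

End Positive.

Lemma depends_onU1 (V : Type) e A (f : {set I} -> V) :
  depends_on A f -> depends_on A (fun X => f (e |: X)%SET).
Proof.
move=> fA X; rewrite fA [RHS]fA; congr f; apply/setP => x.
by rewrite !inE; case: (x == e); case: (x \in X); case: (x \in A).
Qed.

Lemma depends_on_notin (V : Type) e A (f : {set I} -> V) X :
  depends_on A f -> e \notin A -> f (e |: X)%SET = f X.
Proof.
move=> fA eA; rewrite fA [RHS]fA; congr f; apply/setP => x.
by rewrite !inE; case: eqP => // ->; rewrite (negPf eA) !andbF.
Qed.

Lemma depends_on_sub (V : Type) A B (f : {set I} -> V) :
  A \subset B -> depends_on A f -> depends_on B f.
Proof.
move=> /setIidPr AB fA X; rewrite fA [RHS]fA; congr f.
by rewrite -setIA AB.
Qed.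

(** Lets a local event, such as the stability of [S], be moved between [pairs S] and the set of all
    pairs. *)
Lemma bexp_depends p A D f : depends_on A f -> A \subset D ->
  bexp p D f = bexp p A f.
Proof.
move=> fA AD.
(* The inclusion of [A] in [D] does not survive the removal of a point of [D], so the induction is
   run on [D :&: A]. *)
suff: forall D f, depends_on A f -> bexp p D f = bexp p (D :&: A)%SET f.
  by move=> /(_ D f fA) ->; rewrite (setIidPr AD).
move=> {fA AD D f} D; elim/finset_ind: D => [|e D eD IH] f fA.
  by rewrite set0I.
rewrite bexpU1 //; have [eA|eA] := boolP (e \in A).
  have -> : ((e |: D) :&: A = e |: (D :&: A))%SET.
    by apply/setP => x; rewrite !inE; case: eqP => // ->; rewrite eA.
  rewrite bexpU1; last by rewrite inE negb_and eD.
  by congr (_ * _ + _ * _); apply: IH => //; apply: depends_onU1.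
have -> : ((e |: D) :&: A = D :&: A)%SET.
  by apply/setP => x; rewrite !inE; case: eqP => // ->; rewrite (negPf eA) !andbF.
under eq_bexp do rewrite (depends_on_notin _ fA eA).
by rewrite -mulrDl addrC subrK mul1r IH.
Qed.

Lemma bexp_indep p A B D f g : [disjoint A & B] -> depends_on A f ->
  depends_on B g -> bexp p D (fun X => f X * g X) = bexp p D f * bexp p D g.
Proof.
move=> dAB; elim/finset_ind: D f g => [|e D eD IH] f g fA gB.
  by rewrite !bexp_set0.
rewrite !bexpU1 //; have [eA|eA] := boolP (e \in A).
  have eB : e \notin B by rewrite (disjointFr dAB).
  under [X in p * X]eq_bexp do rewrite (depends_on_notin _ gB eB).
  under [X in _ = _ * (p * X + _)]eq_bexp do rewrite (depends_on_notin _ gB eB).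
  by rewrite !IH //; [ring|exact: depends_onU1].
under [X in p * X]eq_bexp do rewrite (depends_on_notin _ fA eA).
under [X in _ = (p * X + _) * _]eq_bexp do rewrite (depends_on_notin _ fA eA).
by rewrite !IH //; [ring|exact: depends_onU1].
Qed.

Lemma bexp_expr_card p D (z : R) :
  bexp p D (fun X => z ^+ #|X|) = (p * z + (1 - p)) ^+ #|D|.
Proof.
elim/finset_ind: D => [|e D eD IH]; first by rewrite bexp_set0 !cards0 !expr0.
rewrite bexpU1 // cardsU1 eD IH add1n exprS [RHS]mulrDl; congr (_ + _).
rewrite -mulrA -IH; congr (_ * _); rewrite -bexpZ; apply: eq_bexp => X XD.
by rewrite cardsU1 (contra (subsetP XD e) eD) add1n exprS.
Qed.

Lemma bexp_expr_cardI p A D (z : R) : A \subset D ->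
  bexp p D (fun X => z ^+ #|X :&: A|) = (p * z + (1 - p)) ^+ #|A|.
Proof.
move=> AD; rewrite (bexp_depends p (A := A)) //; last first.
  by move=> X; rewrite -setIA setIid.
rewrite -bexp_expr_card; apply: eq_bexp => X XA.
by rewrite (setIidPl XA).
Qed.

Lemma depends_on_mem e : depends_on [set e]%SET (fun X => (e \in X)%:R : R).
Proof. by move=> X; rewrite !inE eqxx andbT. Qed.

Lemma bexp_mem p D e : e \in D -> bexp p D (fun X => (e \in X)%:R) = p.
Proof.
move=> eD; rewrite (bexp_depends p (@depends_on_mem e)) ?sub1set //.
rewrite -(setU0 [set e]%SET) bexpU1 ?inE // !bexp_set0 !inE eqxx /=.
by rewrite mulr0 addr0 mulr1.
Qed.

Lemma bexp_mem2 p D e e' : e \in D -> e' \in D -> e != e' ->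
  bexp p D (fun X => (e \in X)%:R * (e' \in X)%:R) = p ^+ 2.
Proof.
move=> eD e'D ne; rewrite (bexp_indep p D (A := [set e]%SET) (B := [set e']%SET));
  rewrite ?bexp_mem ?expr2 //; try exact: depends_on_mem.
by rewrite disjoints1 inE.
Qed.

Definition set_decreasing f := forall X Y, X \subset Y -> f Y <= f X.

(** Conditioning on [e] adds to the covariance the term [p (1 - p) (F0 - F1) (G0 - G1)], whose last
    two factors are nonnegative by monotonicity. *)
Lemma harris p D f g : 0 <= p <= 1 -> set_decreasing f -> set_decreasing g ->
  bexp p D f * bexp p D g <= bexp p D (fun X => f X * g X).
Proof.
move=> p01; elim/finset_ind: D f g => [|e D eD IH] f g fd gd.
  by rewrite !bexp_set0.
have decU h : set_decreasing h -> set_decreasing (fun X => h (e |: X)%SET).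
  by move=> hd X Y XY; apply: hd; apply: setUS.
have le1 h : set_decreasing h -> bexp p D (fun X => h (e |: X)%SET) <= bexp p D h.
  by move=> hd; apply: ler_bexp => // X _; apply: hd; apply: subsetUr.
rewrite !bexpU1 //.
have := IH _ _ (decU _ fd) (decU _ gd); have := IH _ _ fd gd.
have := le1 _ fd; have := le1 _ gd.
set F1 := bexp p D (fun X => f (e |: X)%SET).
set G1 := bexp p D (fun X => g (e |: X)%SET).
set F0 := bexp p D f; set G0 := bexp p D g.
move=> G10 F10 h0 h1; case/andP: p01 => p0 p1.
apply: (@le_trans _ _ (p * (F1 * G1) + (1 - p) * (F0 * G0))); last first.
  by rewrite lerD // ler_wpM2l // subr_ge0.
rewrite -subr_ge0; have -> : p * (F1 * G1) + (1 - p) * (F0 * G0) -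
  (p * F1 + (1 - p) * F0) * (p * G1 + (1 - p) * G0) =
  p * (1 - p) * ((F0 - F1) * (G0 - G1)) by ring.
by rewrite !mulr_ge0 // subr_ge0.
Qed.

Lemma harris_opp p D f g : 0 <= p <= 1 -> set_decreasing f ->
  set_decreasing (fun X => - g X) ->
  bexp p D (fun X => f X * g X) <= bexp p D f * bexp p D g.
Proof.
move=> p01 fd gd; have := harris D p01 fd gd; rewrite bexpN mulrN.
rewrite (eq_bexp p (f := fun X => f X * - g X) (g := fun X => - (f X * g X))) ?bexpN ?lerN2 //.
by move=> X _; rewrite mulrN.
Qed.

End BernoulliSubsets.

(** * Janson's inequality for decreasing events *)

Section Janson.
Variables (R : realType) (I J : finType) (p : R) (D : {set I}).
Variables (A : J -> {set I} -> bool) (supp : J -> {set I}).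
Hypothesis p01 : 0 <= p <= 1.
Hypothesis A_dec : forall j (X Y : {set I}), X \subset Y -> A j Y -> A j X.
Hypothesis A_supp : forall j, depends_on (supp j) (A j).

Let prA j := bexp p D (fun X => (A j X)%:R).
Let prA2 i j := bexp p D (fun X => (A i X && A j X)%:R).
Let meets i j := ~~ [disjoint supp i & supp j].
Let avoids (s : seq J) X := all (fun j => ~~ A j X) s.

(** The exponent obtained by revealing the events one at a time: each intersecting pair is charged
    once, to its earlier member in the list. *)
Fixpoint janson_exponent (s : seq J) : R :=
  if s is i :: s' then
    - prA i + \sum_(j <- s' | meets i j) prA2 i j + janson_exponent s'
  else 0.

Lemma avoids_incr s (X Y : {set I}) : X \subset Y -> avoids s X -> avoids s Y.
Proof.
by move=> XY /allP h; apply/allP => j /h; apply: contra; apply: A_dec.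
Qed.

(* Among the events of [s], those independent of [A i] form a monotone condition
   that Harris' inequality lets us drop from the probabilities of [A i && A j]. *)
Lemma bexp_avoids_ge i s :
  bexp p D (fun X => (avoids s X)%:R) *
    (prA i - \sum_(j <- s | meets i j) prA2 i j) <=
  bexp p D (fun X => (A i X)%:R * (avoids s X)%:R).
Proof.
set B := fun X => (avoids s X)%:R; set x := prA i - _.
pose s1 := [seq j <- s | ~~ meets i j].
pose B1 X : R := (avoids s1 X)%:R.
have B1x : bexp p D B1 * x <= bexp p D (fun X => (A i X)%:R * B X).
  have -> : bexp p D B1 * x = bexp p D (fun X => (A i X)%:R * B1 X) -
      \sum_(j <- s | meets i j) prA2 i j * bexp p D B1.
    rewrite (bexp_indep p D (A := supp i) (B := ~: supp i)%SET).
    - by rewrite mulrC mulrBl; congr (_ - _); rewrite mulr_suml.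
    - by rewrite -setI_eq0 setICr.
    - by move=> X; rewrite {1}A_supp.
    move=> X; congr (_%:R); congr nat_of_bool; apply: eq_in_all => j.
    rewrite mem_filter negbK => /andP[dij _]; congr (~~ _).
    apply: (@depends_on_sub _ _ (supp j)) => //.
    by rewrite -disjoints_subset disjoint_sym.
  apply: (@le_trans _ _ (bexp p D (fun X => (A i X)%:R * B1 X -
      \sum_(j <- s | meets i j) (A i X && A j X)%:R * B1 X))).
    rewrite bexpD lerD2l bexpN lerN2 bexp_sum; apply: ler_sum => j _.
    apply: harris_opp => // X Y XY.
      rewrite ler_nat; case/boolP: (_ && _) => // /andP[iY jY].
      by rewrite (A_dec XY iY) (A_dec XY jY).
    by rewrite lerN2 ler_nat; case/boolP: (avoids s1 X) => // h; rewrite (avoids_incr XY h).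
  apply: ler_bexp => // X _; rewrite /B1 /B.
  have s0 : 0 <= \sum_(j <- s | meets i j) (A i X && A j X)%:R * (avoids s1 X)%:R :> R.
    by apply: sumr_ge0 => j _; rewrite mulr_ge0 // ler0n.
  case: (boolP (avoids s X)) => av; rewrite ?mulr1 ?mulr0.
    rewrite lerBlDr; apply: ler_wpDr => //.
    by rewrite -[leRHS]mulr1; apply: ler_wpM2l; rewrite ?ler0n // lern1 leq_b1.
  case: (boolP (A i X)) => iX; rewrite ?mul0r ?mul1r ?sub0r ?oppr_le0 //; last exact: sumr_ge0.
  case: (boolP (avoids s1 X)) => av1; last by rewrite sub0r oppr_le0; apply: sumr_ge0 => j _; rewrite mulr_ge0 ?ler0n.
  (* An event of [s] that occurs although [s1] is avoided must meet [i], and its summand compensates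
     that of [A i]. *)
  case/allPn: av => j js; rewrite negbK => jX.
  have mij : meets i j.
    by case: (boolP (meets i j)) => // h; move/allP: av1 => /(_ j); rewrite mem_filter h js jX /= => /(_ isT).
  rewrite subr_le0 (big_rem j) //= mij jX /= mulr1 lerDl.
  by apply: sumr_ge0 => l _; rewrite mulr_ge0.
have B0 (s' : seq J) : 0 <= bexp p D (fun X => (avoids s' X)%:R).
  by apply: bexp_ge0 => // X _; rewrite ler0n.
have BB1 : bexp p D B <= bexp p D B1.
  apply: ler_bexp => // X _; rewrite ler_nat; case/boolP: (avoids s X) => // /allP h.
  suff -> : avoids s1 X by [].
  by apply/allP => j; rewrite mem_filter => /andP[_ /h].
have [x0|x0] := leP 0 x; first exact: le_trans (ler_wpM2r x0 BB1) B1x.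
apply: (@le_trans _ _ 0); first by apply: mulr_ge0_le0; [exact: B0|exact: ltW].
by apply: bexp_ge0 => // X _; rewrite mulr_ge0.
Qed.

(** Adding [i] multiplies the bound by [1 - x <= exp (- x)], where [bexp_avoids_ge] makes [x] a
    lower bound for the conditional probability of [A i]. The product form avoids dividing by a
    probability that may vanish. *)
Lemma janson_seq s :
  bexp p D (fun X => (avoids s X)%:R) <= expR (janson_exponent s).
Proof.
elim: s => [|i s IH] /=; first by rewrite bexp_cst expR0.
have -> : bexp p D (fun X => (~~ A i X && avoids s X)%:R) =
   bexp p D (fun X => (avoids s X)%:R) -
   bexp p D (fun X => (A i X)%:R * (avoids s X)%:R).
  rewrite -bexpN -bexpD; apply: eq_bexp => X _.
  by case: (A i X); rewrite /= ?mul1r ?subrr // mul0r subr0.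
have /= := bexp_avoids_ge i s.
set x := prA i - _; set b := bexp _ _ _ => hx.
have b0 : 0 <= b by apply: bexp_ge0 => // X _; rewrite ler0n.
apply: (@le_trans _ _ (b * expR (- x))).
  apply: (@le_trans _ _ (b * (1 - x))); first by rewrite mulrBr mulr1 lerD2l lerN2.
  by apply: ler_wpM2l => //; apply: expR_ge1Dx.
rewrite expRD /x opprB [X in _ <= expR X * _]addrC [leRHS]mulrC.
by apply: ler_wpM2r => //; apply: expR_ge0.
Qed.

(** Ordered pairs count each intersection twice; this loses a factor of 2 in the correlation term
    and makes the bound independent of the order of [s]. *)
Lemma janson_exponent_le s : uniq s -> janson_exponent s <=
  - \sum_(i <- s) prA i + \sum_(i <- s) \sum_(j <- s | (j != i) && meets i j) prA2 i j.
Proof.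
have P2ge0 i j : 0 <= prA2 i j by apply: bexp_ge0 => // X _; rewrite ler0n.
elim: s => [_|i s IH /= /andP[iNs /IH {}IH]]; first by rewrite !big_nil oppr0 addr0.
rewrite !big_cons eqxx /= opprD -!addrA lerD2l.
apply: (@le_trans _ _ (\sum_(j <- s | meets i j) prA2 i j +
   (- \sum_(i0 <- s) prA i0 + \sum_(i0 <- s) \sum_(j <- s | (j != i0) && meets i0 j) prA2 i0 j))).
  by rewrite lerD2l.
rewrite addrCA lerD2l lerD //.
  rewrite le_eqVlt; apply/orP; left; apply/eqP.
  rewrite [LHS]big_seq_cond [RHS]big_seq_cond; apply: eq_bigl => j.
  by case: eqP => [->|_] //=; rewrite (negPf iNs).
apply: ler_sum => l _; rewrite big_cons; case: ifP => // _.
by rewrite lerDr.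
Qed.

(* Keeping each [i] in [F] with probability [r] turns the exponent into the right
   hand side on average, so some subfamily of [F] does at least as well. *)
Lemma janson_sampled (F : {set J}) (r : R) : 0 <= r <= 1 ->
  bexp p D (fun X => [forall j in F, ~~ A j X]%:R) <=
  expR (- (r * \sum_(i in F) prA i) +
    r ^+ 2 * \sum_(i in F) \sum_(j in F | (j != i) && meets i j) prA2 i j).
Proof.
move=> r01.
pose e (G : {set J}) : R := - \sum_(i in G) prA i +
  \sum_(i in G) \sum_(j in G | (j != i) && meets i j) prA2 i j.
have mean : bexp r F e = - (r * \sum_(i in F) prA i) +
    r ^+ 2 * \sum_(i in F) \sum_(j in F | (j != i) && meets i j) prA2 i j.
  rewrite bexpD bexpN; congr (- _ + _).
    rewrite (eq_bexp _ (g := fun G => \sum_(i in F) prA i * (i \in G)%:R)).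
      rewrite bexp_sum mulr_sumr; apply: eq_bigr => i iF.
      by rewrite bexpZ bexp_mem // mulrC.
    move=> G GF; rewrite [RHS](big_setID G) /= (setIidPr GF) [X in _ + X]big1 ?addr0.
      by apply: eq_bigr => i ->; rewrite mulr1.
    by move=> i; rewrite inE => /andP[/negPf -> _]; rewrite mulr0.
  rewrite (eq_bexp _ (g := fun G => \sum_(i in F)
      \sum_(j in F | (j != i) && meets i j) prA2 i j * ((i \in G)%:R * (j \in G)%:R))).
    rewrite bexp_sum mulr_sumr; apply: eq_bigr => i iF.
    rewrite bexp_sum mulr_sumr; apply: eq_bigr => j /and3P[jF ji _].
    by rewrite bexpZ bexp_mem2 1?eq_sym // mulrC.
  move=> G GF; rewrite [RHS](big_setID G) /= (setIidPr GF) [X in _ + X]big1 ?addr0.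
    apply: eq_bigr => i iG; rewrite iG /= (big_setIDcond _ F G) /= (setIidPr GF) [X in _ + X]big1 ?addr0.
      by apply: eq_bigr => j /andP[-> _]; rewrite mul1r mulr1.
    by move=> j; rewrite inE => /andP[/andP[/negPf -> _] _]; rewrite !mulr0.
  move=> i; rewrite inE => /andP[/negPf -> _]; apply: big1 => j _.
  by rewrite mul0r mulr0.
rewrite -mean.
have F0 : set0 \in powerset F by rewrite powersetE sub0set.
have [G GF Gmin] := arg_minP e F0.
have {}GF : G \subset F by rewrite -powersetE; exact: GF.
apply: (@le_trans _ _ (expR (e G))); last first.
  rewrite ler_expR -[leLHS](bexp_cst r F); apply: ler_bexp => // G' G'F.
  by apply: Gmin; move: G'F; rewrite -powersetE; apply.
apply: (@le_trans _ _ (bexp p D (fun X => (avoids (enum G) X)%:R))).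
  apply: ler_bexp => // X _; rewrite ler_nat; case: forall_inP => // h.
  suff -> : avoids (enum G) X by [].
  by apply/allP => j; rewrite mem_enum => /(subsetP GF) /h.
apply: le_trans (janson_seq _) _; rewrite ler_expR.
apply: le_trans (janson_exponent_le (enum_uniq _)) _.
rewrite /e !big_enum /= lerD2l; apply: ler_sum => i _.
by rewrite big_enum_cond.
Qed.

End Janson.

(** * Counting graphs of bounded degree *)

Section Pairs.
Variable T : finType.
Implicit Types (S e : {set T}) (X : {set {set T}}) (u v : T).

Definition pairs S : {set {set T}} := [set e : {set T} | (e \subset S) && (#|e| == 2%N)].

Definition incidence X v := #|[set e in X | v \in e]|.

Definition stable (t : nat) S X := [forall v in S, (incidence (X :&: pairs S)%SET v <= t)%N].

Lemma card_pairs S : #|pairs S| = 'C(#|S|, 2).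
Proof. by rewrite cards_draws. Qed.

Lemma pairs_mono S S' : S \subset S' -> pairs S \subset pairs S'.
Proof.
move=> SS'; apply/subsetP => e; rewrite !inE => /andP[eS ->].
by rewrite (subset_trans eS).
Qed.

Lemma pairsI S S' : (pairs S :&: pairs S' = pairs (S :&: S'))%SET.
Proof.
by apply/setP => e; rewrite !inE subsetI; case: (_ \subset _); case: (_ \subset _); case: eqP.
Qed.

Lemma mem_pairs2 S u v : ([set u; v] \in pairs S) = [&& u \in S, v \in S & u != v].
Proof.
by rewrite inE subUset !sub1set cards2 -andbA eqSS eqb1.
Qed.

Lemma degree_incidence S X v : X \subset pairs S -> v \in S ->
  #|[set u in S | [set u; v] \in X]| = incidence X v.
Proof.
move=> XS vS.
have uv u : [set u; v] \in X -> u != v.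
  by move/(subsetP XS); rewrite mem_pairs2 => /and3P[].
rewrite /incidence -(card_in_imset (f := fun u => [set u; v])).
  apply: eq_card => e; apply/imsetP/idP => [[u]|].
    by rewrite !inE => /andP[_ uvX] ->; rewrite uvX !inE eqxx orbT.
  rewrite !inE => /andP[eX ve].
  have := subsetP XS e eX; rewrite inE => /andP[eS e2].
  have /cards1P[u hu] : (#|(e :\ v)%SET| == 1)%N.
    by move: e2; rewrite (cardsD1 v e) ve eqSS.
  have ue : u \in e by have : u \in [set u]%SET by [rewrite inE]; rewrite -hu inE => /andP[].
  exists u; last by rewrite -(setD1K ve) hu setUC.
  by rewrite inE (subsetP eS) //= setUC -hu setD1K.
move=> u u'; rewrite !inE => /andP[_ uX] /andP[_ u'X] h.
have : u \in [set u'; v]%SET by rewrite -h !inE eqxx.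
by rewrite !inE (negPf (uv _ uX)) orbF => /eqP.
Qed.

Lemma incidence_mono (X Y : {set {set T}}) v : X \subset Y -> (incidence X v <= incidence Y v)%N.
Proof.
move=> XY; apply: subset_leq_card; apply/subsetP => e; rewrite !inE => /andP[eX ->].
by rewrite (subsetP XY).
Qed.

Lemma stable_decreasing t S (X Y : {set {set T}}) :
  X \subset Y -> stable t S Y -> stable t S X.
Proof.
move=> XY /forall_inP h; apply/forall_inP => v vS; apply: leq_trans (h v vS).
by apply: incidence_mono; apply: setSI.
Qed.

Lemma stable_depends t S : depends_on (pairs S) (stable t S).
Proof.
move=> X; apply: eq_forallb => v.
by rewrite -setIA setIid.
Qed.

Lemma edges_pairs (G : sgraph T) : edges G \subset pairs setT.
Proof.
have /forall_inP h := valP G; apply/subsetP => e eG.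
by rewrite inE subsetT h.
Qed.

Lemma t_stableE (G : sgraph T) t S : t_stable G t S = stable t S (edges G).
Proof.
have E v : v \in S -> induced_degree G S v = incidence (edges G :&: pairs S)%SET v.
  move=> vS; rewrite -(degree_incidence (S := S)) ?subsetIr //.
  apply: eq_card => u; rewrite !inE; case: (boolP (u \in S)) => //= uS.
  case: (boolP (_ \in edges G)) => //= uvG.
  have := subsetP (edges_pairs G) _ uvG; rewrite inE => /andP[_ ->].
  by rewrite subUset !sub1set uS vS.
by apply/bigmax_leqP/forall_inP => h v vS; have := h v vS; rewrite E.
Qed.

Lemma sum_incidence S X : X \subset pairs S -> (\sum_(v in S) incidence X v = 2 * #|X|)%N.
Proof.
move=> XS; under eq_bigr => v _ do rewrite /incidence -sum1dep_card big_mkcondr /=.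
rewrite exchange_big /= mulnC -sum_nat_const; apply: eq_bigr => e eX.
have := subsetP XS e eX; rewrite inE => /andP[/setIidPr eS /eqP e2].
by rewrite -big_mkcondr sum1dep_card -[in RHS]e2 -[in RHS]eS; apply: eq_card => v; rewrite !inE.
Qed.

Lemma incidenceU1 X e v : e \notin X ->
  incidence (e |: X)%SET v = ((v \in e) + incidence X v)%N.
Proof.
move=> eX; rewrite /incidence; case: (boolP (v \in e)) => ve.
  rewrite -(_ : (e |: [set e in X | v \in e] = [set e0 in e |: X | v \in e0])%SET).
    by rewrite cardsU1 inE (negPf eX).
  by apply/setP => f; rewrite !inE; case: eqP => // ->; rewrite ve.
rewrite add0n; apply: eq_card => f; rewrite !inE; case: eqP => // ->.
by rewrite (negPf ve) (negPf eX).
Qed.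

(** Turns a sum over possible new edges into a double sum over vertices, to be compared with the
    square of the sum of [a]. *)
Lemma sum_pairs S (a : T -> nat) (Q : pred {set T}) :
  (2 * \sum_(e in pairs S | Q e) \prod_(v in e) a v =
   \sum_(u in S) \sum_(v in S | (u != v) && Q [set u; v]) a u * a v)%N.
Proof.
rewrite pair_big_dep /=.
rewrite (partition_big (fun uv => [set uv.1; uv.2]%SET) (fun e => (e \in pairs S) && Q e)) /=; last first.
  by move=> [u v] /= /and4P[uS vS uv Quv]; rewrite mem_pairs2 uS vS uv.
rewrite big_distrr /=; apply: eq_bigr => e /andP[eP Qe].
have := eP; rewrite inE => /andP[eS /cards2P[x [y [xy ee]]]].
subst e; have [xS yS] : x \in S /\ y \in S.
  by split; apply: (subsetP eS); rewrite !inE eqxx ?orbT.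
rewrite (bigD1 (x, y)) /=; last by rewrite xS yS xy Qe eqxx.
rewrite (bigD1 (y, x)) /=; last first.
  by rewrite xS yS (eq_sym y) xy setUC Qe eqxx /= xpair_eqE negb_and (eq_sym y) xy.
rewrite big_setU1 ?inE // big_set1 big1 /= ?addn0; first by lia.
move=> [u v] /= /andP[/andP[/andP[/and4P[uS vS uv _] /eqP h] n1] n2].
have : u \in [set x; y]%SET by rewrite -h !inE eqxx.
have : v \in [set x; y]%SET by rewrite -h !inE eqxx orbT.
rewrite !inE => /orP[]/eqP ? /orP[]/eqP ?; subst u v; move: uv n1 n2; rewrite !eqxx //.
Qed.

End Pairs.

Section DegreeCount.
Variables (T : finType) (t : nat) (S : {set T}).
Implicit Types (X Y : {set {set T}}).
Let P := pairs S.
Let k := #|S|.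

(* The number of ways to attach the edges of [X] to distinct half-edges, when each
   vertex of [S] carries [t] of them; it vanishes unless [X] has degrees at most [t]. *)
Definition half_edge_weight X := (\prod_(v in S) t ^_ (incidence X v))%N.

Definition half_edge_count m :=
  (\sum_(X in powerset P | #|X| == m) half_edge_weight X)%N.

Lemma half_edge_count0 : half_edge_count 0 = 1%N.
Proof.
rewrite /half_edge_count (eq_bigl (pred1 set0)) ?big_pred1_eq.
  rewrite /half_edge_weight big1 // => v _; rewrite /incidence.
  by rewrite (_ : [set _ in _ | _] = set0) ?cards0 ?ffactn0 //; apply/setP => e; rewrite !inE.
by move=> X; rewrite cards_eq0 /= powersetE; case: eqP => [->|]; rewrite ?sub0set ?andbF.
Qed.

Lemma half_edge_weightU1 e X : e \in P -> e \notin X ->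
  half_edge_weight (e |: X) = (half_edge_weight X * \prod_(v in e) (t - incidence X v))%N.
Proof.
rewrite inE => /andP[eS _] eX; rewrite /half_edge_weight.
rewrite [in RHS](big_setID e) [in LHS](big_setID e) /= (setIidPr eS) mulnAC -big_split /=.
congr (_ * _)%N; apply: eq_bigr => v.
  by move=> ve; rewrite incidenceU1 // ve ffactnSr.
by rewrite inE => /andP[/negPf ve _]; rewrite incidenceU1 // ve.
Qed.

(** Double counting of graphs with a marked edge. Adding [e] multiplies the weight by the numbers of
    free half-edges at its ends, and the total number of free half-edges depends on [m] alone; this
    is the point of the weighting. *)
Lemma half_edge_count_extend m :
  (m.+1 * half_edge_count m.+1 = \sum_(X in powerset P | #|X| == m)
    half_edge_weight X * \sum_(e in P | e \notin X) \prod_(v in e) (t - incidence X v))%N.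
Proof.
transitivity (\sum_(Y in powerset P | #|Y| == m.+1) \sum_(e in Y) half_edge_weight Y)%N.
  rewrite /half_edge_count big_distrr; apply: eq_bigr => Y /andP[_ /eqP Ym].
  by rewrite sum_nat_const Ym.
rewrite (exchange_big_dep (mem P)) /=; last first.
  by move=> Y e /andP[]; rewrite powersetE => /subsetP YP _; apply: YP.
transitivity (\sum_(e in P) \sum_(X in powerset P | (#|X| == m) && (e \notin X))
    half_edge_weight X * \prod_(v in e) (t - incidence X v))%N; last first.
  rewrite (exchange_big_dep (fun X => (X \in powerset P) && (#|X| == m))) /=; last first.
    by move=> e X _ /and3P[-> -> _].
  apply: eq_bigr => X /andP[XP Xm]; rewrite big_distrr.
  by apply: eq_bigl => e; rewrite XP Xm.
apply: eq_bigr => e eP.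
rewrite (reindex_onto (fun X => e |: X) (fun Y => Y :\ e)) /=; last first.
  by move=> Y /andP[_ eY]; rewrite setD1K.
apply: eq_big => [X|X /andP[/andP[/andP[_ _] _] /eqP h]]; last first.
  by rewrite half_edge_weightU1 // -h !inE eqxx.
rewrite !powersetE subUset sub1set eP setU11 /= andbT.
case: (boolP (e \in X)) => eX; rewrite ?andbF /=.
  by apply/negP => /andP[_ /eqP h]; move: eX; rewrite -h !inE eqxx.
by rewrite cardsU1 eX add1n eqSS setU1K // eqxx !andbT.
Qed.

Lemma half_edge_weight_gt0 X : (0 < half_edge_weight X)%N ->
  {in S, forall v, (incidence X v <= t)%N}.
Proof. by move=> + v vS; rewrite /half_edge_weight (bigD1 v) //= muln_gt0 ffact_gt0 => /andP[]. Qed.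

Lemma sum_free_half_edges X : X \subset P -> (0 < half_edge_weight X)%N ->
  (\sum_(v in S) (t - incidence X v) = t * k - 2 * #|X|)%N.
Proof.
move=> XP /half_edge_weight_gt0 h; rewrite -(sum_incidence XP).
rewrite sumnB //.
by rewrite sum_nat_const mulnC.
Qed.

(** Allowing loops and repeated edges turns the double sum into the square of the number of free
    half-edges. *)
Lemma half_edge_count_le m :
  (2 * m.+1 * half_edge_count m.+1 <= (t * k - 2 * m) ^ 2 * half_edge_count m)%N.
Proof.
rewrite -mulnA half_edge_count_extend big_distrr [leqRHS]big_distrr /=.
apply: leq_sum => X /andP[XP /eqP Xm]; rewrite powersetE in XP.
have [->|] := posnP (half_edge_weight X); first by rewrite mul0n !muln0.
move=> W0; rewrite mulnCA [leqRHS]mulnC leq_mul2l; apply/orP; right.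
rewrite (sum_pairs S (fun v => t - incidence X v)%N (fun e => e \notin X)).
rewrite -Xm -sum_free_half_edges // -mulnn big_distrl /=.
apply: leq_sum => u uS; rewrite big_distrr /= [leqLHS]big_mkcondr /=.
by apply: leq_sum => v vS; case: ifP.
Qed.

(** For fixed [u] the square exceeds the sum over new edges by the term [v = u], with at most [t]
    free half-edges, and by at most [t] neighbours of [u], with at most [t] each; hence
    [t + t * t]. *)
Lemma half_edge_count_ge m :
  ((t * k - 2 * m) ^ 2 * half_edge_count m <= 2 * m.+1 * half_edge_count m.+1 +
   (t + t * t) * (t * k - 2 * m) * half_edge_count m)%N.
Proof.
rewrite -[(2 * _ * _)%N]mulnA half_edge_count_extend ![in leqRHS]big_distrr [leqLHS]big_distrr /=.
rewrite -big_split /=.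
apply: leq_sum => X /andP[XP /eqP Xm]; rewrite powersetE in XP.
have [->|] := posnP (half_edge_weight X); first by rewrite !muln0.
move=> W0; rewrite mulnCA [leqLHS]mulnC [X in (_ <= _ + X)%N]mulnC -mulnDr leq_mul2l; apply/orP; right.
rewrite (sum_pairs S (fun v => t - incidence X v)%N (fun e => e \notin X)).
rewrite -Xm -sum_free_half_edges //.
set a := fun v => (t - incidence X v)%N.
have at_ v : (a v <= t)%N by apply: leq_subr.
rewrite -mulnn big_distrl /= big_distrr -big_split /=.
apply: leq_sum => u uS; rewrite [leqLHS]big_distrr /= (bigID (fun v => (u != v) && ([set u; v] \notin X))) /=.
rewrite leq_add2l.
apply: (@leq_trans (\sum_(v in S | u == v) a u * a v + \sum_(v in S | [set v; u] \in X) a u * a v)%N).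
  rewrite [in leqRHS]big_mkcondr [X in (_ <= _ + X)%N]big_mkcondr -big_split [leqLHS]big_mkcondr /=.
  apply: leq_sum => v vS; rewrite negb_and !negbK (setUC [set v]).
  by case: eqP => //= _; case: ifP => //= _; rewrite ?addn0 ?leq_addr // leq_addl.
rewrite mulnDl leq_add //.
  rewrite (eq_bigl (pred1 u)) ?big_pred1_eq; first by rewrite leq_mul2r at_ orbT.
  by move=> v /=; rewrite eq_sym; case: eqP => [->|]; rewrite ?uS ?andbF.
rewrite -big_distrr /= mulnC leq_mul2r; apply/orP; right.
apply: (@leq_trans (\sum_(v in S | [set v; u] \in X) t)%N); first exact: leq_sum.
rewrite sum_nat_const leq_mul2r; apply/orP; right.
have := half_edge_weight_gt0 W0 uS; rewrite -(degree_incidence XP uS).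
by apply: leq_trans; apply: subset_leq_card; apply/subsetP => v; rewrite !inE.
Qed.

End DegreeCount.

(** * Elementary estimates for logarithms and factorials *)

Section RealEstimates.
Variable R : realType.
Implicit Types x y d : R.

Lemma exp_partial_sum x n : 0 <= x -> \sum_(i < n) x ^+ i / i`!%:R <= expR x.
Proof.
move=> x0; have nd : nondecreasing_seq (series (exp_coeff x)).
  by apply/nondecreasing_seqP => m; rewrite seriesSr lerDl divr_ge0 // exprn_ge0.
have := nondecreasing_cvgn_le nd (is_cvg_series_exp_coeff x) n.
by rewrite {1}seriesEord.
Qed.

Lemma exp_term x n : 0 <= x -> x ^+ n / n`!%:R <= expR x.
Proof.
move=> x0; apply: le_trans (exp_partial_sum n.+1 x0); rewrite big_ord_recr /= lerDr.
by apply: sumr_ge0 => i _; rewrite divr_ge0 // exprn_ge0.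
Qed.

Lemma ln_le_sub1 x : 0 < x -> ln x <= x - 1.
Proof. by move=> x0; rewrite -[x in ln x](subrKC 1); apply: le_ln1Dx; lra. Qed.

Lemma ln_ge_1subV x : 0 < x -> 1 - x^-1 <= ln x.
Proof.
move=> x0; have := @ln_le_sub1 x^-1; rewrite invr_gt0 => /(_ x0).
by rewrite lnV //; lra.
Qed.

Lemma ln_le_linear d x : 0 < d -> 0 < x -> ln x <= d * x - 1 - ln d.
Proof.
move=> d0 x0; rewrite lerBrDr -lnM 1?mulrC; [|exact: x0|exact: d0].
by apply: ln_le_sub1; rewrite mulr_gt0.
Qed.

Lemma ln_le_ex d : 0 < d -> exists C, 0 <= C /\ forall x, 0 < x -> ln x <= d * x + C.
Proof.
move=> d0; exists `|- 1 - ln d|; split=> // x x0.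
apply: le_trans (ln_le_linear d0 x0) _; rewrite -addrA lerD2l; exact: ler_norm.
Qed.

Lemma ln_fact_ge n : n%:R * ln n%:R - n%:R <= ln (n`!%:R) :> R.
Proof.
case: n => [|n]; first by rewrite mul0r subr0 fact0 ln1.
have h := @exp_term n.+1%:R n.+1 (ler0n _ _).
have f0 : (0 : R) < (n.+1)`!%:R by rewrite ltr0n fact_gt0.
have n0 : (0 : R) < n.+1%:R by rewrite ltr0n.
have p0 : (0 : R) < n.+1%:R ^+ n.+1 by rewrite exprn_gt0.
move: h; rewrite -ler_ln ?posrE ?expR_gt0 ?divr_gt0 // ln_div ?posrE // expRK lnXn //.
by rewrite mulr_natl; lra.
Qed.

Lemma ln_fact_le n :
  ln (n`!%:R) <= n%:R * ln n%:R - n%:R + 2 * ln (n.+1%:R) + 1 :> R.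
Proof.
elim: n => [|n IH]; first by rewrite fact0 !ln1 mul0r mulr0 subr0 !add0r.
case: n IH => [|n] IH.
  rewrite (_ : 1`! = 1)%N // ln1; have : (0 : R) <= ln 2%:R by apply: ln_ge0; rewrite ler1n.
  by lra.
have N0 : (0 : R) < n.+1%:R by rewrite ltr0n.
have N1 : (0 : R) < n.+2%:R by rewrite ltr0n.
have N2 : (0 : R) < n.+3%:R by rewrite ltr0n.
rewrite factS natrM lnM ?posrE // ?ltr0n ?fact_gt0 //.
set a := ln n.+1%:R in IH *; set b := ln n.+2%:R in IH *; set c := ln n.+3%:R.
have h1 : 1 - n.+1%:R / n.+2%:R <= b - a.
  by rewrite /a /b -ln_div ?posrE // -[n.+1%:R / _]invf_div; apply: ln_ge_1subV; rewrite divr_gt0.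
have h2 : 1 - n.+2%:R / n.+3%:R <= c - b.
  by rewrite /c /b -ln_div ?posrE // -[n.+2%:R / _]invf_div; apply: ln_ge_1subV; rewrite divr_gt0.
have E2 : n.+2%:R = n.+1%:R + 1 :> R by rewrite -[LHS]natr1.
have E3 : n.+3%:R = n.+1%:R + 2 :> R by rewrite -[LHS]natr1 E2; lra.
have h1' : n.+1%:R * (1 - n.+1%:R / n.+2%:R) <= n.+1%:R * (b - a).
  by rewrite ler_pM2l.
(* Once the differences of logarithms are bounded by [ln_ge_1subV], the induction step reduces to
   this rational inequality. *)
have key : 1 <= n.+1%:R * (1 - n.+1%:R / n.+2%:R) + 2 * (1 - n.+2%:R / n.+3%:R) :> R.
  rewrite E2 E3; set u := n.+1%:R in N0 *.
  have -> : u * (1 - u / (u + 1)) + 2 * (1 - (u + 1) / (u + 2)) = 1 + u / ((u + 1) * (u + 2)).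
    by field; rewrite !gt_eqF //; lra.
  by rewrite lerDl divr_ge0 // ?mulr_ge0; lra.
move: h1' h2 key IH; rewrite E2; set u := n.+1%:R; set r1 := u / (u + 1); set r2 := _ / n.+3%:R.
nra.
Qed.

End RealEstimates.

(** Applied with [u = beta k / 2] and [s = ln n], it replaces [ln k] by [ln (2 s / beta)] at a cost
    of [2 g]. *)
Lemma ln_ratio_le (R : realType) (u s g : R) : 0 < s -> 0 < g -> g <= 2^-1 ->
  s - g * s <= u -> u <= s + g * s -> `|ln (u / s)| <= 2 * g.
Proof.
move=> s0 g0 g2 u1 u2.
have z2 : 0 <= g * s * (1 - 2 * g).
  by rewrite mulr_ge0 ?mulr_ge0 ?(ltW g0) ?(ltW s0) //; clear - g2; lra.
have u0 : 0 < u.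
  have : g * s <= 2^-1 * s by rewrite ler_pM2r.
  by clear - s0 u1; lra.
have us0 : 0 < u / s by rewrite divr_gt0.
rewrite ler_norml; apply/andP; split.
  apply: le_trans (ln_ge_1subV us0); rewrite invf_div lerBrDr addrC -lerBrDr opprK.
  rewrite ler_pdivrMr //.
  have z1 : 0 <= g * (u - (s - g * s)) by rewrite mulr_ge0 ?(ltW g0) // subr_ge0.
  by clear - z1 z2 u1; lra.
apply: le_trans (ln_le_sub1 us0) _; rewrite lerBlDr ler_pdivrMr //.
have z1 : 0 <= g * s by rewrite mulr_ge0 // ltW.
by clear - z1 u2; lra.
Qed.

Lemma bern_card (R : realType) (I : finType) (p : R) (D X : {set I}) :
  p < 1 -> X \subset D -> bern p D X = (1 - p) ^+ #|D| * (p / (1 - p)) ^+ #|X|.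
Proof.
move=> p1 XD; have q0 : 1 - p != 0 by rewrite subr_eq0 eq_sym lt_eqF.
rewrite /bern (big_setID X) /= (setIidPr XD).
rewrite (eq_bigr (fun=> p)); last by move=> e ->.
rewrite [X in _ * X](eq_bigr (fun=> 1 - p)); last by move=> e; rewrite inE => /andP[/negPf ->].
rewrite !prodr_const cardsD (setIidPr XD) expr_div_n -[in RHS](subnK (subset_leq_card XD)) exprD.
by field; apply: expf_neq0.
Qed.

Lemma ffact_le_expn m n : (m ^_ n <= m ^ n)%N.
Proof.
elim: n => [|n IH]; first by rewrite ffactn0.
by rewrite ffactnSr expnSr leq_mul // leq_subr.
Qed.

(** * From half-edge counts to the probability of stability *)

Section CountBounds.
Variables (T : finType) (t : nat) (S : {set T}).
Let k := #|S|.
Let Z := half_edge_count t S.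
Let W := half_edge_weight t S.

(** Since [(t k - 2 m) ^ 2 <= 4 (uphalf (t k) - m) ^ 2], iterating the recursion gives a squared
    falling factorial; rounding up covers odd [t k]. *)
Lemma half_edge_count_upper m :
  (m`! * Z m <= 2 ^ m * (uphalf (t * k) ^_ m) ^ 2)%N.
Proof.
elim: m => [|m IH]; first by rewrite /Z half_edge_count0 ffactn0.
rewrite -(leq_pmul2l (isT : 0 < 2)%N) factS.
have h := half_edge_count_le t S m; rewrite -/k -/Z in h.
apply: (@leq_trans (m`! * (2 * m.+1 * Z m.+1))%N); first by rewrite [leqRHS]mulnC; lia.
apply: (@leq_trans (m`! * ((t * k - 2 * m) ^ 2 * Z m))%N); first by rewrite leq_mul2l h orbT.
apply: (@leq_trans ((t * k - 2 * m) ^ 2 * (2 ^ m * (uphalf (t * k) ^_ m) ^ 2))%N).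
  by rewrite [leqLHS]mulnCA leq_mul2l IH orbT.
rewrite ffactnSr expnMn (expnS 2 m).
have : ((t * k - 2 * m) ^ 2 <= 4 * (uphalf (t * k) - m) ^ 2)%N.
  rewrite (_ : 4 = 2 ^ 2)%N // -expnMn leq_exp2r //; lia.
move=> h2; apply: (@leq_trans (4 * (uphalf (t * k) - m) ^ 2 * (2 ^ m * (uphalf (t * k) ^_ m) ^ 2))%N).
  by rewrite leq_mul2r h2 orbT.
by apply: eq_leq; ring.
Qed.

(** The recursion factor is [r (r - (t + t * t))], so the product splits into two falling
    factorials, the second one shortened by the loss term. *)
Lemma half_edge_count_lower m M : M = ((t * k)./2 - (t + t * t))%N ->
  (2 ^ m * ((t * k)./2 ^_ m * M ^_ m) <= m`! * Z m)%N.
Proof.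
move=> ME; elim: m => [|m IH]; first by rewrite /Z half_edge_count0 !ffactn0.
have [Mm|mM] := leqP M m; first by rewrite (@ffact_small M) ?ltnS // !muln0.
rewrite -(leq_pmul2l (isT : 0 < 2)%N) factS.
have h := half_edge_count_ge t S m; rewrite -/k -/Z in h.
apply: (@leq_trans (m`! * (2 * m.+1 * Z m.+1))%N); last by rewrite [leqLHS]mulnC; lia.
set r := (t * k - 2 * m)%N in h.
apply: (@leq_trans (m`! * ((r ^ 2 - (t + t * t) * r) * Z m))%N); last first.
  by rewrite leq_mul2l; apply/orP; right; rewrite mulnBl leq_subLR addnC.
rewrite [leqRHS]mulnCA; apply: (@leq_trans ((r ^ 2 - (t + t * t) * r) * (2 ^ m * ((t * k)./2 ^_ m * M ^_ m)))%N); last first.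
  by rewrite leq_mul2l IH orbT.
rewrite !ffactnSr (expnS 2 m).
have : (4 * (((t * k)./2 - m) * (M - m)) <= r ^ 2 - (t + t * t) * r)%N.
  rewrite -mulnn -mulnBl (_ : 4 = 2 * 2)%N // mulnACA mulnC; apply: leq_mul; rewrite /r; lia.
move=> h2; apply: (@leq_trans (4 * (((t * k)./2 - m) * (M - m)) * (2 ^ m * ((t * k)./2 ^_ m * M ^_ m)))%N).
  by apply: eq_leq; ring.
by rewrite leq_mul2r h2 orbT.
Qed.

(** At a vertex of degree [d], [t! = t ^_ d * (t - d)!] and [(t - d)! <= t! ^ (t - d)], so the
    weight falls short of [t! ^ k] by at most a factor [t!] per free half-edge. Graphs with nearly
    [t k / 2] edges lose little. *)
Lemma stable_weight_ge (X : {set {set T}}) : X \subset pairs S -> stable t S X ->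
  (t`! ^ k <= t`! ^ (t * k - 2 * #|X|) * W X)%N.
Proof.
move=> XS; rewrite /stable (setIidPl XS) => /forall_inP h.
have W0 : (0 < W X)%N by rewrite /W prodn_cond_gt0 // => v vS; rewrite ffact_gt0 h.
rewrite -(sum_free_half_edges XS W0) expn_sum /W /half_edge_weight.
rewrite -big_split /= -prod_nat_const; apply: leq_prod => v vS.
rewrite mulnC -[leqLHS](ffact_fact (h v vS)) leq_mul2l; apply/orP; right.
case: (t - incidence X v)%N (leq_subr (incidence X v) t) => [|a] at_; first by rewrite fact0.
apply: (@leq_trans (t`!)); first exact: leq_fact.
by rewrite -[leqLHS]expn1; apply: leq_pexp2l; rewrite ?fact_gt0.
Qed.

Lemma stable_weight_le (X : {set {set T}}) : X \subset pairs S ->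
  (W X <= stable t S X * t`! ^ k)%N.
Proof.
move=> XS; have [->//|] := posnP (W X) => W0.
have -> : stable t S X.
  by rewrite /stable (setIidPl XS); apply/forall_inP => v vS; apply: half_edge_weight_gt0 W0 _ vS.
rewrite mul1n -prod_nat_const; apply: leq_prod => v vS.
have := half_edge_weight_gt0 W0 vS => /ffact_fact <-.
by rewrite leq_pmulr // fact_gt0.
Qed.

Variables (R : realType) (p q th : R).
Hypotheses (p01 : 0 < p < 1) (qE : q = 1 - p) (thE : th = p / q).
Let Pr := bexp p (pairs S) (fun X => (stable t S X)%:R).

Let q0 : 0 < q. Proof. by rewrite qE subr_gt0; case/andP: p01. Qed.
Let th0 : 0 < th. Proof. by case/andP: p01 => p0 _; rewrite thE divr_gt0. Qed.

Lemma sum_half_edge_weight N (F : nat -> R) : (forall X : {set {set T}}, X \subset pairs S -> (0 < W X)%N -> (#|X| < N)%N) ->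
  \sum_(X in powerset (pairs S)) F #|X| * (W X)%:R = \sum_(m < N) F m * (Z m)%:R.
Proof.
move=> hN; rewrite (eq_bigr (fun m : 'I_N => \sum_(X in powerset (pairs S) | #|X| == m) F #|X| * (W X)%:R)); last first.
  by move=> m _; rewrite natr_sum mulr_sumr; apply: eq_bigr => X /andP[_ /eqP ->].
rewrite (exchange_big_dep (mem (powerset (pairs S)))) /=; last by move=> m X _ /andP[].
apply: eq_bigr => X; rewrite powersetE => XP.
have [->|W0] := posnP (W X); first by rewrite mulr0 big1 // => m _; rewrite mulr0.
rewrite (big_pred1 (Ordinal (hN X XP W0))) // => m.
by rewrite /= XP andTb -val_eqE eq_sym.
Qed.

Lemma stable_bern_sum : Pr = q ^+ 'C(k, 2) *
  \sum_(X in powerset (pairs S)) th ^+ #|X| * (stable t S X)%:R.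
Proof.
rewrite /Pr /bexp mulr_sumr; apply: eq_bigr => X; rewrite powersetE => XS.
by rewrite bern_card ?card_pairs ?mulrA -?qE -?thE //; case/andP: p01.
Qed.

(* With [s = tau - m] missing edges, the sum over [m] is at most a sum of
   [x ^ s / (s!) ^ 2], which is bounded by splitting [x] as [(d * tau) * (x / (d * tau))]
   and using two exponential series. *)
Lemma stable_prob_upper (d : R) tau : tau = uphalf (t * k) -> 0 < d ->
  (t`!)%:R ^+ k * Pr <= q ^+ 'C(k, 2) * (2 * th) ^+ tau * tau`!%:R *
    expR (d * tau%:R + (t`!)%:R ^+ 2 / (2 * th * d)).
Proof.
move=> tauE d0; rewrite stable_bern_sum mulrCA -[leRHS]mulrA -[leRHS]mulrA ler_wpM2l ?exprn_ge0 ?(ltW q0) ?(ltW th0) //.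
pose F m : R := th ^+ m * (t`!)%:R ^+ (t * k - 2 * m).
have hN : forall X : {set {set T}}, X \subset pairs S -> (0 < W X)%N -> (#|X| < tau.+1)%N.
  move=> X XS W0; rewrite ltnS tauE.
  have : (2 * #|X| <= t * k)%N.
    rewrite -(sum_incidence XS) mulnC -sum_nat_const; apply: leq_sum => v vS.
    exact: half_edge_weight_gt0 W0 _ vS.
  lia.
apply: (@le_trans _ _ (\sum_(m < tau.+1) F m * (Z m)%:R)).
  rewrite -(sum_half_edge_weight F hN) mulr_sumr; apply: ler_sum => X; rewrite powersetE => XS.
  rewrite mulrCA -mulrA ler_wpM2l ?exprn_ge0 ?(ltW q0) ?(ltW th0) // /F.
  case: (boolP (stable t S X)) => st; last by rewrite mulr0 mulr_ge0 ?exprn_ge0.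
  by rewrite mulr1 -!natrX -natrM ler_nat; apply: stable_weight_ge.
set f : R := (t`!)%:R; have f1 : 1 <= f by rewrite ler1n fact_gt0.
set D := f ^+ 2 / (2 * th).
have f0 : 0 < f := lt_le_trans ltr01 f1.
have D0 : 0 < D by apply: divr_gt0; [exact: exprn_gt0|exact: mulr_gt0].
have term (m : 'I_tau.+1) : F m * (Z m)%:R <= (2 * th) ^+ tau * (tau`!%:R *
    ((d * tau%:R) ^+ (tau - m) / (tau - m)`!%:R * ((D / d) ^+ (tau - m) / (tau - m)`!%:R))).
  have mt : (m <= tau)%N by rewrite -ltnS.
  have Zm : (Z m)%:R <= 2 ^+ m * tau`!%:R * (tau%:R ^+ (tau - m) / (tau - m)`!%:R ^+ 2) :> R.
    have m0 : 0 < m`!%:R :> R by rewrite ltr0n fact_gt0.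
    have s0 : 0 < (tau - m)`!%:R :> R by rewrite ltr0n fact_gt0.
    rewrite mulrA ler_pdivlMr ?exprn_gt0 //.
    have : (Z m * (tau - m)`! ^ 2 <= 2 ^ m * tau`! * tau ^ (tau - m))%N.
      rewrite -(leq_pmul2l (fact_gt0 m)).
      have h := half_edge_count_upper m; rewrite -tauE in h.
      apply: (@leq_trans (2 ^ m * (tau ^_ m) ^ 2 * (tau - m)`! ^ 2)); first by rewrite mulnA leq_mul2r h orbT.
      rewrite -mulnA -expnMn ffact_fact // -mulnn.
      have -> : (m`! * (2 ^ m * tau`! * tau ^ (tau - m)) = 2 ^ m * (tau`! * (m`! * tau ^ (tau - m))))%N by ring.
      rewrite !leq_mul2l; apply/orP; right; apply/orP; right.
      rewrite -(ffact_fact (leq_subr m tau)) subKn // mulnC leq_mul2l; apply/orP; right.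
      exact: ffact_le_expn.
    by rewrite -(ler_nat R) !natrM !natrX -!mulrA.
  rewrite /F; apply: (@le_trans _ _ (th ^+ m * (f ^+ 2) ^+ (tau - m) * (Z m)%:R)).
    rewrite ler_wpM2r // ler_wpM2l ?exprn_ge0 ?(ltW q0) ?(ltW th0) // -exprM ler_weXn2l //.
    move: mt; have := tauE; lia.
  apply: (@le_trans _ _ (th ^+ m * (f ^+ 2) ^+ (tau - m) * (2 ^+ m * tau`!%:R * (tau%:R ^+ (tau - m) / (tau - m)`!%:R ^+ 2)))).
    by rewrite ler_wpM2l // mulr_ge0 ?exprn_ge0 ?(ltW q0) ?(ltW th0) ?(ltW f0).
  rewrite le_eqVlt; apply/orP; left; apply/eqP.
  have s0 : (tau - m)`!%:R != 0 :> R by rewrite pnatr_eq0 -lt0n fact_gt0.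
  have -> : (2 * th) ^+ tau = (2 * th) ^+ m * (2 * th) ^+ (tau - m) by rewrite -exprD subnKC.
  rewrite /D !(exprMn, exprVn).
  have d1 : d ^+ (tau - m) != 0 by rewrite expf_neq0 // gt_eqF.
  have th1 : th ^+ (tau - m) != 0 by rewrite expf_neq0 // gt_eqF.
  have two1 : (2 : R) ^+ (tau - m) != 0 by rewrite expf_neq0 // pnatr_eq0.
  by field; rewrite s0 d1 th1 two1.
apply: le_trans (ler_sum _ (fun i _ => term i)) _.
rewrite -!mulr_sumr ler_wpM2l ?exprn_ge0 ?mulr_ge0 ?(ltW q0) ?(ltW th0) //.
rewrite ler_wpM2l //.
have -> : f ^+ 2 / (2 * th * d) = D / d by rewrite /D; field; rewrite !gt_eqF.
rewrite expRD.
rewrite (reindex_inj rev_ord_inj) /=.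
under eq_bigr => i _ do rewrite subSS (subKn (ltnSE (ltn_ord i))).
have dt0 : 0 <= d * tau%:R by rewrite mulr_ge0 // ltW.
have Dd0 : 0 <= D / d by rewrite divr_ge0 // ltW.
(* The sum is the diagonal of a product of two partial exponential series with nonnegative terms. *)
apply: (@le_trans _ _ ((\sum_(i < tau.+1) (d * tau%:R) ^+ i / i`!%:R) * (\sum_(i < tau.+1) (D / d) ^+ i / i`!%:R))).
  rewrite mulr_suml; apply: ler_sum => i _; rewrite ler_wpM2l ?divr_ge0 ?exprn_ge0 //.
  rewrite (bigD1 i) //= lerDl; apply: sumr_ge0 => j _; rewrite divr_ge0 ?exprn_ge0 //.
by apply: ler_pM; rewrite ?exp_partial_sum //; apply: sumr_ge0 => j _; rewrite divr_ge0 ?exprn_ge0.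
Qed.

(** Only graphs with [tau - c] edges are kept, the largest number at which [half_edge_count_lower]
    is not void. Falling short of [tau] by the constant [c] costs a constant factor. *)
Lemma stable_prob_lower c tau : c = (t + t * t)%N -> tau = (t * k)./2 ->
  q ^+ 'C(k, 2) * (th ^+ (tau - c) * 2 ^+ (tau - c) * tau`!%:R) <=
  c`!%:R * (t`!)%:R ^+ k * Pr.
Proof.
move=> cE tauE; rewrite stable_bern_sum [leRHS]mulrCA ler_wpM2l ?exprn_ge0 ?(ltW q0) ?(ltW th0) //.
set M := (tau - c)%N.
have ZM : 2 ^+ M * tau`!%:R <= c`!%:R * (Z M)%:R :> R.
  rewrite -natrX -!natrM ler_nat.
  have h := half_edge_count_lower M (M := M); rewrite -tauE -cE ffactnn in h.
  have {}h := h erefl.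
  have {}h : (2 ^ M * tau ^_ M <= Z M)%N.
    by rewrite -(leq_pmul2l (fact_gt0 M)); apply: leq_trans h; lia.
  apply: (@leq_trans (c`! * (2 ^ M * tau ^_ M)))%N; last by rewrite leq_mul2l h orbT.
  have Mt : (M <= tau)%N by apply: leq_subr.
  rewrite -(ffact_fact Mt) [leqRHS]mulnCA leq_mul2l; apply/orP; right.
  rewrite [leqRHS]mulnC leq_mul2l; apply/orP; right; apply: leq_fact.
  by rewrite /M; lia.
apply: (@le_trans _ _ (th ^+ M * (c`!%:R * (Z M)%:R))).
  by rewrite -mulrA ler_wpM2l ?exprn_ge0 ?(ltW q0) ?(ltW th0).
rewrite mulrCA -mulrA ler_wpM2l //.
apply: (@le_trans _ _ (\sum_(X in powerset (pairs S) | #|X| == M) (t`!)%:R ^+ k * (th ^+ #|X| * (stable t S X)%:R))).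
  rewrite natr_sum mulr_sumr; apply: ler_sum => X /andP[]; rewrite powersetE => XS /eqP ->.
  rewrite mulrCA ler_wpM2l ?exprn_ge0 ?(ltW q0) ?(ltW th0) // -natrX -natrM ler_nat mulnC.
  exact: stable_weight_le.
rewrite mulr_sumr [leRHS](bigID (fun X : {set {set T}} => #|X| == M)) /= lerDl.
apply: sumr_ge0 => X _; rewrite !mulr_ge0 ?exprn_ge0 ?(ltW q0) ?(ltW th0) //.
Qed.

End CountBounds.

(** * The probability that a set is stable *)

(** [2 ^ n * n!] is the double factorial of [2 n]. Comparing its square with a factorial shows
    [ln (2 ^ tau * tau!)] to be half of [ln (t k)!] up to logarithmic terms, for either parity of
    [t k]. *)
Lemma double_fact_sqr_le n : ((2 ^ n * n`!) ^ 2 <= (2 * n).+1`!)%N.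
Proof.
elim: n => [|n IH]; first by [].
rewrite (expnS 2 n) factS.
have -> : ((2 * n.+1).+1 = (2 * n).+1.+2)%N by lia.
rewrite !(factS (_.+1)).
apply: (@leq_trans ((2 * n.+1) ^ 2 * (2 ^ n * n`!) ^ 2)); first by rewrite -expnMn leq_exp2r //; lia.
rewrite mulnA; apply: leq_mul => //; lia.
Qed.

Lemma double_fact_sqr_ge n : ((2 * n)`! <= (2 ^ n * n`!) ^ 2)%N.
Proof.
elim: n => [|n IH]; first by [].
rewrite (expnS 2 n) factS.
have -> : (2 * n.+1 = (2 * n).+2)%N by lia.
rewrite !factS.
apply: (@leq_trans ((2 * n.+1) ^ 2 * (2 ^ n * n`!) ^ 2)); last by rewrite -expnMn leq_exp2r //; lia.
rewrite mulnA; apply: leq_mul => //; lia.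
Qed.

Section StableProbability.
Variables (R : realType) (p q th beta : R) (t : nat).
Hypotheses (p01 : 0 < p < 1) (qE : q = 1 - p) (thE : th = p / q) (betaE : beta = - ln q).

(* [th] stands for the odds [p / (1 - p)]. At [t = 0] the junk value [ln 0 = 0] gives
   [kap th 0 = 0], which agrees with the convention [0 ^ 0 = 1] in [alpha]. *)
Definition kap (th : R) (t : nat) : R :=
  t%:R / 2 * (ln t%:R + ln th - 1) - ln (t`!%:R).

Definition stable_rate (beta th : R) (t : nat) (x : R) : R :=
  - beta * (x * (x - 1) / 2) + t%:R / 2 * (x * ln x) + kap th t * x.

Let h := stable_rate beta th t.

Definition stable_prob (T : finType) (S : {set T}) : R :=
  bexp p (pairs S) (fun X => (stable t S X)%:R).

Let q0 : 0 < q. Proof. by rewrite qE subr_gt0; case/andP: p01. Qed.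
Let th0 : 0 < th. Proof. by case/andP: p01 => p0 _; rewrite thE divr_gt0. Qed.

Lemma bin2_real (k : nat) : 'C(k, 2)%:R = k%:R * (k%:R - 1) / 2 :> R.
Proof.
case: k => [|k]; first by rewrite mul0r mul0r.
have : (2 * 'C(k.+1, 2) = k.+1 * k)%N by rewrite bin2 mul2n halfK oddM oddS andNb subn0.
move/(congr1 (fun n => n%:R : R)); rewrite !natrM.
have -> : k.+1%:R = k%:R + 1 :> R by rewrite natr1.
by lra.
Qed.

Lemma half_approx (m n : nat) : (uphalf n = m \/ n./2 = m) ->
  `| m%:R - n%:R / 2 | <= 1 :> R.
Proof.
move=> mn; rewrite ler_norml.
have : (2 * m <= n + 1)%N /\ (n <= 2 * m + 1)%N by lia.
by rewrite -!(ler_nat R) !(natrM, natrD) => -[]; lra.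
Qed.

(** Holds at [t = 0] as well, where both sides vanish whatever the value of [ln 0]. *)
Lemma xlnx_mul (k : nat) : (0 < k)%N ->
  (t * k)%:R * ln (t * k)%:R = t%:R * k%:R * ln t%:R + t%:R * (k%:R * ln k%:R) :> R.
Proof.
move=> k0; case: (posnP t) => [->|t0]; first by rewrite mul0n !mul0r addr0.
by rewrite natrM lnM ?posrE ?ltr0n //; ring.
Qed.

Lemma ln_double_fact_le (n : nat) (a : R) : a = ln (2 ^+ uphalf n * (uphalf n)`!%:R) ->
  2 * a <= n%:R * ln n%:R - n%:R + 4 * ln (n%:R + 2) + 1.
Proof.
move=> ->.
have f0 m : 0 < m`!%:R :> R by rewrite ltr0n fact_gt0.
have : ((2 ^+ uphalf n * (uphalf n)`!%:R) ^+ 2 : R) <= (n.+2)`!%:R.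
  rewrite -natrX -natrM -natrX ler_nat; apply: leq_trans (double_fact_sqr_le _) _.
  by apply: leq_fact; lia.
rewrite -ler_ln ?posrE ?exprn_gt0 ?mulr_gt0 ?exprn_gt0 // lnXn ?mulr_gt0 ?exprn_gt0 //.
rewrite !factS !natrM !lnM ?posrE ?mulr_gt0 ?ltr0n ?fact_gt0 //.
have := ln_fact_le R n; have : ln n.+1%:R <= ln n.+2%:R :> R by rewrite ler_ln ?posrE ?ltr0n // ler_nat.
by rewrite -[n%:R + 2]/(n%:R + 2%:R) -natrD addn2; lra.
Qed.

Lemma ln_double_fact_ge (n : nat) (a : R) : a = ln (2 ^+ n./2 * (n./2)`!%:R) ->
  n%:R * ln n%:R - n%:R - ln (n%:R + 2) <= 2 * a.
Proof.
move=> ->.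
have f0 m : 0 < m`!%:R :> R by rewrite ltr0n fact_gt0.
have : n`!%:R <= n.+1%:R * (2 ^+ n./2 * (n./2)`!%:R) ^+ 2 :> R.
  rewrite -natrX -natrM -natrX -natrM ler_nat.
  have := double_fact_sqr_ge n./2; rewrite mul2n.
  case: (boolP (odd n)) => on hn.
    rewrite -{1}(odd_double_half n) on add1n factS leq_mul //.
    by rewrite -{2}(odd_double_half n) on add1n.
  rewrite -{1}(odd_double_half n) (negPf on) add0n.
  by apply: leq_trans hn _; apply: leq_pmull.
have n1 : 0 < n.+1%:R :> R by rewrite ltr0n.
rewrite -ler_ln ?posrE ?mulr_gt0 ?exprn_gt0 ?mulr_gt0 ?exprn_gt0 //.
rewrite lnM ?posrE ?exprn_gt0 ?mulr_gt0 ?exprn_gt0 // lnXn ?mulr_gt0 ?exprn_gt0 //.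
have := ln_fact_ge R n; have : ln n.+1%:R <= ln n.+2%:R :> R by rewrite ler_ln ?posrE ?ltr0n // ler_nat.
by rewrite -[n%:R + 2]/(n%:R + 2%:R) -natrD addn2; lra.
Qed.

Lemma stable_prob_le d : 0 < d -> exists C, 0 <= C /\
  forall (T : finType) (S : {set T}), (0 < #|S|)%N ->
    stable_prob S <= expR (h #|S|%:R + d * #|S|%:R + C).
Proof.
(* The errors linear in [k] add up to at most [3 d' t k], which has to fit into [d k]; the [+ 1]
   keeps the divisor positive at [t = 0]. *)
move=> d0; set d' := d / (3 * t%:R + 1).
have t3 : 0 < 3 * t%:R + 1 :> R by rewrite ltr_wpDl // mulr_ge0.
have d'0 : 0 < d' by rewrite divr_gt0.
have [C' [C'0 hC']] := ln_le_ex d'0.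
set E := (t`!)%:R ^+ 2 / (2 * th * d').
have E0 : 0 <= E by rewrite divr_ge0 ?exprn_ge0 // !mulr_ge0 // ltW.
exists (2 * (2 * d' + C') + 2^-1 + `|ln th| + d' + E); split.
  by have := normr_ge0 (ln th); move: d'0 C'0 E0; lra.
move=> T S k0; set k := #|S| in k0 *.
have k0R : 0 < k%:R :> R by rewrite ltr0n.
set n := (t * k)%N; set tau := uphalf n.
have := stable_prob_upper p01 qE thE (erefl tau : tau = uphalf (t * #|S|)) d'0.
rewrite -/(stable_prob S) -/k -/E.
have f0 : 0 < (t`!)%:R ^+ k :> R by rewrite exprn_gt0 // ltr0n fact_gt0.
rewrite -ler_pdivlMl // => up; apply: le_trans up _.
rewrite ler_pdivrMl //.
have g0 : 0 < tau`!%:R :> R by rewrite ltr0n fact_gt0.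
rewrite -(mulrA (q ^+ _)).
have -> : (t`!)%:R ^+ k = expR (k%:R * ln (t`!%:R)) :> R.
  by rewrite expRM_natl lnK // posrE ltr0n fact_gt0.
have -> : q ^+ 'C(k, 2) = expR (- beta * 'C(k, 2)%:R).
  by rewrite expRM_natr betaE opprK lnK // posrE.
have -> : (2 * th) ^+ tau * tau`!%:R = expR (tau%:R * ln th + ln (2 ^+ tau * tau`!%:R)).
  rewrite expRD lnK ?posrE ?mulr_gt0 ?exprn_gt0 // expRM_natl lnK // exprMn.
  by rewrite -mulrA mulrCA.
rewrite -!expRD ler_expR.
set a := ln (2 ^+ tau * _).
have ha := ln_double_fact_le (erefl a).
have hn := xlnx_mul k0; rewrite -/n in hn.
have hC := hC' (n%:R + 2) ltac:(by rewrite ltr_wpDl).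
have ht := half_approx (or_introl (erefl tau) : uphalf n = tau \/ n./2 = tau).
have nE : n%:R = t%:R * k%:R :> R by rewrite natrM.
have hth : tau%:R * ln th <= n%:R / 2 * ln th + `|ln th|.
  rewrite -lerBlDl -mulrBl; apply: le_trans (ler_norm _) _.
  by rewrite normrM ler_piMl.
have hdt : d' * tau%:R <= d' * (n%:R / 2 + 1).
  by rewrite ler_pM2l //; move: ht; rewrite ler_norml; lra.
have hd : 3 * (d' * n%:R) <= d * k%:R.
  have -> : d = d' * (3 * t%:R + 1) by rewrite /d' divfK // gt_eqF.
  by have := mulr_gt0 d'0 k0R; rewrite nE; lra.
have hC2 := bin2_real k.
rewrite /h /stable_rate /kap.
have dn0 : 0 <= d' * n%:R by rewrite mulr_ge0 // ltW.
rewrite hC2; move: ha hC hth hdt hd hn dn0; rewrite nE.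
set lk := k%:R * ln k%:R; set lt := `|_|; set ll := ln (_ + 2); set fl := ln (t`!%:R).
lra.
Qed.

Lemma stable_prob_ge d : 0 < d -> exists C, 0 <= C /\
  forall (T : finType) (S : {set T}), (0 < #|S|)%N ->
    expR (h #|S|%:R - d * #|S|%:R - C) <= stable_prob S.
Proof.
move=> d0; set d' := d / (3 * t%:R + 1).
have t3 : 0 < 3 * t%:R + 1 :> R by rewrite ltr_wpDl // mulr_ge0.
have d'0 : 0 < d' by rewrite divr_gt0.
have [C' [C'0 hC']] := ln_le_ex d'0.
set c := (t + t * t)%N.
have l20 : 0 <= ln 2 :> R by apply: ln_ge0; rewrite ler1n.
have lc0 : 0 <= ln (c`!%:R) :> R by apply: ln_ge0; rewrite ler1n fact_gt0.
exists (2 * d' + C' + c%:R * ln 2 + (c%:R + 1) * `|ln th| + ln (c`!%:R)); split.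
  have := normr_ge0 (ln th); have : 0 <= c%:R :> R by []. move: d'0 C'0 lc0 l20; nra.
move=> T S k0; set k := #|S| in k0 *.
have k0R : 0 < k%:R :> R by rewrite ltr0n.
set n := (t * k)%N; set tau := n./2.
have := stable_prob_lower p01 qE thE (erefl c) (erefl tau : tau = (t * #|S|)./2).
rewrite -/(stable_prob S) -/k.
have f0 : 0 < (t`!)%:R ^+ k :> R by rewrite exprn_gt0 // ltr0n fact_gt0.
have c0 : 0 < c`!%:R :> R by rewrite ltr0n fact_gt0.
rewrite -ler_pdivrMl ?mulr_gt0 // => lo; apply: le_trans lo.
rewrite ler_pdivlMl ?mulr_gt0 //.
have g0 : 0 < tau`!%:R :> R by rewrite ltr0n fact_gt0.
have -> : (t`!)%:R ^+ k = expR (k%:R * ln (t`!%:R)) :> R.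
  by rewrite expRM_natl lnK // posrE ltr0n fact_gt0.
have -> : q ^+ 'C(k, 2) = expR (- beta * 'C(k, 2)%:R).
  by rewrite expRM_natr betaE opprK lnK // posrE.
set M := (tau - c)%N.
have -> : th ^+ M * 2 ^+ M * tau`!%:R = expR (M%:R * ln th + M%:R * ln 2 + ln (tau`!%:R)).
  by rewrite !expRD !expRM_natl !lnK ?posrE.
rewrite -[c`!%:R in leLHS]lnK ?posrE // -!expRD ler_expR.
have ha := ln_double_fact_ge (erefl (ln (2 ^+ tau * tau`!%:R))).
have l2 : ln (2 ^+ tau) = tau%:R * ln 2 :> R by rewrite lnXn // mulr_natl.
rewrite lnM ?posrE ?exprn_gt0 // l2 in ha.
have hn := xlnx_mul k0; rewrite -/n in hn.
have hC := hC' (n%:R + 2) ltac:(by rewrite ltr_wpDl).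
have ht := half_approx (or_intror (erefl tau) : uphalf n = tau \/ n./2 = tau).
have nE : n%:R = t%:R * k%:R :> R by rewrite natrM.
have hM : `|n%:R / 2 - M%:R| <= c%:R + 1 :> R.
  have : (tau <= M + c)%N /\ (M <= tau)%N by rewrite addnC -leq_subLR leqnn leq_subr.
  rewrite -!(ler_nat R) !natrD; move: ht; rewrite !ler_norml => + -[].
  lra.
have hth : n%:R / 2 * ln th - (c%:R + 1) * `|ln th| <= M%:R * ln th.
  rewrite lerBlDr -lerBlDl -mulrBl; apply: le_trans (ler_norm _) _.
  by rewrite normrM ler_wpM2r.
have h2 : tau%:R * ln 2 - c%:R * ln 2 <= M%:R * ln 2 :> R.
  have : (tau <= M + c)%N by rewrite addnC -leq_subLR.
  by rewrite -(ler_nat R) natrD -mulrBl => ?; rewrite ler_wpM2r // lerBlDr.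
have hd : 3 * (d' * n%:R) <= d * k%:R.
  have -> : d = d' * (3 * t%:R + 1) by rewrite /d' divfK // gt_eqF.
  by have := mulr_gt0 d'0 k0R; rewrite nE; lra.
have hC2 := bin2_real k.
rewrite /h /stable_rate /kap.
have dn0 : 0 <= d' * n%:R by rewrite mulr_ge0 // ltW.
rewrite expRK hC2; move: ha hC hth h2 hd hn dn0; rewrite nE.
set lk := k%:R * ln k%:R; set lt := `|_|; set ll := ln (_ + 2); set fl := ln (t`!%:R).

lra.
Qed.

End StableProbability.

(** * Existence of stable sets *)

Lemma bexp_imset (R : realType) (I J : finType) (p : R) (g : I -> J)
  (D : {set I}) (f : {set J} -> R) : {in D &, injective g} ->
  bexp p (g @: D) f = bexp p D (fun X => f (g @: X)).
Proof.
elim/finset_ind: D f => [|e D eD IH] f ginj; first by rewrite imset0 !bexp_set0 imset0.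
have gD : {in D &, injective g}.
  by move=> x y xD yD; apply: ginj; rewrite !inE ?xD ?yD orbT.
rewrite imsetU1 !bexpU1 //; last first.
  apply/negP => /imsetP[y yD /ginj]; rewrite !inE eqxx yD orbT => /(_ isT isT) ey.
  by rewrite -ey (negPf eD) in yD.
rewrite !IH //; congr (_ * _ + _); apply: eq_bexp => X _.
by rewrite imsetU1.
Qed.

Lemma bin2_double n : (2 * 'C(n, 2) = n * n.-1)%N.
Proof. by case: n => // n; rewrite bin2 mul2n halfK oddM oddS andNb subn0. Qed.

Section StablePairs.
Variables (R : realType) (p q th beta : R) (t : nat).
Hypotheses (p01 : 0 < p < 1) (qE : q = 1 - p) (thE : th = p / q) (betaE : beta = - ln q).
Let q0 : 0 < q. Proof. by rewrite qE subr_gt0; case/andP: p01. Qed.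
Let th0 : 0 < th. Proof. by case/andP: p01 => p0 _; rewrite thE divr_gt0. Qed.
Let p01' : 0 <= p <= 1. Proof. by case/andP: p01 => /ltW -> /ltW ->. Qed.
Variable T : finType.
Implicit Types S U : {set T}.

(** Matching the enumerations of [S] and [S'] gives a bijection that carries pairs to pairs and
    preserves incidences. *)
Lemma stable_prob_card (S S' : {set T}) : #|S| = #|S'| -> stable_prob p t S = stable_prob p t S'.
Proof.
move=> SS'.
have [x0 x0S|S0] := pickP (mem S); last first.
  have S00 : S = set0 by apply/setP => x; rewrite inE; apply: S0.
  by move: SS'; rewrite S00 cards0 => /esym /eqP; rewrite cards_eq0 => /eqP ->.
pose g x := nth x0 (enum S') (index x (enum S)).
have gS x : x \in S -> g x \in S'.
  by move=> xS; rewrite -mem_enum mem_nth // -cardE -SS' cardE index_mem mem_enum.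
have ginj : {in S &, injective g}.
  move=> x y xS yS /eqP; rewrite nth_uniq ?enum_uniq // -?cardE -?SS' ?cardE ?index_mem ?mem_enum //.
  by move/eqP => xy; rewrite -[x](nth_index x0 (s := enum S)) ?mem_enum // xy nth_index ?mem_enum.
have gSE : g @: S = S'.
  apply/eqP; rewrite eqEcard card_in_imset // SS' leqnn andbT.
  by apply/subsetP => _ /imsetP[x xS ->]; apply: gS.
pose h (e : {set T}) := g @: e.
have hinj : {in pairs S &, injective h}.
  move=> e e'; rewrite !inE => /andP[eS _] /andP[e'S _] hee.
  have hm (f : {set T}) x : f \subset S -> x \in S -> (x \in f) = (g x \in g @: f).
    move=> fS xS; apply/idP/imsetP => [xf|[y yf gxy]]; first by exists x.
    by rewrite (ginj _ _ xS (subsetP fS y yf) gxy).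
  apply/setP => x; case: (boolP (x \in S)) => [xS|xS].
    by rewrite (hm e) // (hm e') // -/(h e) hee.
  by rewrite (contraNF (subsetP eS x)) // (contraNF (subsetP e'S x)).
have hP : h @: pairs S = pairs S'.
  have hsub : h @: pairs S \subset pairs S'.
    apply/subsetP => f /imsetP[e + ->]; rewrite inE => /andP[eS e2].
    rewrite inE -gSE imsetS //= card_in_imset //.
    by move=> x y xe ye; apply: ginj; apply: (subsetP eS).
  by apply/eqP; rewrite eqEcard hsub card_in_imset // !card_pairs SS' leqnn.
rewrite /stable_prob -hP bexp_imset //; apply: eq_bexp => X XS; congr (_%:R).
have hX : h @: X \subset pairs S' by rewrite -hP imsetS.
rewrite /stable (setIidPl hX) (setIidPl XS) -gSE; congr nat_of_bool.
have inc v : v \in S -> incidence (h @: X) (g v) = incidence X v.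
  move=> vS; rewrite /incidence -(card_in_imset (f := h) (D := [set e in X | v \in e])); last first.
    by move=> e e'; rewrite !inE => /andP[/(subsetP XS) eP _] /andP[/(subsetP XS) e'P _]; apply: hinj.
  apply: eq_card => f; rewrite !inE; apply/andP/imsetP => [[/imsetP[e eX ->] /imsetP[w we gvw]]|[e]].
    exists e => //; rewrite inE eX /=.
    have := subsetP XS e eX; rewrite inE => /andP[/subsetP eS _].
    by rewrite (ginj _ _ vS (eS _ we) gvw).
  by rewrite inE => /andP[eX ve] ->; split; apply: imset_f.
apply/forall_inP/forall_inP => hh v.
  by case/imsetP => w wS ->; rewrite inc //; apply: hh.
by move=> vS; rewrite -inc //; apply: hh; apply: imset_f.
Qed.

Lemma stable_probE S : bexp p (pairs setT) (fun X => (stable t S X)%:R) = stable_prob p t S.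
Proof.
apply: bexp_depends; last by apply: pairs_mono; apply: subsetT.
by move=> X; rewrite stable_depends.
Qed.

Let both S S' := bexp p (pairs setT) (fun X => (stable t S X && stable t S' X)%:R).

(* Deleting the pairs common to [S] and [S'] makes the two events independent, and
   [S'] is stable after the deletion whenever none of these pairs is an edge. *)
Lemma both_small_le S S' :
  both S S' * q ^+ 'C(#|S :&: S'|, 2) <= stable_prob p t S * stable_prob p t S'.
Proof.
pose C := pairs (S :&: S').
pose g X : R := (stable t S' (X :\: C))%:R.
have gdep : depends_on (pairs S' :\: C) g.
  move=> X; congr (_%:R); rewrite /g [in LHS]stable_depends [in RHS]stable_depends.
  congr (nat_of_bool (stable t S' _)); apply/setP => e; rewrite !inE.
  by case: (e \in X); case: (_ \subset _); case: (_ \subset _); case: (_ == 2%N).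
have CP : C \subset pairs setT by apply: pairs_mono; apply: subsetT.
apply: (@le_trans _ _ (stable_prob p t S * bexp p (pairs setT) g * q ^+ #|C|)).
  rewrite card_pairs ler_wpM2r ?exprn_ge0 ?(ltW q0) // -stable_probE.
  rewrite -(bexp_indep p _ (A := pairs S) (B := pairs S' :\: C)) //.
  - apply: ler_bexp => // X _; rewrite /g -natrM mulnb ler_nat.
    case: (stable t S X) => //=; case: (boolP (stable t S' X)) => // h.
    by rewrite (stable_decreasing (subsetDl _ _) h).
  - by rewrite -setI_eq0 setIDA -/C pairsI setDv.
  by move=> X; rewrite {1}stable_depends.
rewrite -mulrA ler_wpM2l //; first by apply: bexp_ge0.
have := bexp_expr_cardI p 0 CP; rewrite mulr0 add0r -qE => <-.
rewrite -(bexp_indep p _ (A := pairs S' :\: C) (B := C)) // -?stable_probE.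
- apply: ler_bexp => // X _; rewrite /g expr0n cards_eq0.
  case: eqP => XC; last by rewrite mulr0.
  rewrite mulr1 (_ : X :\: C = X) //; apply/setP => e; rewrite inE.
  by have /setP/(_ e) := XC; rewrite !inE; case: (e \in X) => /= [->|] //; rewrite andbF.
- by rewrite -setI_eq0 setIDAC -setIDA setDv setI0.
by move=> X; rewrite -setIA setIid.
Qed.

(* If [S'] is stable then at most [t * (k - l)] edges touch [S' :\: S]; the bound is
   Chernoff's with tilt [1 / k]. *)
Lemma both_large_le S S' (k l : nat) : #|S'| = k -> (0 < k)%N -> #|S :&: S'| = l ->
  both S S' <= stable_prob p t S * ((k%:R ^+ t * expR th) ^+ (k - l) * q ^+ ('C(k, 2) - 'C(l, 2))).
Proof.
move=> kE k0 lE; pose N := S' :\: S.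
pose Q := pairs S' :\: pairs (S :&: S').
have cN : #|N| = (k - l)%N by rewrite cardsD setIC lE kE.
have cQ : #|Q| = ('C(k, 2) - 'C(l, 2))%N.
  rewrite cardsD card_pairs kE (setIidPr _) ?card_pairs ?lE //.
  by apply: pairs_mono; apply: subsetIr.
have QP : Q \subset pairs setT.
  by apply: subset_trans (subsetDl _ _) (pairs_mono (subsetT _)).
have QN e : e \in Q -> (0 < \sum_(v in N) (v \in e))%N.
  rewrite inE => /andP[+ eS']; rewrite inE negb_and; move: (eS'); rewrite inE => /andP[eS0 ->].
  rewrite orbF => /subsetPn[v ve vSS]; rewrite (bigD1 v) /= ?ve //.
  by rewrite inE; move: vSS; rewrite inE (subsetP eS0 v ve) andbT => ->.
have NE (Y : {set {set T}}) : Y \subset Q -> (#|Y| <= \sum_(v in N) incidence Y v)%N.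
  move=> YQ; under eq_bigr => v _ do rewrite /incidence -sum1dep_card big_mkcondr /=.
  rewrite exchange_big /= -sum1_card; apply: leq_sum => e eY.
  apply: leq_trans (QN e (subsetP YQ e eY)) _; apply: leq_sum => v _; by case: (v \in e).
have kR : 0 < k%:R :> R by rewrite ltr0n.
pose z : R := k%:R^-1.
have z0 : 0 < z by rewrite invr_gt0.
have z1 : z <= 1 by rewrite invf_le1 // ler1n.
pose g X := k%:R ^+ (t * (k - l)) * z ^+ #|X :&: Q|.
have gE : bexp p (pairs setT) g <= (k%:R ^+ t * expR th) ^+ (k - l) * q ^+ ('C(k, 2) - 'C(l, 2)).
  rewrite bexpZ bexp_expr_cardI // -qE cQ.
  have -> : p * z + q = (1 + th * z) * q by rewrite thE; field; rewrite !gt_eqF.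
  rewrite !exprMn mulrA ler_wpM2r ?exprn_ge0 ?(ltW q0) // -exprM ler_wpM2l ?exprn_ge0 //.
  apply: (@le_trans _ _ (expR (th * z) ^+ ('C(k, 2) - 'C(l, 2)))).
    by rewrite lerXn2r ?nnegrE ?expR_ge0 ?expR_ge1Dx // addr_ge0 // mulr_ge0 // ltW.
  rewrite -!expRM_natl ler_expR mulrCA [leRHS]mulrC ler_wpM2l ?(ltW th0) //.
  rewrite ler_pdivrMr // -natrM ler_nat.
  have lk : (l <= k)%N by rewrite -lE -kE subset_leq_card ?subsetIr.
  rewrite leq_subLR; have := bin2_double k; have := bin2_double l.
  case: (k) lk => [|k'] /=; first by rewrite bin0n.
  case: (l) => [|l'] /=; nia.
rewrite -stable_probE; apply: (@le_trans _ _ (bexp p (pairs setT) (fun X => (stable t S X)%:R * g X))).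
  apply: ler_bexp => // X _; rewrite /g -mulnb natrM ler_wpM2l //.
  case: (boolP (stable t S' X)) => [h|_]; last by rewrite mulr_ge0 ?exprn_ge0 // ltW.
  have hle : (#|X :&: Q| <= t * (k - l))%N.
    apply: leq_trans (NE _ (subsetIr _ _)) _; rewrite -cN mulnC -sum_nat_const.
    apply: leq_sum => v; rewrite inE => /andP[_ vS'].
    have /forall_inP/(_ v vS') := h; apply: leq_trans; apply: incidence_mono.
    by apply: setIS; apply: subsetDl.
  rewrite -(subnKC hle) exprD mulrAC -exprMn divff ?gt_eqF // expr1n mul1r.
  by rewrite exprn_ege1 // ler1n.
rewrite (bexp_indep p _ (A := pairs S) (B := Q)).
- by rewrite stable_probE ler_wpM2l // bexp_ge0.
- by rewrite -setI_eq0 setIDA pairsI setDv.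
- by move=> X; rewrite {1}stable_depends.
by move=> X; rewrite /g -setIA setIid.
Qed.

End StablePairs.

Lemma bin_le_expn m n : ('C(m, n) <= m ^ n)%N.
Proof.
apply: leq_trans (ffact_le_expn m n); rewrite -bin_ffact.
by rewrite leq_pmulr // fact_gt0.
Qed.

(** The ratio of the binomials is the product of [(k - i) / (m - i)] over [i < l], each factor being
    at most [k / m]. *)
Lemma bin_sub_ratio m k l : (l <= k)%N -> (k <= m)%N ->
  ('C(m - l, k - l) * m ^ l <= 'C(m, k) * k ^ l)%N.
Proof.
elim: l => [|l IH] lk km; first by rewrite !subn0.
have ml : (0 < m - l)%N by rewrite subn_gt0 (leq_trans lk).
rewrite -(leq_pmul2l ml).
have E : ((m - l) * 'C(m - l.+1, k - l.+1) = (k - l) * 'C(m - l, k - l))%N.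
  by rewrite !subnS mul_bin_diag prednK ?subn_gt0.
have := IH (ltnW lk) km; set B := 'C(m - l, k - l) in E *; set B' := 'C(m - l.+1, _) in E *.
set M := 'C(m, k) => h.
have -> : ((m - l) * (B' * m ^ l.+1) = (k - l) * m * (B * m ^ l))%N.
  by rewrite mulnA E expnS; ring.
apply: (@leq_trans ((k - l) * m * (M * k ^ l))%N); first by rewrite leq_mul2l h orbT.
rewrite expnS (_ : (m - l) * (M * (k * k ^ l)) = (m - l) * k * (M * k ^ l))%N; last by ring.
by rewrite leq_mul2r; apply/orP; right; nia.
Qed.

(** * Janson's inequality for the stable [k]-subsets of a vertex set *)

Section JansonStable.
Variables (R : realType) (p q th beta : R) (t : nat).
Hypotheses (p01 : 0 < p < 1) (qE : q = 1 - p) (thE : th = p / q) (betaE : beta = - ln q).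
Let q0 : 0 < q. Proof. by rewrite qE subr_gt0; case/andP: p01. Qed.
Let p01' : 0 <= p <= 1. Proof. by case/andP: p01 => /ltW -> /ltW ->. Qed.
Variable T : finType.
Implicit Types S U : {set T}.

Definition ksubsets U (k : nat) : {set {set T}} := [set S : {set T} | (S \subset U) && (#|S| == k)].

Lemma card_ksubsets_meet U S k l : S \in ksubsets U k ->
  (#|[set S' in ksubsets U k | #|S :&: S'| == l]| <= 'C(k, l) * 'C(#|U| - k, k - l))%N.
Proof.
rewrite inE => /andP[SU /eqP Sk].
have <- : #|setX (ksubsets S l) (ksubsets (U :\: S) (k - l))| = ('C(k, l) * 'C(#|U| - k, k - l))%N.
  by rewrite cardsX !cards_draws cardsD (setIidPr SU) Sk.
pose f (S' : {set T}) := (S :&: S', S' :\: S).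
rewrite -(card_in_imset (f := f)); last first.
  by move=> S1 S2 _ _ [h1 h2]; rewrite -(setID S1 S) -(setID S2 S) ![_ :&: S]setIC h1 h2.
apply: subset_leq_card; apply/subsetP => _ /imsetP[S' + ->].
rewrite !inE => /andP[/andP[S'U /eqP S'k] /eqP Sl] /=.
by rewrite subsetIl Sl eqxx setSD //= cardsD setIC Sl S'k eqxx.
Qed.

Let qn n : q ^+ n = expR (- (beta * n%:R)).
Proof. by rewrite betaE mulNr opprK expRM_natr lnK. Qed.

(** Sets meeting in at most one vertex share no pair and do not enter. For a fixed set, an overlap
    [2 <= l <= l0] contributes at most [N P ^ 2 x ^ l] by [both_small_le], and [l > l0] at most
    [P y ^ (k - l)] by [both_large_le]. As [x] and [y] are at most 1, the extreme cases [x ^ 2] and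
    [y] bound all of the at most [k] levels. *)
Lemma janson_stable U (m k l0 : nat) (rho nu x y : R) :
  #|U| = m -> (0 < k)%N -> (k <= m)%N ->
  (forall S, #|S| = k -> rho <= stable_prob p t S) ->
  0 < nu -> nu <= 'C(m, k)%:R * rho ->
  k%:R ^+ 2 / m%:R * expR (beta * l0%:R / 2) <= x -> x <= 1 ->
  k%:R * m%:R * (k%:R ^+ t * expR th) * expR (- (beta * (k + l0)%:R / 2)) <= y -> y <= 1 ->
  bexp p (pairs [set: T]) (fun X => [forall S in ksubsets U k, ~~ stable t S X]%:R) <=
    expR (- nu + nu ^+ 2 * (k%:R * x ^+ 2) + nu * (k%:R * y)).
Proof.
move=> Um k0 km rhoP nu0 nuN hx x1 hy y1.
set F := ksubsets U k.
have FE : #|F| = 'C(m, k) by rewrite /F /ksubsets cards_draws Um.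
have [S0 S0F] : exists S0, S0 \in F.
  by apply/set0Pn; rewrite -card_gt0 FE bin_gt0.
have cF S : S \in F -> #|S| = k by rewrite inE => /andP[_ /eqP].
set P := stable_prob p t S0; set N : R := 'C(m, k)%:R.
have PF S : S \in F -> stable_prob p t S = P.
  by move=> SF; apply: stable_prob_card; rewrite !cF.
have N0 : 0 < N by rewrite ltr0n bin_gt0.
have nuNP : nu <= N * P.
  by apply: le_trans nuN _; rewrite ler_wpM2l ?(ltW N0) // rhoP // cF.
have NP0 : 0 < N * P by apply: lt_le_trans nuNP.
have P0 : 0 < P by rewrite pmulr_rgt0 in NP0.
have beta0 : 0 < beta.
  by rewrite betaE oppr_gt0 ln_lt0 // q0 /= qE; case/andP: p01 => ? ?; lra.
have m0 : 0 < m%:R :> R by rewrite ltr0n (leq_trans k0).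
have k0R : 0 < k%:R :> R by rewrite ltr0n.
have x0 : 0 <= x by apply: le_trans hx; rewrite mulr_ge0 ?expR_ge0 // divr_ge0 ?exprn_ge0.
have y0 : 0 <= y.
  by apply: le_trans hy; rewrite mulr_ge0 ?expR_ge0 // mulr_ge0 ?mulr_ge0 ?expR_ge0 ?exprn_ge0.
pose both S S' := bexp p (pairs [set: T]) (fun X => (stable t S X && stable t S' X)%:R).
have level S (l : nat) : S \in F -> (1 < l < k)%N ->
    \sum_(S' in F | #|S :&: S'| == l) both S S' <= N * P ^+ 2 * x ^+ 2 + P * y.
  move=> SF /andP[l1 lk].
  have := card_ksubsets_meet l SF; rewrite Um => cnt.
  have bnd b : 0 <= b -> (forall S', S' \in F -> #|S :&: S'| = l -> both S S' <= b) ->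
      \sum_(S' in F | #|S :&: S'| == l) both S S' <= ('C(k, l) * 'C(m - k, k - l))%:R * b.
    move=> b0 hb; apply: (@le_trans _ _ (\sum_(S' in F | #|S :&: S'| == l) b)).
      by apply: ler_sum => S' /andP[S'F /eqP]; apply: hb.
    rewrite sumr_const -[leLHS]mulr_natl ler_wpM2r // ler_nat; apply: leq_trans cnt.
    by apply: subset_leq_card; apply/subsetP => S' hS'; rewrite inE; exact: hS'.
  have [ll0|ll0] := leqP l l0.
    apply: (@le_trans _ _ (('C(k, l) * 'C(m - k, k - l))%:R * (P ^+ 2 * expR (beta * 'C(l, 2)%:R)))).
      apply: bnd => [|S' S'F lE]; first by rewrite mulr_ge0 ?expR_ge0 ?exprn_ge0 ?(ltW P0).
      have := both_small_le t p01 qE S S'; rewrite lE !PF // -expr2 qn expRN.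
      by rewrite ler_pdivrMr ?expR_gt0.
    apply: (@le_trans _ _ (N * P ^+ 2 * x ^+ 2)); last by rewrite lerDl mulr_ge0 // ltW.
    have hb : ('C(k, l) * 'C(m - k, k - l))%:R <= N * (k%:R ^+ 2 / m%:R) ^+ l.
      rewrite expr_div_n mulrA ler_pdivlMr ?exprn_gt0 // /N -!natrX -!natrM ler_nat.
      apply: (@leq_trans (k ^ l * ('C(m - l, k - l) * m ^ l))%N).
        rewrite -!mulnA leq_mul ?bin_le_expn // leq_mul2r leq_bin2l ?orbT //.
        by rewrite leq_sub2l // ltnW.
      rewrite -expnM mul2n -addnn expnD [leqRHS]mulnCA leq_mul2l; apply/orP; right.
      by apply: bin_sub_ratio => //; apply: ltnW.
    have hx2 : (k%:R ^+ 2 / m%:R) ^+ l * expR (beta * 'C(l, 2)%:R) <= x ^+ 2.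
      have -> : expR (beta * 'C(l, 2)%:R) = expR (beta * (l%:R - 1) / 2) ^+ l.
        by rewrite -expRM_natl bin2_real; congr expR; field.
      rewrite -exprMn; apply: (@le_trans _ _ (x ^+ l)).
        rewrite lerXn2r ?nnegrE ?mulr_ge0 ?expR_ge0 // ?divr_ge0 ?exprn_ge0 //.
        apply: le_trans hx; rewrite ler_wpM2l ?divr_ge0 ?exprn_ge0 // ler_expR.
        rewrite ler_pM2r // ler_pM2l //.
        by have : l%:R <= l0%:R :> R by [rewrite ler_nat]; lra.
      by apply: ler_wiXn2l => //.
    apply: (@le_trans _ _ (N * (k%:R ^+ 2 / m%:R) ^+ l * (P ^+ 2 * expR (beta * 'C(l, 2)%:R)))).
      by rewrite ler_wpM2r // mulr_ge0 ?exprn_ge0 ?expR_ge0 // ltW.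
    rewrite -[leLHS]mulrA -[leRHS]mulrA ler_wpM2l ?(ltW N0) // mulrCA.
    by rewrite ler_wpM2l // exprn_ge0 // ltW.
  pose K := k%:R ^+ t * expR th.
  have K0 : 0 <= K by rewrite mulr_ge0 ?exprn_ge0 ?expR_ge0.
  have C2 : ('C(k, 2) - 'C(l, 2))%:R = (k - l)%:R * ((k%:R + l%:R - 1) / 2) :> R.
    by rewrite natrB ?(leq_bin2l _ (ltnW lk)) // !bin2_real natrB ?(ltnW lk) //; field.
  apply: (@le_trans _ _ (('C(k, l) * 'C(m - k, k - l))%:R * (P * (K ^+ (k - l) * q ^+ ('C(k, 2) - 'C(l, 2)))))).
    apply: bnd => [|S' S'F lE]; first by rewrite !mulr_ge0 ?exprn_ge0 ?(ltW P0) ?(ltW q0).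
    by have := both_large_le t p01 qE thE (cF _ S'F) k0 lE; rewrite PF.
  apply: (@le_trans _ _ (P * y)); last by rewrite lerDr mulr_ge0 // ?mulr_ge0 ?exprn_ge0 ?(ltW P0) ?(ltW N0).
  rewrite mulrCA ler_wpM2l ?(ltW P0) //.
  have hb : ('C(k, l) * 'C(m - k, k - l))%:R <= (k%:R * m%:R) ^+ (k - l) :> R.
    rewrite -natrM -natrX ler_nat expnMn leq_mul //.
      by rewrite -(bin_sub (ltnW lk)) bin_le_expn.
    by apply: leq_trans (bin_le_expn _ _) _; rewrite leq_exp2r ?subn_gt0 // leq_subr.
  apply: (@le_trans _ _ ((k%:R * m%:R) ^+ (k - l) * (K ^+ (k - l) * q ^+ ('C(k, 2) - 'C(l, 2))))).
    by rewrite ler_wpM2r // mulr_ge0 ?exprn_ge0 ?(ltW q0).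
  rewrite qn C2 (mulrCA beta) -mulrN expRM_natl -!exprMn mulrA.
  apply: (@le_trans _ _ (y ^+ (k - l))); last first.
    by rewrite -[leRHS]expr1; apply: ler_wiXn2l => //; rewrite subn_gt0.
  rewrite lerXn2r ?nnegrE ?mulr_ge0 ?expR_ge0 //.
  apply: le_trans hy; rewrite -/K ler_wpM2l ?mulr_ge0 // ler_expR lerN2 -mulrA ler_pM2l //.
  rewrite ler_pM2r // natrD; have : l0.+1%:R <= l%:R :> R by rewrite ler_nat.
  by rewrite -(natr1 l0); lra.
have inner S : S \in F -> \sum_(S' in F | (S' != S) && ~~ [disjoint pairs S & pairs S']) both S S' <=
    k%:R * (N * P ^+ 2 * x ^+ 2 + P * y).
  move=> SF.
  have b0 S' : 0 <= both S S' by apply: bexp_ge0 => // X _; rewrite ler0n.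
  apply: (@le_trans _ _ (\sum_(l < k | (1 < l)%N) \sum_(S' in F | #|S :&: S'| == l) both S S')).
    rewrite (exchange_big_dep (mem F)) /=; last by move=> l S' _ /andP[].
    rewrite [leLHS]big_mkcondr /=; apply: ler_sum => S' S'F; case: ifP => [/andP[ne dis]|_]; last first.
      by apply: sumr_ge0 => l _.
    have l1 : (1 < #|S :&: S'|)%N.
      move: dis; rewrite -setI_eq0 pairsI -card_gt0 card_pairs.
      by case: (#|_|) => [|[|]].
    have lk : (#|S :&: S'| < k)%N.
      rewrite -(cF S SF) proper_card // properE subsetIl /=; apply: contra ne => SS.
      rewrite eq_sym eqEcard (cF S) // (cF S') // leqnn andbT.
      by apply: subset_trans SS (subsetIr _ _).
    rewrite (bigD1 (Ordinal lk)) /=; last by rewrite l1 S'F eqxx.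
    by rewrite lerDl; apply: sumr_ge0.
  apply: (@le_trans _ _ (\sum_(l < k | (1 < l)%N) (N * P ^+ 2 * x ^+ 2 + P * y))).
    by apply: ler_sum => l l1; apply: level => //; rewrite l1 ltn_ord.
  rewrite sumr_const -[leLHS]mulr_natl ler_wpM2r //.
    by rewrite addr_ge0 ?mulr_ge0 ?exprn_ge0 ?(ltW P0) ?(ltW N0).
  rewrite ler_nat -[leqRHS](card_ord k) -[leqRHS]cardsT -cardsE; apply: subset_leq_card.
  exact: subsetT.
(* The sampling rate at which the expected number of sampled stable sets is [nu]. *)
pose r := nu / (N * P).
have r01 : 0 <= r <= 1 by rewrite divr_ge0 ?(ltW nu0) ?(ltW NP0) // ler_pdivrMr // mul1r.
apply: le_trans (@janson_sampled R _ {set T} p (pairs [set: T]) (stable t) (@pairs T) p01'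
  (@stable_decreasing T t) (@stable_depends T t) F r r01) _.
rewrite ler_expR.
have -> : \sum_(S in F) bexp p (pairs [set: T]) (fun X => (stable t S X)%:R) = N * P.
  rewrite (eq_bigr (fun=> P)); first by rewrite sumr_const FE -[LHS]mulr_natl.
  by move=> S SF; rewrite stable_probE PF.
have rNP : r * (N * P) = nu by rewrite divfK // gt_eqF.
rewrite rNP -addrA lerD2l.
apply: (@le_trans _ _ (r ^+ 2 * (N * (k%:R * (N * P ^+ 2 * x ^+ 2 + P * y))))).
  rewrite ler_wpM2l ?sqr_ge0 //.
  apply: (@le_trans _ _ (\sum_(S in F) (k%:R * (N * P ^+ 2 * x ^+ 2 + P * y)))).
    by apply: ler_sum => S SF; apply: inner.
  by rewrite sumr_const FE -[leLHS]mulr_natl.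
have -> : r ^+ 2 * (N * (k%:R * (N * P ^+ 2 * x ^+ 2 + P * y))) =
   (r * (N * P)) ^+ 2 * (k%:R * x ^+ 2) + (r * (N * P)) * (r * (k%:R * y)) by ring.
rewrite rNP lerD2l ler_wpM2l ?(ltW nu0) //.
by rewrite ler_piMl ?mulr_ge0 //; case/andP: r01.
Qed.

End JansonStable.

(** * Eventual inequalities in the variable [s = ln n], and [alpha] as a function of it *)

Section Eventually.
Variable R : realType.
Implicit Types P Q : R -> Prop.

Definition ev P := exists s0, forall s, s0 <= s -> P s.

Lemma ev_and P Q : ev P -> ev Q -> ev (fun s => P s /\ Q s).
Proof.
move=> [a ha] [b hb]; exists (Num.max a b) => s; rewrite ge_max => /andP[sa sb].
by split; [apply: ha|apply: hb].
Qed.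

Lemma ev_imp P Q : (forall s, P s -> Q s) -> ev P -> ev Q.
Proof. by move=> h [a ha]; exists a => s /ha /h. Qed.

Lemma ev_ge c : ev (fun s => c <= s).
Proof. by exists c. Qed.

Lemma ev_linear (g c : R) : 0 < g -> ev (fun s => c <= g * s).
Proof.
by move=> g0; exists (c / g) => s; rewrite ler_pdivrMr // mulrC.
Qed.

Lemma ev_ln (g c : R) : 0 < g -> ev (fun s => ln s + c <= g * s).
Proof.
move=> g0; have g2 : 0 < g / 2 by rewrite divr_gt0.
have [C [C0 hC]] := ln_le_ex g2.
have := ev_and (ev_ge 1) (ev_linear (C + c) g2); apply: ev_imp => s [s1 h].
have s0 : 0 < s by lra.
by have := hC s s0; lra.
Qed.

Lemma ev_lnM (M g c : R) : 0 <= M -> 0 < g -> ev (fun s => M * ln s + c <= g * s).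
Proof.
move=> M0 g0; have M1 : 0 < M + 1 by lra.
have g2 : 0 < g / (M + 1) by rewrite divr_gt0.
have := ev_and (ev_ge 1) (ev_ln (`|c| / (M + 1)) g2); apply: ev_imp => s [s1 h].
have := ln_ge0 s1; have := ler_norm c; have := normr_ge0 c.
move: h; rewrite -(ler_pM2l M1) mulrDr !mulrA [(M + 1) * g / _]mulrAC [(M + 1) * `|c| / _]mulrAC divff ?gt_eqF // !mul1r.
nra.
Qed.

Lemma ev_ln_nat P : ev P -> exists N : nat, forall n, (N <= n)%N -> P (ln n%:R).
Proof.
move=> [a ha]; exists (Num.truncn (expR a)).+1 => n hn; apply: ha.
have h : expR a <= n%:R.
  apply: ltW; apply: lt_le_trans (truncnS_gt (expR a)) _.
  by rewrite ler_nat.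
rewrite -[a]expRK ler_ln ?posrE ?expR_gt0 //.
exact: lt_le_trans (expR_gt0 a) h.
Qed.

End Eventually.

Section Alpha.
Variables (R : realType) (p q th beta : R) (t : nat).
Hypotheses (p01 : 0 < p < 1) (qE : q = 1 - p) (thE : th = p / q) (betaE : beta = - ln q).

(* [alpha] as a function of [s = ln n]. *)
Definition alpha_log (beta th : R) (t : nat) (s : R) : R :=
  1 + 2 / beta * (s + (t%:R / 2 - 1) * ln (2 * s / beta) + kap th t + 1).

Let a := alpha_log beta th t.
Let D : R := t%:R / 2 - 1.

Let q0 : 0 < q. Proof. by rewrite qE subr_gt0; case/andP: p01. Qed.
Let th0 : 0 < th. Proof. by case/andP: p01 => p0 _; rewrite thE divr_gt0. Qed.
Let beta0 : 0 < beta.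
Proof. by rewrite betaE oppr_gt0 ln_lt0 // q0 /= qE; case/andP: p01 => ? ?; lra. Qed.

Lemma ln_base : ln (base p) = beta.
Proof. by rewrite /base -qE ln_div ?posrE // ln1 sub0r betaE. Qed.

Lemma alphaE (n : nat) : (2 < n)%N -> alpha t p n = a (ln n%:R).
Proof.
move=> n2; rewrite /alpha /a /alpha_log /logb ln_base /kap.
have n0 : 0 < n%:R :> R by rewrite ltr0n (leq_trans _ n2).
have ln0' : 0 < ln n%:R :> R by rewrite ln_gt0 // ltr1n (leq_trans _ n2).
have f0 : 0 < t`!%:R :> R by rewrite ltr0n fact_gt0.
have bp : 2 * base p * p / expR 1 = 2 * th / expR 1.
  by rewrite /base -qE thE; field; rewrite expR_eq0 gt_eqF.
have tt0 : 0 < t%:R ^+ t :> R.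
  by case: (posnP t) => [->|t0]; rewrite ?expr0 // exprn_gt0 // ltr0n.
rewrite bp !ln_div ?posrE ?tt0 ?divr_gt0 ?mulr_gt0 ?expR_gt0 ?exprn_gt0 //.
rewrite !lnM ?posrE // expRK.
have -> : ln (t%:R ^+ t) = t%:R * ln t%:R :> R.
  by case: (posnP t) => [->|t0]; rewrite ?expr0 ?ln1 ?mul0r // lnXn ?ltr0n // mulr_natl.
by field; rewrite gt_eqF.
Qed.

(** The equation that defines [alpha]: by Stirling the expected number of stable [k]-sets is, to
    leading order, [exp (k (s + kap + 1 + D ln k - beta (k - 1) / 2))], and the bracket vanishes at
    [k = a s] once [ln k] is replaced by [ln (2 s / beta)]. *)
Lemma alpha_log_inv s : s + kap th t + 1 = beta * (a s - 1) / 2 - D * ln (2 * s / beta).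
Proof. by rewrite /a /alpha_log /D; field; rewrite gt_eqF. Qed.

(** The corrections to [a s = 2 s / beta] are of order [ln s]; [c] makes room for the constants of
    each application. *)
Lemma alpha_log_linear g c : 0 < g -> ev (fun s => `| beta * a s / 2 - s | + c <= g * s).
Proof.
move=> g0.
have g2 : 0 < g / (2 * (`|D| + 1)).
  by rewrite divr_gt0 // mulr_gt0 // ltr_wpDl.
pose C := `|beta / 2 + kap th t + 1 + D * ln (2 / beta)| + c.
have := ev_and (ev_ge 1) (ev_and (ev_ln 0 g2) (ev_linear (2 * C) g0)).
apply: ev_imp => s [s1 [h1 h2]].
have s0 : 0 < s by lra.
have -> : beta * a s / 2 - s = D * ln s + (beta / 2 + kap th t + 1 + D * ln (2 / beta)).
  rewrite /a /alpha_log -/D (_ : 2 * s / beta = s * (2 / beta)); last by field; rewrite gt_eqF.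
  by rewrite lnM ?posrE ?divr_gt0 //; field; rewrite gt_eqF.
have lns : 0 <= ln s by apply: ln_ge0.
have hD : `|D * ln s| <= g * s / 2.
  rewrite normrM (ger0_norm lns); apply: (@le_trans _ _ ((`|D| + 1) * (g / (2 * (`|D| + 1)) * s))).
    by apply: ler_pM; rewrite // ?lerDl //; lra.
  rewrite le_eqVlt; apply/orP; left; apply/eqP; field; rewrite gt_eqF // ltr_wpDl //.
have := ler_normD (D * ln s) (beta / 2 + kap th t + 1 + D * ln (2 / beta)).
by move: h2; rewrite /C; lra.
Qed.

End Alpha.

(** Starts from [(m - k) ^ k <= C(m, k) * k!]; replacing [m - k] by [m] costs at most
    [2 k ^ 2 / m <= 1]. *)
Lemma ln_bin_ge (R : realType) (m k : nat) : (0 < k)%N -> (2 * k ^ 2 <= m)%N ->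
  k%:R * ln m%:R - 1 - ln (k`!%:R) <= ln ('C(m, k)%:R) :> R.
Proof.
move=> k0 km; have k2 : (k <= k ^ 2)%N by rewrite expnS expn1 leq_pmulr.
have m0 : (0 < m)%N by lia.
have km' : (k < m)%N by lia.
have f0 : 0 < k`!%:R :> R by rewrite ltr0n fact_gt0.
have C0 : 0 < 'C(m, k)%:R :> R by rewrite ltr0n bin_gt0 ltnW.
have mk0 : 0 < (m - k)%:R :> R by rewrite ltr0n subn_gt0.
have m0R : 0 < m%:R :> R by rewrite ltr0n.
have h : (m - k)%:R ^+ k <= 'C(m, k)%:R * k`!%:R :> R.
  rewrite -natrX -natrM ler_nat bin_ffact ffact_prod -[k in (_ ^ k)%N]card_ord -prod_nat_const.
  by apply: leq_prod => i _; rewrite leq_sub2l // ltnW.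
move: h; rewrite -ler_ln ?posrE ?exprn_gt0 ?mulr_gt0 // lnM ?posrE // lnXn // -[leLHS]mulr_natl => h.
have h1 : ln m%:R - ln (m - k)%:R <= 2 * k%:R / m%:R :> R.
  have := @ln_ge_1subV R ((m - k)%:R / m%:R); rewrite divr_gt0 // => /(_ isT).
  rewrite ln_div ?posrE // invf_div.
  have : 1 - m%:R / (m - k)%:R >= - (2 * k%:R / m%:R) :> R; last by lra.
  rewrite natrB ?(ltnW km') // in mk0 *.
  rewrite lerNl opprB lerBlDr ler_pdivrMr //.
  have -> : (2 * k%:R / m%:R + 1) * (m%:R - k%:R) = m%:R + k%:R * (1 - 2 * k%:R / m%:R) :> R by field; rewrite gt_eqF.
  rewrite lerDl mulr_ge0 // subr_ge0 ler_pdivrMr // mul1r -natrM ler_nat.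
  by apply: leq_trans km; rewrite leq_mul2l.
have h2 : k%:R * (ln m%:R - ln (m - k)%:R) <= 1 :> R.
  apply: (@le_trans _ _ (k%:R * (2 * k%:R / m%:R))); first by rewrite ler_wpM2l.
  rewrite mulrA ler_pdivrMr // mul1r -natrM -natrM ler_nat.
  by apply: leq_trans km; rewrite mulnCA -mulnn.
by move: h h2; lra.
Qed.

Lemma beta_gt0 (R : realType) (p q beta : R) :
  0 < p < 1 -> q = 1 - p -> beta = - ln q -> 0 < beta.
Proof.
by move=> /andP[p0 p1] -> ->; rewrite oppr_gt0 ln_lt0 // subr_gt0 p1 /=; lra.
Qed.

(** Since [exp (beta k / 2)] is about [m], the condition [a s - k >= 1 + e] puts the expected number
    of stable [k]-sets above [nu = m ^ (1 + e / 8)]. With overlaps split at [k / 4], [x] must exceed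
    about [m ^ (- 3 / 4)] and [y] about [m ^ (- 1 / 4)], up to powers of [k]. The weaker exponents
    [- 5 / 8] and [- 1 / 8] absorb these powers and still keep [nu k x ^ 2] and [k y] below
    [1 / 4]. *)
Lemma janson_asymptotic (R : realType) (p q th beta : R) (t : nat) (e : R) :
  0 < p < 1 -> q = 1 - p -> th = p / q -> beta = - ln q -> 0 < e <= 1 ->
  ev (fun s => forall (T : finType) (U : {set T}) (k : nat),
    s = ln #|U|%:R -> alpha_log beta th t s - 2 - e <= k%:R ->
    k%:R <= alpha_log beta th t s - 1 - e ->
    (0 < k)%N /\
    bexp p (pairs [set: T]) (fun X => [forall S in ksubsets U k, ~~ stable t S X]%:R) <=
    expR (- (expR ((1 + e / 8) * s) / 2))).
Proof.
move=> p01 qE thE betaE /andP[e0 e1]; set a := alpha_log beta th t; set D : R := t%:R / 2 - 1.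
have beta0 := beta_gt0 p01 qE betaE.
have D1 : 0 < `|D| + 1 by rewrite ltr_wpDl.
pose d := beta * e / 32; have d0 : 0 < d by rewrite divr_gt0 ?mulr_gt0.
have [C [C0 hC]] := stable_prob_ge t p01 qE thE betaE d0.
(* [g] will bound the relative distance of [beta k / 2] from [s]. The first bound protects the
   leading exponent, the second the term [D ln k]. *)
pose g := Num.min (e / 16) (beta * e / (64 * (`|D| + 1))).
have g0 : 0 < g by rewrite lt_min !divr_gt0 ?mulr_gt0.
have ge : g <= e / 16 by rewrite ge_min lexx.
have gD : `|D| * (2 * g) <= beta * e / 32.
  have : g * (64 * (`|D| + 1)) <= beta * e by rewrite -ler_pdivlMr ?mulr_gt0 // ge_min lexx orbT.
  by nra.
have M2 : 0 <= 2 :> R by [].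
have i8 (x : R) : 0 < x -> 0 < x^-1 by rewrite invr_gt0.
have E1 := @alpha_log_linear _ p q th beta t p01 qE betaE g (3 * beta) g0.
have E2 := @ev_lnM R (1 + t%:R) (32^-1) ((1 + t%:R) * ln (4 / beta) + th + beta / 2)
  (addr_ge0 ler01 (ler0n _ _)) (i8 _ (ltr0Sn _ _)).
have E3 := @ev_lnM R 2 (16^-1) (2 * ln (4 / beta)) M2 (i8 _ (ltr0Sn _ _)).
have E4 := @ev_lnM R 1 (8^-1) (ln (4 / beta) + ln 4) ler01 (i8 _ (ltr0Sn _ _)).
have E5 := @ev_lnM R 2 1 (2 * ln (4 / beta) + ln 2) M2 ltr01.
have e3 : 0 < 3 * e / 8 by lra.
have E6 := @ev_lnM R 2 (3 * e / 8) (2 * (ln (4 / beta) + ln 2) + 2 + C) M2 e3.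
have E7 := @ev_linear R (15 / 16) (beta / 2) ltac:(lra).
have := ev_and (ev_ge 1) (ev_and E1 (ev_and E2 (ev_and E3 (ev_and E4 (ev_and E5 (ev_and E6 E7)))))).
apply: ev_imp => s {E1 E2 E3 E4 E5 E6 E7} [s1 [E1 [E2 [E3 [E4 [E5 [E6 E7]]]]]]] T U k sE ka1 ka2.
have s0 : 0 < s by lra.
set m := #|U| in sE.
pose u := beta * k%:R / 2.
have kr1 : beta * (a s - 2 - e) / 2 <= u by rewrite /u ler_pM2r // ler_pM2l.
have kr2 : u <= beta * (a s - 1 - e) / 2 by rewrite /u ler_pM2r // ler_pM2l.
have be : 0 < beta * e by rewrite mulr_gt0.
have be1 : beta * e <= beta by rewrite ler_piMr // ltW.
have us : `|u - s| <= g * s.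
  move: E1; rewrite -/a => E1.
  have h1 := ler_norm (beta * a s / 2 - s); have h2 := lerNnormlW (lexx `|beta * a s / 2 - s|).
  rewrite ler_norml; clear - E1 h1 h2 kr1 kr2 be1 be beta0; lra.
have gs : g * s <= e / 16 * s by rewrite ler_pM2r.
have es : e / 16 * s <= s / 16 by rewrite mulrAC ler_pM2r //; clear - e1 s0; nra.
have [u1 u2] : (1 - e / 16) * s <= u /\ u <= s + g * s.
  by move: us; rewrite ler_norml => /andP[]; clear - gs; lra.
have u1' : s - g * s <= u by move: us; rewrite ler_norml => /andP[]; clear; lra.
have u0 : 0 < u by clear - u1' gs es s0; lra.
have k0R : 0 < k%:R :> R by move: u0; rewrite /u pmulr_lgt0 // pmulr_rgt0.
have k0 : (0 < k)%N by rewrite -(ltr0n R).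
split=> //.
have m0R : 0 < m%:R :> R.
  rewrite ltNge; apply/negP => m0; move: s0; rewrite sE ln0 ?ltxx //.
have mE : m%:R = expR s by rewrite sE lnK.
set lk : R := ln k%:R.
have kE : k%:R = expR lk :> R by rewrite lnK.
have hk : lk <= ln s + ln (4 / beta).
  have b4 : 0 < 4 / beta by rewrite divr_gt0.
  rewrite -lnM ?posrE // ler_ln ?posrE ?(mulr_gt0 s0 b4) //.
  have -> : k%:R = u * (2 / beta) :> R by rewrite /u; field; rewrite gt_eqF.
  have -> : s * (4 / beta) = (2 * s) * (2 / beta) by field; rewrite gt_eqF.
  by rewrite ler_pM2r ?divr_gt0 //; clear - u2 gs es s0; lra.
have lk0 : 0 <= lk by rewrite ln_ge0 // ler1n.
have g2 : g <= 2^-1 by clear - ge e1; lra.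
have hr : `|lk - ln (2 * s / beta)| <= 2 * g.
  have -> : lk - ln (2 * s / beta) = ln (u / s).
    rewrite /lk -ln_div ?posrE ?divr_gt0 ?mulr_gt0 //; congr ln; rewrite /u.
    by field; rewrite !gt_eqF.
  exact: ln_ratio_le.
have hDr : - (beta * e / 32) <= D * (lk - ln (2 * s / beta)).
  rewrite lerNl; apply: le_trans (ler_norm _) _; rewrite normrN normrM.
  by apply: le_trans gD; rewrite ler_wpM2l.
have inv := @alpha_log_inv _ p q th beta t p01 qE betaE s.
rewrite -/a -/D in inv.
have km2 : (2 * k ^ 2 <= m)%N.
  rewrite -(ler_nat R) natrM natrX mE kE.
  have -> : 2 * expR lk ^+ 2 = expR (ln 2 + (lk + lk)) :> R by rewrite !expRD lnK ?posrE.
  by rewrite ler_expR; clear - hk E5; lra.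
pose rho := expR (stable_rate beta th t k%:R - d * k%:R - C).
have rhoP (S : {set T}) : #|S| = k -> rho <= stable_prob p t S.
  by move=> Sk; have := hC T S; rewrite Sk => /(_ k0).
pose nu := expR ((1 + e / 8) * s).
have nu0 : 0 < nu by apply: expR_gt0.
have kleM : (k <= m)%N.
  by apply: leq_trans km2; rewrite expnS expn1 mulnA leq_pmull // muln_gt0.
have C0' : 0 < 'C(m, k)%:R :> R by rewrite ltr0n bin_gt0.
have kfac := ln_fact_le R k.
have lk1 : ln k.+1%:R <= ln 2 + lk.
  by rewrite -lnM ?posrE // ler_ln ?posrE ?mulr_gt0 // -natrM ler_nat mul2n -addnn -addn1 leq_add2l.
have nuC : nu <= 'C(m, k)%:R * rho.
  rewrite -['C(m, k)%:R]lnK ?posrE // -expRD ler_expR.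
  have := @ln_bin_ge R m k k0 km2; rewrite -sE => hb.
  apply: (@le_trans _ _ (k%:R * s - 1 - ln k`!%:R + (stable_rate beta th t k%:R - d * k%:R - C))); last by rewrite lerD2r.
  rewrite /stable_rate -/lk.
  set kp := kap th t in inv *; set lf := ln k`!%:R in kfac *; set lk' := ln k.+1%:R in kfac lk1; rewrite -/lk in kfac.
  (* By [alpha_log_inv] the bracket is [beta (a s - k) / 2] up to the error in [ln k]. *)
  have main : k%:R * (beta * (1 + e) / 2 - beta * e / 32) <=
      k%:R * (s + kp + 1 + D * lk - beta * (k%:R - 1) / 2).
    rewrite ler_pM2l // inv.
    have : beta * k%:R <= beta * (a s - 1 - e) by rewrite ler_pM2l.
    by move: hDr; rewrite mulrBr; clear; lra.
  have dk : d * k%:R = e / 16 * u by rewrite /d /u; field.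
  have uk : k%:R * (beta * (1 + e) / 2 - beta * e / 32) = u * (1 + e - e / 16) by rewrite /u; field.
  have uu : (1 + e / 2) * s <= u * (1 + e - e / 8).
    apply: (@le_trans _ _ ((1 - e / 16) * s * (1 + e - e / 8))); last by rewrite ler_pM2r //; clear - e0 e1; lra.
    rewrite [leRHS]mulrAC ler_pM2r //; clear - e0 e1; nra.
  have De : t%:R / 2 * (k%:R * lk) = D * (k%:R * lk) + k%:R * lk by rewrite /D; ring.
  rewrite De dk; move: main; rewrite uk; clear - uu kfac lk1 hk E6 hb; lra.
have l40 : ln 4 = ln 2 + ln 2 :> R by rewrite -lnM ?posrE //; congr ln; lra.
pose x := expR (- (5 / 8 * s)); pose y := expR (- (s / 8)).
have l0k : (k %/ 4)%:R <= k%:R / 4 :> R.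
  by rewrite ler_pdivlMr // -natrM ler_nat leq_divM.
have l0k' : k%:R / 4 - 1 <= (k %/ 4)%:R :> R.
  rewrite lerBlDr ler_pdivrMr // natr1 -natrM ler_nat.
  by rewrite ltnW // {1}(divn_eq k 4) mulSn addnC ltn_add2r ltn_mod.
have hx : k%:R ^+ 2 / m%:R * expR (beta * (k %/ 4)%:R / 2) <= x.
  rewrite mE kE -expRM_natl -expRN -!expRD ler_expR.
  have : beta * (k %/ 4)%:R / 2 <= u / 4.
    by rewrite /u -ler_pdivlMr //; have := ler_wpM2l (ltW beta0) l0k; clear; lra.
  by clear - u2 gs es hk E3 s0; lra.
have x1 : x <= 1 by rewrite expR_le1; clear - s0; lra.
have hy : k%:R * m%:R * (k%:R ^+ t * expR th) * expR (- (beta * (k + k %/ 4)%:R / 2)) <= y.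
  rewrite mE kE -expRM_natl -!expRD ler_expR natrD.
  have h1 : 5 / 4 * u - beta / 2 <= beta * (k%:R + (k %/ 4)%:R) / 2.
    by rewrite /u; have := ler_wpM2l (ltW beta0) l0k'; clear; lra.
  have h2 : (1 + t%:R) * lk <= (1 + t%:R) * ln s + (1 + t%:R) * ln (4 / beta).
    by rewrite -mulrDr ler_pM2l // ltr_wpDr.
  by move: h2; rewrite mulrDl; clear - h1 u1' gs es E2 s0; lra.
have y1 : y <= 1 by rewrite expR_le1; clear - s0; lra.
have := @janson_stable R p q th beta t p01 qE thE betaE T U m k (k %/ 4) rho nu x y erefl k0 kleM rhoP nu0 nuC hx x1 hy y1.
move/le_trans; apply; rewrite ler_expR -/nu.
have h1 : nu * (k%:R * x ^+ 2) <= 1 / 4.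
  rewrite -[leRHS]mulrC; have -> : 4^-1 * 1 = expR (- ln 4) :> R by rewrite mulr1 expRN lnK ?posrE.
  rewrite /nu kE expr2 /x -!expRD ler_expR.
  have : e / 8 * s <= s / 8 by rewrite mulrAC ler_pM2r //; clear - e1 s0; nra.
  by rewrite mulrDl; clear - hk E4; lra.
have h2 : k%:R * y <= 1 / 4.
  rewrite -[leRHS]mulrC; have -> : 4^-1 * 1 = expR (- ln 4) :> R by rewrite mulr1 expRN lnK ?posrE.
  by rewrite kE /y -expRD ler_expR; clear - hk E4; lra.
have h1' : nu ^+ 2 * (k%:R * x ^+ 2) <= nu / 4.
  by rewrite expr2 -mulrA -(mulr1 nu) -!mulrA ler_pM2l // !mul1r -[X in _ <= X]mul1r.
have h2' : nu * (k%:R * y) <= nu / 4.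
  by rewrite ler_pM2l // -[leRHS]mul1r.
by clear - h1' h2'; lra.
Qed.

(** * Upper bound on the chromatic number *)

Section GraphProbability.
Variables (R : realType) (p : R) (n : nat).
Implicit Types (A : pred (sgraph 'I_n)).

Lemma empty_sgraph_subproof : [forall e in (set0 : {set {set 'I_n}}), #|e| == 2%N].
Proof. by apply/forall_inP => e; rewrite inE. Qed.

Definition empty_sgraph : sgraph 'I_n := SGraph empty_sgraph_subproof.

Lemma sum_sgraph (F : {set {set 'I_n}} -> R) :
  \sum_(G : sgraph 'I_n) F (edges G) = \sum_(X in powerset (pairs [set: 'I_n])) F X.
Proof.
rewrite (reindex (fun G : sgraph 'I_n => edges G)) /=.
  by apply: eq_bigl => G; rewrite powersetE edges_pairs.
exists (fun X => insubd empty_sgraph X) => [G _|X]; first by rewrite /= valKd.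
rewrite /= powersetE => XP; rewrite insubdK //; apply/forall_inP => e eX.
by have := subsetP XP e eX; rewrite inE => /andP[].
Qed.

Lemma Gnp_weightE (G : sgraph 'I_n) : Gnp_weight p G = bern p (pairs [set: 'I_n]) (edges G).
Proof. by apply: eq_bigl => e; rewrite inE subsetT. Qed.

Lemma Gnp_probE (f : {set {set 'I_n}} -> bool) A :
  (forall G, A G = f (edges G)) ->
  Gnp_prob p A = bexp p (pairs [set: 'I_n]) (fun X => (f X)%:R).
Proof.
move=> Af; rewrite /Gnp_prob /bexp -sum_sgraph big_mkcond /=; apply: eq_bigr => G _.
by rewrite Af Gnp_weightE; case: (f _); rewrite ?mulr1 ?mulr0.
Qed.

Hypothesis p01 : 0 <= p <= 1.

Lemma Gnp_prob_le A A' : (forall G, A G -> A' G) -> Gnp_prob p A <= Gnp_prob p A'.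
Proof.
move=> AA'; rewrite /Gnp_prob big_mkcond [leRHS]big_mkcond; apply: ler_sum => G _.
case: (boolP (A G)) => [/AA' ->//|_]; case: ifP => // _.
by rewrite Gnp_weightE bern_ge0.
Qed.

Lemma Gnp_prob_ge0 A : 0 <= Gnp_prob p A.
Proof. by apply: sumr_ge0 => G _; rewrite Gnp_weightE bern_ge0. Qed.

Lemma Gnp_probT : Gnp_prob p (predT : pred (sgraph 'I_n)) = 1 :> R.
Proof. by rewrite (Gnp_probE (f := predT)) // bexp_cst. Qed.

Lemma Gnp_probC A : Gnp_prob p A + Gnp_prob p (predC A) = 1.
Proof. by rewrite -Gnp_probT /Gnp_prob [RHS](bigID A). Qed.

Lemma Gnp_prob_union (J : finType) (Q : pred J) (B : J -> pred (sgraph 'I_n)) A :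
  (forall G, A G -> [exists j, Q j && B j G]) ->
  Gnp_prob p A <= \sum_(j | Q j) Gnp_prob p (B j).
Proof.
move=> AB; rewrite /Gnp_prob big_mkcond.
under [leRHS]eq_bigr => j _ do rewrite big_mkcond.
rewrite exchange_big /=; apply: ler_sum => G _.
have w0 : 0 <= Gnp_weight p G by rewrite Gnp_weightE bern_ge0.
case: (boolP (A G)) => [/AB/existsP[j /andP[Qj BjG]]|_].
  by rewrite (bigD1 j) //= BjG lerDl; apply: sumr_ge0 => i _; case: ifP.
by apply: sumr_ge0 => i _; case: ifP.
Qed.

End GraphProbability.

(** * Greedy colouring and its number of colours *)

Section Greedy.
Variables (R : realType) (T : finType) (G : sgraph T) (t : nat).

Lemma stable_card1 (S : {set T}) : (#|S| <= 1)%N -> t_stable G t S.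
Proof.
move=> S1; rewrite t_stableE; apply/forall_inP => v vS.
rewrite /incidence (_ : [set e in _ | _] = set0) ?cards0 //; apply/setP => e; rewrite !inE.
apply/negP => /andP[/andP[_ /andP[eS /eqP e2]] _].
by have := subset_leq_card eS; rewrite e2; move: S1; case: (#|S|) => [|[]].
Qed.

(** Each removed set uses one colour and lowers the potential by at least 1; once fewer than [m0]
    vertices remain, they get distinct colours. *)
Lemma greedy_colouring (k : nat -> nat) (m0 : nat) (Psi : nat -> R) :
  (forall m, 0 <= Psi m) ->
  (forall m, (m0 <= m <= #|T|)%N -> (0 < k m <= m)%N -> Psi (m - k m)%N + 1 <= Psi m) ->
  (forall U : {set T}, (m0 <= #|U|)%N -> (0 < #|U|)%N -> exists2 S : {set T},
     S \in ksubsets U (k #|U|) & (0 < k #|U|)%N && t_stable G t S) ->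
  forall U : {set T}, exists (c : T -> nat) (j : nat),
    [/\ forall v, v \in U -> (c v < j)%N,
        forall i, t_stable G t [set v in U | c v == i] &
        j%:R <= m0%:R + Psi #|U|].
Proof.
move=> Psi0 PsiS ex U; have [N] := ubnP #|U|; elim: N U => // N IH U /ltnSE UN.
have [Um|mU] := ltnP #|U| m0.
  exists (fun v => index v (enum U)), #|U|; split.
  - by move=> v vU; rewrite cardE index_mem mem_enum.
  - move=> i; apply: stable_card1; apply/card_le1_eqP => u v; rewrite !inE.
    move=> /andP[uU /eqP ui] /andP[vU /eqP vi].
    by rewrite -(nth_index u (s := enum U) (x := v)) ?mem_enum // vi -ui nth_index ?mem_enum.
  by rewrite (le_trans (y := m0%:R)) ?ler_nat ?(ltnW Um) // lerDl.
have [U0|U0] := posnP #|U|.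
  exists (fun=> 0%N), 0%N; split=> [v|i|]; last by rewrite addr_ge0.
    by move/card0_eq: U0 => /(_ v) ->.
  apply: stable_card1; apply: (@leq_trans #|U|); last by rewrite U0.
  by apply: subset_leq_card; apply/subsetP => v; rewrite inE => /andP[].
have [S] := ex U mU U0; rewrite inE => /andP[SU /eqP Sk] /andP[k0 Sst].
have cUS : #|U :\: S| = (#|U| - k #|U|)%N by rewrite cardsD (setIidPr SU) Sk.
have kU : (k #|U| <= #|U|)%N by rewrite -Sk subset_leq_card.
have lt : (#|U :\: S| < N)%N by rewrite cUS (leq_trans _ UN) // ltn_subrL k0.
have [c [j [cj cst jle]]] := IH _ lt.
exists (fun v => if v \in S then j else c v), j.+1; split.
- move=> v vU; case: ifP => // vS; apply: ltnW; rewrite ltnS; apply: cj.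
  by rewrite inE vS.
- move=> i; have [ij|ij] := eqVneq i j.
    rewrite (_ : [set v in U | _] = S) //; apply/setP => v; rewrite inE ij.
    case: (boolP (v \in S)) => vS; first by rewrite eqxx (subsetP SU).
    by apply/negP => /andP[vU /eqP cv]; have := cj v; rewrite inE vS vU cv ltnn => /(_ isT).
  rewrite (_ : [set v in U | _] = [set v in U :\: S | c v == i]) //; apply/setP => v; rewrite !inE.
  by case: (v \in S) => //=; rewrite eq_sym (negPf ij) andbF.
rewrite -natr1; have := PsiS #|U|; rewrite mU max_card k0 kU => /(_ isT isT); rewrite -cUS.
by move: jle; lra.
Qed.

Lemma improper_chromatic_le (c : T -> nat) (j : nat) :
  (forall v, (c v < j)%N) -> (forall i, t_stable G t [set v | c v == i]) ->
  (improper_chromatic G t <= j)%N.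
Proof.
move=> cj cst; rewrite /improper_chromatic; case: ex_minnP => m _; apply.
apply/existsP; exists [ffun v => Ordinal (cj v)]; apply/forallP => i.
rewrite (_ : [set v | _] = [set v | c v == i]) //; apply/setP => v.
by rewrite !inE ffunE -val_eqE.
Qed.

End Greedy.

Section GreedyPotential.
Variables (R : realType) (n m0 : nat) (A c : R).
Hypotheses (m0_gt0 : (0 < m0)%N) (m0n : (m0 <= n)%N) (c0 : 0 < c).
Let Y := c * (ln n%:R - ln m0%:R).
Hypothesis YA : Y < A.

(* A lower bound for the size of the stable set removed when [i] vertices remain,
   linearised around [i = n] and frozen below [m0]. *)
Definition class_size_bound (i : nat) : R := A - c * (ln n%:R - ln (maxn i m0)%:R).
Let kappa := class_size_bound.
(** A discrete integral of the reciprocal class size, so that removing one class lowers it by at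
    least 1. *)
Definition greedy_potential (m : nat) : R := \sum_(i < m) (kappa i.+1)^-1.

Lemma class_size_bound_mono i j : (i <= j)%N -> kappa i <= kappa j.
Proof.
move=> ij; rewrite /kappa /class_size_bound lerD2l lerN2 ler_pM2l // lerD2l lerN2.
have mi x : (0 : R) < (maxn x m0)%:R by rewrite ltr0n leq_max m0_gt0 orbT.
rewrite ler_ln ?posrE //.
by rewrite ler_nat geq_max leq_max ij leq_maxr.
Qed.

Lemma class_size_bound_gt0 i : 0 < kappa i.
Proof.
have h : 0 < kappa 0 by rewrite /kappa /class_size_bound max0n subr_gt0.
by apply: lt_le_trans h _; apply: class_size_bound_mono.
Qed.

Lemma greedy_potential_ge0 m : 0 <= greedy_potential m.
Proof. by apply: sumr_ge0 => i _; rewrite invr_ge0 ltW // class_size_bound_gt0. Qed.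

Lemma greedy_potential_step m k : (k <= m)%N -> kappa m <= k%:R ->
  greedy_potential (m - k) + 1 <= greedy_potential m.
Proof.
move=> km kk; rewrite /greedy_potential -!(big_mkord xpredT (fun i => (kappa i.+1)^-1)).
rewrite [leRHS](big_cat_nat (n := (m - k)%N)) ?leq_subr //= lerD2l.
apply: (@le_trans _ _ (\sum_(m - k <= i < m) (kappa m)^-1)).
  rewrite sumr_const_nat subKn // -[leRHS]mulr_natl ler_pdivlMr ?class_size_bound_gt0 //.
  by rewrite mul1r.
apply: ler_sum_nat => i /andP[_ im].
by rewrite lef_pV2 ?posrE ?class_size_bound_gt0 // class_size_bound_mono.
Qed.

Lemma sum_ln_fact j : \sum_(i < j) ln (i.+1%:R) = ln (j`!%:R) :> R.
Proof.
elim: j => [|j IH]; first by rewrite big_ord0 fact0 ln1.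
rewrite big_ord_recr /= IH factS natrM lnM ?posrE ?ltr0n ?fact_gt0 //.
by rewrite addrC.
Qed.

(** Writing [1 / (A - y) = 1 / A + y / (A (A - y))] and replacing [y] by [Y] in the denominator
    leaves the sum of [c ln (n / i)], which is at most [c n] by Stirling. Freezing below [m0] only
    decreases [y]. *)
Lemma greedy_potential_le : greedy_potential n <= n%:R / A + c * n%:R / (A * (A - Y)).
Proof.
have m0R : 0 < m0%:R :> R by rewrite ltr0n.
have n0R : 0 < n%:R :> R by rewrite ltr0n (leq_trans m0_gt0).
have Y0 : 0 <= Y by rewrite mulr_ge0 ?(ltW c0) // subr_ge0 ler_ln ?posrE // ler_nat.
have A0 : 0 < A by apply: le_lt_trans YA.
have AY : 0 < A - Y by rewrite subr_gt0.
have term (i : 'I_n) : (kappa i.+1)^-1 <= A^-1 + c * (ln n%:R - ln i.+1%:R) / (A * (A - Y)).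
  set y := c * (ln n%:R - ln (maxn i.+1 m0)%:R).
  have mx0 : (0 : R) < (maxn i.+1 m0)%:R by rewrite ltr0n leq_max.
  have y0 : 0 <= y.
    by rewrite mulr_ge0 ?(ltW c0) // subr_ge0 ler_ln ?posrE // ler_nat geq_max m0n ltn_ord.
  have yY : y <= Y.
    by rewrite ler_pM2l // lerD2l lerN2 ler_ln ?posrE // ler_nat leq_maxr.
  have yi : y <= c * (ln n%:R - ln i.+1%:R).
    by rewrite ler_pM2l // lerD2l lerN2 ler_ln ?posrE ?mx0 ?ltr0n // ler_nat leq_maxl.
  have Ay : 0 < A - y by rewrite subr_gt0 (le_lt_trans yY).
  apply: (@le_trans _ _ (A^-1 + y / (A * (A - Y)))); last first.
    by rewrite lerD2l ler_pM2r // invr_gt0 mulr_gt0.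
  have -> : (kappa i.+1)^-1 = A^-1 + y / (A * (A - y)).
    rewrite /kappa /class_size_bound -/y; field.
    by rewrite !gt_eqF.
  rewrite lerD2l ler_wpM2l // lef_pV2 ?posrE ?mulr_gt0 // ler_pM2l //.
  by rewrite lerD2l lerN2.
apply: le_trans (ler_sum _ (fun i _ => term i)) _.
rewrite big_split /= sumr_const card_ord -mulr_suml -mulr_sumr sumrB sumr_const card_ord sum_ln_fact.
rewrite -[A^-1 *+ n]mulr_natl -[ln n%:R *+ n]mulr_natl lerD2l ler_pM2r ?invr_gt0 ?mulr_gt0 //.
by rewrite ler_pM2l //; have := ln_fact_ge R n; lra.
Qed.

(** To second order [n / A + c n / A ^ 2] is [n / (A - c)]. The [m0] extra colours and the
    difference between [A - Y] and [A] are charged to [e]. *)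
Lemma greedy_total_le (e l3 : R) : 0 < l3 -> m0%:R <= n%:R / l3 -> 0 < e ->
  c * Y / (A - Y) + A ^+ 2 / l3 <= e -> 0 < A - e - c ->
  m0%:R + greedy_potential n <= n%:R / (A - e - c).
Proof.
move=> l30 m0l e0 hY B0; set B := A - e - c in B0 *.
have m0R : 0 < m0%:R :> R by rewrite ltr0n.
have n0R : 0 < n%:R :> R by rewrite ltr0n (leq_trans m0_gt0).
have Y0 : 0 <= Y by rewrite mulr_ge0 ?(ltW c0) // subr_ge0 ler_ln ?posrE // ler_nat.
have A0 : 0 < A by apply: le_lt_trans YA.
have AY : 0 < A - Y by rewrite subr_gt0.
apply: (@le_trans _ _ (n%:R * (l3^-1 + A^-1 + c / (A * (A - Y))))).
  have := lerD m0l greedy_potential_le; rewrite !mulrDr addrA.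
  by rewrite [c * n%:R]mulrC -[n%:R * c / _]mulrA.
rewrite ler_pM2l //.
have h1 : A^-1 * (1 + (c * Y / (A - Y) + A ^+ 2 / l3 + c) / A) = l3^-1 + A^-1 + c / (A * (A - Y)).
  by field; rewrite !gt_eqF.
rewrite -h1 -[leRHS]mul1r ler_pdivlMr // mulrAC -mulrA ler_pdivrMl // mulr1.
have h2 : (c * Y / (A - Y) + A ^+ 2 / l3 + c) / A <= (e + c) / A.
  by rewrite ler_pM2r ?invr_gt0 // lerD2r.
have AB : B <= A by rewrite /B -addrA gerDl -opprD oppr_le0 addr_ge0 // ltW.
apply: (@le_trans _ _ (B * (1 + (e + c) / A))); first by rewrite ler_pM2l // lerD2l.
have ec : 0 < e + c by rewrite addr_gt0.
rewrite mulrDr mulr1; have : B * ((e + c) / A) <= e + c.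
  by rewrite mulrCA ler_piMr ?(ltW ec) // ler_pdivrMr // mul1r.
by rewrite /B; lra.
Qed.

End GreedyPotential.

Definition greedy_size (R : realType) (beta th : R) (t : nat) (e : R) (m : nat) : nat :=
  Num.truncn (alpha_log beta th t (ln m%:R) - 1 - e).

Lemma stable_family_prob (R : realType) (p q th beta : R) (t : nat) (e : R) :
  0 < p < 1 -> q = 1 - p -> th = p / q -> beta = - ln q -> 0 < e <= 1 ->
  let K := greedy_size beta th t e in
  exists s0 : R, forall n m0 : nat, (0 < m0)%N -> s0 <= ln m0%:R ->
    (forall m, (m0 <= m)%N -> (0 < K m)%N /\ alpha_log beta th t (ln m%:R) - 2 - e <= (K m)%:R) /\
    Gnp_prob p (fun G : sgraph 'I_n => [exists U : {set 'I_n},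
        (m0 <= #|U|)%N && [forall S in ksubsets U (K #|U|), ~~ t_stable G t S]]) <=
      2 ^+ n * expR (- (expR ((1 + e / 8) * ln m0%:R) / 2)).
Proof.
move=> p01 qE thE betaE e01 K; case/andP: (e01) => e0 e1.
have beta0 := beta_gt0 p01 qE betaE.
have [s1 h1] := janson_asymptotic t p01 qE thE betaE e01.
have half0 : 0 < 2^-1 :> R by rewrite invr_gt0.
have [s2 h2] := ev_and (ev_ge 0) (@alpha_log_linear _ p q th beta t p01 qE betaE (2^-1) (2 * beta) half0).
exists (Num.max s1 s2) => n m0 m00; rewrite ge_max => /andP[sm1 sm2].
have m0R : 0 < m0%:R :> R by rewrite ltr0n.
have lnm m : (m0 <= m)%N -> ln m0%:R <= ln m%:R :> R.
  by move=> mm; rewrite ler_ln ?posrE ?ltr0n ?ler_nat // (leq_trans m00).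
have aK m : (m0 <= m)%N -> alpha_log beta th t (ln m%:R) - 2 - e <= (K m)%:R
     /\ (K m)%:R <= alpha_log beta th t (ln m%:R) - 1 - e.
  move=> mm; have [z0 hz] := h2 _ (le_trans sm2 (lnm m mm)).
  set al := alpha_log _ _ _ _ in hz *.
  (* [Num.truncn] is 0 on negative reals, so the rounding bounds require a nonnegative argument. *)
  have al4 : 4 <= al.
    have := lerNnormlW (lexx `|beta * al / 2 - ln m%:R|) => hz2.
    rewrite -(ler_pM2l beta0); clear - hz hz2 z0; lra.
  have pos : 0 <= al - 1 - e by clear - al4 e1; lra.
  have := truncn_itv pos; rewrite -/(K m) -natr1 => /andP[]; clear; lra.
have K0 m : (m0 <= m)%N -> (0 < K m)%N.
  move=> mm; have [ka1 ka2] := aK m mm.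
  have [] := h1 _ (le_trans sm1 (lnm m mm)) 'I_m [set: 'I_m] (K m) _ _ _ => //.
  by rewrite cardsT card_ord.
split=> [m mm|]; first by split; [exact: K0|case: (aK m mm)].
have p01' : 0 <= p <= 1 by case/andP: p01 => /ltW -> /ltW ->.
apply: (@le_trans _ _ (\sum_(U : {set 'I_n} | (m0 <= #|U|)%N)
   Gnp_prob p (fun G : sgraph 'I_n => [forall S in ksubsets U (K #|U|), ~~ t_stable G t S]))).
  by apply: Gnp_prob_union.
apply: (@le_trans _ _ (\sum_(U : {set 'I_n}) expR (- (expR ((1 + e / 8) * ln m0%:R) / 2)))).
  rewrite big_mkcond; apply: ler_sum => U _; case: ifP => [mU|_]; last exact: expR_ge0.
  rewrite (Gnp_probE p (f := fun X => [forall S in ksubsets U (K #|U|), ~~ stable t S X])); last first.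
    by move=> G; apply: eq_forallb => S; rewrite t_stableE.
  have [ka1 ka2] := aK _ mU.
  have [] := h1 _ (le_trans sm1 (lnm _ mU)) 'I_n U (K #|U|) erefl ka1 ka2.
  move=> _ /le_trans; apply; rewrite ler_expR lerN2 ler_pM2r // ler_expR ler_pM2l ?lnm //.
  by clear - e0; lra.
by rewrite sumr_const -cardsT -powersetT card_powerset cardsT card_ord -[leLHS]mulr_natl natrX.
Qed.

(** Of the slack [3 * e], one part is the deficit in [greedy_size], one pays for the variation of
    [ln (2 s / beta)] between [ln m0] and [ln n], and one for the errors of the greedy count. The
    constant [c = 2 / beta] is the slope of [alpha_log] in [s], its logarithmic term aside. *)
Lemma chromatic_upper (R : realType) (p : R) (t : nat) (e eta : R) :
  0 < p < 1 -> 0 < e <= 1 -> 0 < eta ->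
  exists N : nat, forall n, (N <= n)%N ->
    Gnp_prob p (fun G : sgraph 'I_n => ~~ ((improper_chromatic G t)%:R <=
      n%:R / (alpha t p n - 2 / ln (base p) - 2 - 3 * e))) <= eta.
Proof.
move=> p01 e01 eta0; case/andP: (e01) => e0 e1.
pose q := 1 - p; pose th := p / q; pose beta := - ln q.
have beta0 := @beta_gt0 R p q beta p01 erefl erefl.
have [s0 h0] := @stable_family_prob R p q th beta t e p01 erefl erefl erefl e01.
set a := alpha_log beta th t; pose D : R := t%:R / 2 - 1; pose c := 2 / beta.
have c0 : 0 < c by rewrite divr_gt0.
have D1 : 0 < `|D| + 1 by rewrite ltr_wpDl.
pose g := Num.min (2^-1) (e * beta / (4 * (`|D| + 1))).
have g0 : 0 < g by rewrite lt_min invr_gt0 ltr0n divr_gt0 ?mulr_gt0.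
have g2 : g <= 2^-1 by rewrite ge_min lexx.
have gD : c * (`|D| * (2 * g)) <= e.
  have : g * (4 * (`|D| + 1)) <= e * beta by rewrite -ler_pdivlMr ?mulr_gt0 // ge_min lexx orbT.
  rewrite /c mulrAC ler_pdivrMr //; clear - g0; have := normr_ge0 D; nra.
have half0 : 0 < 2^-1 :> R by rewrite invr_gt0.
have e8 : 0 < e / 8 by rewrite divr_gt0.
have M3 : 0 <= 3 :> R by []. have M6 : 0 <= 6 :> R by [].
have ec : 0 < e * beta / 32 by rewrite divr_gt0 ?mulr_gt0.
have E1 := @alpha_log_linear _ p q th beta t p01 erefl erefl (2^-1) (4 * beta + 4) half0.
have E2 := @ev_lnM R 3 g (ln 2) M3 g0.
have E3 := @ev_lnM R 6 (e / 8) (2 * ln 2 + ln 4) M6 e8.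
have E4 := @ev_lnM R 3 (e * beta / 32) (ln 2) M3 ec.
have e16 : 0 < e * beta ^+ 2 / 18 by rewrite divr_gt0 ?mulr_gt0 ?exprn_gt0.
have E5 := @ev_linear R (e * beta ^+ 2 / 18) 1 e16.
have E6 := @ev_linear R (2^-1) s0 half0.
have E8 := @ev_lnM R 3 (16^-1) (ln 2) M3 ltac:(by rewrite invr_gt0).
have Eall := ev_and (ev_ge 1) (ev_and (ev_ge (- ln eta)) (ev_and E1 (ev_and E2 (ev_and E3 (ev_and E4 (ev_and E5 (ev_and E6 E8))))))).
have [N hN] := ev_ln_nat Eall; exists (maxn N 3) => n; rewrite geq_max => /andP[Nn n3].
have [L1 [Leta [{}E1 [{}E2 [{}E3 [{}E4 [{}E5 [{}E6 {}E8]]]]]]]] := hN n Nn.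
have n0 : (0 < n)%N by apply: leq_trans n3.
have n0R : 0 < n%:R :> R by rewrite ltr0n.
set L := ln n%:R in L1 Leta E1 E2 E3 E4 E5 E6 E8.
have L0 : 0 < L by clear - L1; lra.
rewrite (@alphaE R p q th beta t p01 erefl erefl erefl n n3) (@ln_base R p q beta p01 erefl erefl) -/L -/a -/c.
(* The cut-off [m0] is about [n / L ^ 3]: so few extra colours are negligible against [n / L ^ 2],
   the effect of a constant change in the denominator, while [m0 ^ (1 + e / 8)] still exceeds
   [4 n]. *)
set l3 := L ^+ 3; have l30 : 0 < l3 by rewrite exprn_gt0.
have nE : n%:R = expR L by rewrite lnK.
have l3E : l3 = expR (3 * ln L) by rewrite expRM_natl lnK.
have nl3 : 2 <= n%:R / l3.
  rewrite ler_pdivlMr // nE l3E -[2 in leLHS]lnK ?posrE // -expRD ler_expR.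
  by clear - E8 L0; lra.
pose m0 := Num.truncn (n%:R / l3).
have := truncn_itv (le_trans (ler0n _ 2) nl3); rewrite -/m0 -natr1 => /andP[m0l m0g].
have m00 : (0 < m0)%N by rewrite -(ltr0n R); clear - m0g nl3; lra.
have m0R : 0 < m0%:R :> R by rewrite ltr0n.
have m0h : n%:R / l3 / 2 <= m0%:R by clear - m0g nl3; lra.
have lm0 : L - (3 * ln L + ln 2) <= ln m0%:R.
  have -> : L - (3 * ln L + ln 2) = ln (n%:R / l3 / 2).
    by rewrite !ln_div ?posrE ?divr_gt0 // -/L l3E expRK opprD addrA.
  by rewrite ler_ln ?posrE ?divr_gt0.
have l31 : 1 <= l3 by rewrite exprn_ege1.
have m0n : (m0 <= n)%N.
  rewrite -(ler_nat R); apply: le_trans m0l _; rewrite ler_pdivrMr //.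
  by rewrite ler_peMr ?(ltW n0R).
have lmL : ln m0%:R <= L by rewrite ler_ln ?posrE ?ler_nat.
have lm0g : L - g * L <= ln m0%:R by clear - lm0 E2; lra.
have gL : g * L <= L / 2 by rewrite mulrC ler_pM2l.
have s0m : s0 <= ln m0%:R by clear - lm0g gL E6; lra.
have [hK hbad] := h0 n m0 m00 s0m.
set K := greedy_size beta th t e in hK hbad.
pose A := a L - 2 - 2 * e.
pose Y := c * (ln n%:R - ln m0%:R).
have Yle : Y <= c * (3 * ln L + ln 2) by rewrite ler_pM2l // -/L; clear - lm0; lra.
have Y0 : 0 <= Y by rewrite mulr_ge0 ?(ltW c0) // subr_ge0.
have cb : c * beta = 2 by rewrite /c divfK // gt_eqF.
have aL1 := ler_norm (beta * a L / 2 - L); have aL2 := lerNnormlW (lexx `|beta * a L / 2 - L|).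
rewrite -/a in E1.
have be1 : beta * e <= beta by rewrite ler_piMr // ltW.
have AbL : L + 4 * beta + 8 <= beta * A.
  by rewrite /A; clear - E1 aL1 aL2 be1 beta0; lra.
have AbU : beta * A <= 3 * L.
  have be0 : 0 < beta * e by rewrite mulr_gt0.
  by rewrite /A; clear - E1 aL1 aL2 be0 beta0; lra.
have bc z : beta * (c * z) = 2 * z by rewrite mulrA (mulrC beta) cb.
have bY : beta * Y <= L / 8.
  have := ler_wpM2l (ltW beta0) Yle; rewrite (bc (3 * ln L + ln 2)).
  by clear - E8; lra.
have A0 : 0 < A by rewrite -(pmulr_rgt0 _ beta0); clear - AbL L0 beta0; lra.
have AY : 7 / 8 * L <= beta * (A - Y) by clear - bY AbL beta0; lra.
have AY0 : 0 < A - Y by rewrite -(pmulr_rgt0 _ beta0); clear - AY L0; lra.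
have YA : Y < A by rewrite -subr_gt0.
have B0 : 0 < A - e - c.
  have cbE : beta * (A - e - c) = beta * A - beta * e - c * beta by ring.
  rewrite -(pmulr_rgt0 _ beta0) cbE cb.
  by clear - AbL L0 be1 beta0; lra.
have hY : c * Y / (A - Y) + A ^+ 2 / l3 <= e.
  have y1 : c * Y / (A - Y) <= e / 2.
    rewrite ler_pdivrMr // -(ler_pM2l beta0) (bc Y).
    have -> : beta * (e / 2 * (A - Y)) = e / 2 * (beta * (A - Y)) by ring.
    have z1 : Y <= c * (e * beta / 32 * L).
      by apply: le_trans Yle _; rewrite ler_pM2l.
    have z2 : c * (e * beta / 32 * L) = e * L / 16.
      have -> : c * (e * beta / 32 * L) = c * beta * (e * L / 32) by ring.
      by rewrite cb; field.
    rewrite z2 in z1.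
    have z3 := ler_wpM2l (ltW e0) AY.
    have z4 : 0 < e * L by rewrite mulr_gt0.
    by clear - z1 z3 z4; lra.
  have y2 : A ^+ 2 / l3 <= e / 2.
    rewrite ler_pdivrMr // -(ler_pM2l (exprn_gt0 2 beta0)) -exprMn.
    apply: (@le_trans _ _ ((3 * L) ^+ 2)).
      by rewrite lerXn2r ?nnegrE ?mulr_ge0 ?(ltW beta0) ?(ltW A0) ?(ltW L0).
    have L2 : 0 < L ^+ 2 by rewrite exprn_gt0.
    have -> : beta ^+ 2 * (e / 2 * l3) = (9 * L ^+ 2) * (e * beta ^+ 2 / 18 * L).
      by rewrite /l3; field.
    have -> : (3 * L) ^+ 2 = 9 * L ^+ 2 by ring.
    by rewrite -[leLHS]mulr1 ler_pM2l // mulr_gt0.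
  by clear - y1 y2; lra.
have total := @greedy_total_le R n m0 A c m00 m0n c0 YA e l3 l30 m0l e0 hY B0.
(* The second [e] in [A] is spent here, on the nonlinear term [D ln (2 s / beta)] of [alpha_log]. *)
have kap_le m : (m0 <= m <= n)%N -> class_size_bound n m0 A c m <= (K m)%:R.
  move=> /andP[mm mn]; have [_ hk] := hK m mm; apply: le_trans hk.
  rewrite /class_size_bound (maxn_idPl mm) -/L /A.
  have mR : 0 < m%:R :> R by rewrite ltr0n (leq_trans m00).
  set lm := ln m%:R.
  have lmm : ln m0%:R <= lm by rewrite ler_ln ?posrE ?ler_nat.
  have lmL' : lm <= L by rewrite ler_ln ?posrE ?ler_nat.
  have lmg : L - g * L <= lm by apply: le_trans lmm.
  have lm00 : 0 < lm by clear - lmg gL L0; lra.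
  have r0 : 0 <= ln (2 * L / beta) - ln (2 * lm / beta) <= 2 * g.
    rewrite -ln_div ?posrE ?divr_gt0 ?mulr_gt0 //.
    have -> : 2 * L / beta / (2 * lm / beta) = L / lm by field; rewrite !gt_eqF.
    rewrite ln_ge0 ?ler_pdivlMr ?mul1r //=.
    apply: le_trans (ln_le_sub1 (divr_gt0 L0 lm00)) _.
    rewrite lerBlDr ler_pdivrMr //.
    have z1 : 0 <= g * (lm - (L - g * L)) by rewrite mulr_ge0 ?(ltW g0) // subr_ge0.
    have z2 : 0 <= g * L * (1 - 2 * g).
      by rewrite mulr_ge0 ?mulr_ge0 ?(ltW g0) ?(ltW L0) //; clear - g2; lra.
    by clear - z1 z2 lmg; lra.
  have hD : c * (D * (ln (2 * L / beta) - ln (2 * lm / beta))) <= e.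
    apply: le_trans gD; rewrite ler_pM2l //; apply: le_trans (ler_norm _) _.
    by rewrite normrM ler_wpM2l // ger0_norm; case/andP: r0.
  rewrite /a /alpha_log -/D -/c.
  by clear - hD; lra.
have good (G : sgraph 'I_n) :
    ~~ [exists U : {set 'I_n}, (m0 <= #|U|)%N && [forall S in ksubsets U (K #|U|), ~~ t_stable G t S]] ->
    (improper_chromatic G t)%:R <= n%:R / (A - e - c).
  move=> /existsPn nb.
  have ex (U : {set 'I_n}) : (m0 <= #|U|)%N -> (0 < #|U|)%N -> exists2 S : {set 'I_n},
     S \in ksubsets U (K #|U|) & (0 < K #|U|)%N && t_stable G t S.
    move=> mU _; have := nb U; rewrite mU /= => /forall_inPn[S SU]; rewrite negbK => st.
    by exists S => //; rewrite st andbT; case: (hK _ mU).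
  have [|cl [j [clj clst jle]]] := @greedy_colouring R 'I_n G t K m0 (greedy_potential n m0 A c)
      (greedy_potential_ge0 m00 c0 YA) _ ex [set: 'I_n].
    rewrite card_ord => m mm /andP[_ km].
    exact: (greedy_potential_step m00 c0 YA km (kap_le m mm)).
  apply: le_trans total; rewrite cardsT card_ord in jle; apply: le_trans jle.
  rewrite ler_nat; apply: (@improper_chromatic_le _ _ _ cl) => [v|i]; first exact: clj.
  have := clst i; rewrite (_ : [set v in [set: 'I_n] | cl v == i] = [set v | cl v == i]) //.
  by apply/setP => v; rewrite !inE.
have p01' : 0 <= p <= 1 by case/andP: p01 => /ltW -> /ltW ->.
apply: (@le_trans _ _ (2 ^+ n * expR (- (expR ((1 + e / 8) * ln m0%:R) / 2)))).
  apply: le_trans hbad; apply: Gnp_prob_le => // G; apply: contraR => /good.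
  by rewrite /A; congr (_ <= _ / _); clear; lra.
have h2n : 2 ^+ n <= expR n%:R :> R.
  rewrite -[n%:R]mulr1 expRM_natl lerXn2r ?nnegrE ?expR_ge0 //.
  by apply: le_trans (expR_ge1Dx 1); clear; lra.
have h4n : 4 * n%:R <= expR ((1 + e / 8) * ln m0%:R).
  rewrite nE -[4 in leLHS]lnK ?posrE // -expRD ler_expR.
  have z : 0 < 1 + e / 8 by clear - e0; lra.
  have := ler_wpM2l (ltW z) lm0; have z2 : 0 <= 3 * ln L + ln 2.
    by rewrite addr_ge0 ?mulr_ge0 ?ln_ge0 // ler1n.
  have z3 : e / 8 * (3 * ln L + ln 2) <= 3 * ln L + ln 2 by rewrite ler_piMl //; clear - e1; lra.
  by clear - z3 E3; lra.
(* The product is [exp (- n)], which is below [eta] because [n > ln n >= - ln eta]. *)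
apply: (@le_trans _ _ (expR n%:R * expR (- (2 * n%:R)))).
  apply: ler_pM; rewrite ?exprn_ge0 ?expR_ge0 // ler_expR lerN2.
  by clear - h4n; lra.
rewrite -expRD -[eta]lnK ?posrE // ler_expR.
have : L < n%:R by apply: ln_sublinear.
by clear - Leta; lra.
Qed.

(** * Lower bound on the chromatic number *)

Section StableCovers.
Variables (T : finType) (t : nat).
Implicit Types (S U : {set T}) (X : {set {set T}}).

(* The number of sequences of [j] disjoint stable sets, possibly empty, with union
   [U]; [stable_covers (S j) U X] chooses the first set. *)
Fixpoint stable_covers (j : nat) (U : {set T}) (X : {set {set T}}) : nat :=
  if j is j'.+1 then \sum_(S in powerset U) stable t S X * stable_covers j' (U :\: S) X
  else U == set0.

Lemma stable_covers_depends j U : depends_on (pairs U) (stable_covers j U).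
Proof.
elim: j U => [//|j IH] U X /=; apply: eq_bigr => S; rewrite powersetE => SU.
congr (_ * _)%N.
  by congr nat_of_bool; apply: (depends_on_sub (pairs_mono SU) (@stable_depends T t S)).
by apply: (depends_on_sub _ (IH (U :\: S))); apply: pairs_mono; apply: subsetDl.
Qed.

Lemma stable_covers_partition (P : {set {set T}}) U X :
  partition P U -> (forall S, S \in P -> stable t S X) ->
  ((#|P|)`! <= stable_covers #|P| U X)%N.
Proof.
move: {2}#|P| (erefl #|P|) => j; elim: j P U => [|j IH] P U Pj /and3P[cP tP nP] st; rewrite Pj.
  move/eqP: Pj; rewrite cards_eq0 => /eqP P0; rewrite P0 /cover big_set0 eq_sym in cP.
  by rewrite /= cP.
rewrite /= factS -Pj -sum_nat_const [leqRHS](bigID (mem P)) /=.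
apply: leq_trans (leq_addr _ _).
have PU S : S \in P -> S \subset U by move=> SP; rewrite -(eqP cP); apply: bigcup_sup.
rewrite [leqRHS](eq_bigl (fun S => S \in P)); last first.
  by move=> S /=; apply: andb_idl => SP; move: (PU S SP); rewrite -powersetE.
apply: leq_sum => S SP; rewrite st // mul1n.
have cP1 : #|P :\ S| = j by apply/eqP; rewrite -eqSS -Pj (cardsD1 S P) SP.
rewrite -cP1; apply: IH => //; last by move=> S'; rewrite !inE => /andP[_ /st].
apply/and3P; split.
- rewrite -(eqP cP) /cover (big_setD1 S SP) /= setDUl setDv set0U; apply/eqP/esym/setDidPl.
  rewrite -setI_eq0 big_distrl /=; apply/eqP; apply: big1 => S'; rewrite !inE => /andP[ne S'P].
  by apply/eqP; rewrite setI_eq0; move/trivIsetP: tP; apply.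
- by apply: trivIsetS tP; apply: subsetDl.
by rewrite inE (negPf nP) andbF.
Qed.

Lemma colourable_partition (G : sgraph T) (m : nat) : improper_colourable G t m ->
  exists P, [/\ partition P [set: T], (#|P| <= m)%N & forall S, S \in P -> stable t S (edges G)].
Proof.
case/existsP => c /forallP cst.
pose cl (i : 'I_m) := [set v | c v == i].
exists ((cl @: 'I_m) :\ set0); split.
- apply/and3P; split; last by rewrite !inE eqxx.
    rewrite eqEsubset subsetT /=; apply/subsetP => v _; apply/bigcupP.
    exists (cl (c v)); last by rewrite inE.
    rewrite !inE imset_f // andbT; apply/set0Pn; exists v; by rewrite inE.
  apply/trivIsetP => S S'; rewrite !inE => /andP[_ /imsetP[i _ ->]] /andP[_ /imsetP[i' _ ->]] ne.
  rewrite -setI_eq0; apply/eqP/setP => v; rewrite !inE; apply/negP => /andP[/eqP vi /eqP vi'].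
  by rewrite -vi -vi' eqxx in ne.
- apply: leq_trans (subset_leq_card (subsetDl _ _)) _.
  by apply: leq_trans (leq_imset_card _ _) _; rewrite card_ord.
by move=> S; rewrite !inE => /andP[_ /imsetP[i _ ->]]; rewrite -t_stableE; apply: cst.
Qed.

Lemma improper_chromatic_colourable (G : sgraph T) : improper_colourable G t (improper_chromatic G t).
Proof. by rewrite /improper_chromatic; case: ex_minnP. Qed.

Variables (R : realType) (p : R) (g : nat -> R) (z F : R) (n : nat).
Hypotheses (p01 : 0 <= p <= 1) (z0 : 0 < z).
Hypothesis g_ge : forall S, stable_prob p t S <= g #|S|.
Hypothesis gF : \sum_(x < n.+1) g x * z ^+ x / x`!%:R <= F.
Hypothesis g0 : forall x, 0 <= g x.

Lemma sum_powerset_card U (f : nat -> R) :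
  \sum_(S in powerset U) f #|S| = \sum_(x < #|U|.+1) 'C(#|U|, x)%:R * f x.
Proof.
rewrite (eq_bigr (fun S : {set T} => \sum_(x < #|U|.+1 | #|S| == x) f x)); last first.
  move=> S; rewrite powersetE => /subset_leq_card SU; rewrite -ltnS in SU.
  by rewrite (big_pred1 (Ordinal SU)) // => x; rewrite eq_sym -val_eqE.
rewrite (exchange_big_dep predT) //=; apply: eq_bigr => x _.
rewrite sumr_const -[LHS]mulr_natl -cards_draws; congr (_%:R * _).
by apply: eq_card => S; rewrite [RHS]inE -powersetE.
Qed.

(** Disjoint blocks share no pair, so their probabilities multiply. The identity
    [C(u, x) (u - x)! = u! / x!] turns the choice of the first block into multiplication by the
    generating function, and a coefficient of a nonnegative series is at most its value at [z]
    divided by [z ^ u]. *)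
Lemma stable_covers_expectation j U : (#|U| <= n)%N ->
  bexp p (pairs [set: T]) (fun X => (stable_covers j U X)%:R) <= (#|U|)`!%:R * z ^- #|U| * F ^+ j.
Proof.
have F0 : 0 <= F.
  apply: le_trans gF; apply: sumr_ge0 => x _; rewrite divr_ge0 ?mulr_ge0 ?exprn_ge0 //; exact: ltW.
elim: j U => [|j IH] U Un /=.
  rewrite bexp_cst expr0 mulr1; case: eqP => [->|_]; first by rewrite cards0 fact0 expr0 invr1 mulr1.
  by rewrite mulr_ge0 // invr_ge0 exprn_ge0 // ltW.
under eq_bexp do rewrite natr_sum.
rewrite bexp_sum.
apply: (@le_trans _ _ (\sum_(S in powerset U)
   g #|S| * ((#|U| - #|S|)`!%:R * z ^- (#|U| - #|S|) * F ^+ j))).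
  apply: ler_sum => S; rewrite powersetE => SU.
  under eq_bexp do rewrite natrM.
  rewrite (bexp_indep p _ (A := pairs S) (B := pairs (U :\: S))); first last.
  - by move=> X; congr (_%:R); apply: stable_covers_depends.
  - by move=> X; rewrite {1}stable_depends.
  - rewrite -setI_eq0 pairsI -cards_eq0 card_pairs.
    by rewrite (_ : S :&: (U :\: S) = set0) ?cards0 //; apply/setP => v; rewrite !inE; case: (v \in S).
  have USE : #|U :\: S| = (#|U| - #|S|)%N by rewrite cardsD (setIidPr SU).
  rewrite stable_probE; apply: ler_pM.
  - by apply: bexp_ge0.
  - by apply: bexp_ge0.
  - exact: g_ge.
  by rewrite -USE; apply: IH; rewrite USE (leq_trans (leq_subr _ _)).
rewrite (sum_powerset_card U (fun x => g x * ((#|U| - x)`!%:R * z ^- (#|U| - x) * F ^+ j))).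
rewrite (eq_bigr (fun x : 'I_(#|U|.+1) => (#|U|)`!%:R * z ^- #|U| * F ^+ j * (g x * z ^+ x / x`!%:R))).
  rewrite -mulr_sumr exprSr [leRHS]mulrA ler_wpM2l //.
    by rewrite !mulr_ge0 ?exprn_ge0 ?invr_ge0 ?exprn_ge0 // ltW.
  apply: le_trans gF; rewrite -(big_mkord xpredT (fun x => g x * z ^+ x / x`!%:R)).
  rewrite -(big_mkord xpredT (fun x => g x * z ^+ x / x`!%:R)).
  rewrite [leRHS](big_cat_nat (n := #|U|.+1)) //= lerDl; apply: sumr_ge0 => x _.
  by rewrite divr_ge0 ?mulr_ge0 ?exprn_ge0 // ltW.
move=> x _; have xU : (x <= #|U|)%N by rewrite -ltnS.
have fx : x`!%:R != 0 :> R by rewrite pnatr_eq0 -lt0n fact_gt0.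
have fy : (#|U| - x)`!%:R != 0 :> R by rewrite pnatr_eq0 -lt0n fact_gt0.
have zn m : z ^+ m != 0 by rewrite expf_neq0 // gt_eqF.
have CE : 'C(#|U|, x)%:R = (#|U|)`!%:R / (x`!%:R * (#|U| - x)`!%:R) :> R.
  by rewrite -(bin_fact xU) !natrM mulfK // mulf_neq0.
have zE : z ^+ #|U| = z ^+ x * z ^+ (#|U| - x) by rewrite -exprD subnKC.
by rewrite CE zE; field; rewrite fx fy !zn.
Qed.

End StableCovers.

(* The left hand side is the logarithm of the [x]-th term of the generating function;
   the linear coefficient is chosen so that its quadratic part peaks at [x = K]. *)
Lemma tilted_term (R : realType) (beta D K x : R) : 0 < beta -> 0 < K ->
  `|D| <= beta / 4 * K -> 0 <= x ->
  D * (x * ln x) - beta * x ^+ 2 / 2 + x * (beta * K - D * ln K - D) <=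
  beta * K ^+ 2 / 2 - D * K - beta / 4 * (x - K) ^+ 2.
Proof.
move=> beta0 K0 DK; rewrite le_eqVlt => /predU1P[<-|x0].
  rewrite ln0 // !mul0r expr0n /= !mulr0 mul0r subrr addr0 sub0r sqrrN.
  have := ler_norm D; have := normr_ge0 D; have K2 : 0 < K ^+ 2 by rewrite exprn_gt0.
  move=> _ hD; have : D * K <= beta / 4 * K * K by rewrite ler_pM2r // (le_trans hD).
  by rewrite expr2; lra.
have xK0 : 0 < x / K by rewrite divr_gt0.
have lnE : ln x = ln K + ln (x / K) by rewrite ln_div ?posrE // addrC subrK.
have key : D * (x * ln (x / K)) <= D * (x - K) + beta / 4 * (x - K) ^+ 2.
  have [D0|D0] := leP 0 D.
    have h : x * ln (x / K) <= (x - K) + (x - K) ^+ 2 / K.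
      have -> : (x - K) + (x - K) ^+ 2 / K = x * (x / K - 1) by field; rewrite gt_eqF.
      by rewrite ler_pM2l // ln_le_sub1.
    apply: (le_trans (ler_wpM2l D0 h)); rewrite mulrDr lerD2l mulrCA mulrC ler_wpM2r ?sqr_ge0 //.
    by rewrite ler_pdivrMr // -(ger0_norm D0).
  have h : x - K <= x * ln (x / K).
    have -> : x - K = x * (1 - (x / K)^-1) by field; rewrite !gt_eqF.
    by rewrite ler_pM2l // ln_ge_1subV.
  apply: (le_trans (ler_wnM2l (ltW D0) h)); rewrite lerDl mulr_ge0 ?sqr_ge0 //.
  by rewrite divr_ge0 // ltW.
have -> : D * (x * ln x) - beta * x ^+ 2 / 2 + x * (beta * K - D * ln K - D) =
   D * (x * ln (x / K)) - D * (x - K) - D * K + beta * K ^+ 2 / 2 - beta / 2 * (x - K) ^+ 2.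
  by rewrite lnE; field.
by move: key; clear; lra.
Qed.

(** Up to [2 K] each summand is at most 1; beyond, the distance to [K] is at least [K] and each is
    at most [1 / (n + 1)]. *)
Lemma gaussian_sum_le (R : realType) (c K : R) (n : nat) : 0 < c -> 0 <= K ->
  ln n.+1%:R <= c * K ^+ 2 ->
  \sum_(x < n.+1) expR (- (c * (x%:R - K) ^+ 2)) <= 2 * K + 2.
Proof.
move=> c0 K0 hn; pose M := Num.truncn (2 * K).
have K20 : 0 <= 2 * K by rewrite mulr_ge0.
have /andP[M1 M2] := truncn_itv K20; rewrite -/M in M1 M2.
have n0 : (0 : R) < n.+1%:R by rewrite ltr0n.
apply: (@le_trans _ _ (\sum_(x < n.+1) ((x <= M)%N%:R + n.+1%:R^-1))).
  apply: ler_sum => x _; have [xM|Mx] := leqP x M.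
    apply: (@le_trans _ _ 1); last by rewrite lerDl invr_ge0.
    by rewrite expR_le1 oppr_le0 mulr_ge0 ?sqr_ge0 // ltW.
  rewrite add0r -[n.+1%:R]lnK ?posrE // -expRN ler_expR lerN2; apply: le_trans hn _.
  rewrite ler_pM2l // ler_sqr ?nnegrE //.
    have : M.+1%:R <= x%:R :> R by rewrite ler_nat.
    by move: M2; lra.
  have : M.+1%:R <= x%:R :> R by rewrite ler_nat.
  by move: M2; lra.
rewrite big_split /= sumr_const card_ord -[n.+1%:R^-1 *+ _]mulr_natl divff ?gt_eqF //.
suff : \sum_(x < n.+1) (x <= M)%N%:R <= M.+1%:R :> R by rewrite -natr1; lra.
rewrite -natr_sum ler_nat; apply: leq_trans (geq_minr n.+1 M.+1).
elim: n.+1 => [|m IH]; first by rewrite big_ord0.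
by rewrite big_ord_recr /=; move: IH; case: leqP => /=; lia.
Qed.

(** [lam] is found by setting the derivative of the exponent to zero at [x = K], after [x!] has been
    bounded below by Stirling; this bound is what turns [t / 2] into [D]. *)
Lemma tilted_sum_le (R : realType) (beta th d D C K lam : R) (t n : nat) (g : nat -> R) :
  0 < beta -> 0 < K -> 0 <= C -> D = t%:R / 2 - 1 -> `|D| <= beta / 4 * K ->
  lam = beta * K - beta / 2 - D * ln K - kap th t - 1 - d - D ->
  ln n.+1%:R <= beta / 4 * K ^+ 2 ->
  g 0 = 1 ->
  (forall x, (0 < x)%N -> g x = expR (stable_rate beta th t x%:R + d * x%:R + C)) ->
  \sum_(x < n.+1) g x * expR lam ^+ x / x`!%:R <=
  expR (beta * K ^+ 2 / 2 - D * K + C) * (2 * K + 2).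
Proof.
move=> beta0 K0 C0 DE DK lamE hn g0 gS.
have b4 : 0 < beta / 4 by rewrite divr_gt0.
apply: (@le_trans _ _ (\sum_(x < n.+1) expR (beta * K ^+ 2 / 2 - D * K + C) * expR (- (beta / 4 * (x%:R - K) ^+ 2)))); last first.
  by rewrite -mulr_sumr ler_pM2l ?expR_gt0 // gaussian_sum_le // ltW.
apply: ler_sum => x _; rewrite -expRD.
have f0 : 0 < x`!%:R :> R by rewrite ltr0n fact_gt0.
apply: (@le_trans _ _ (expR (C + (D * (x%:R * ln x%:R) - beta * x%:R ^+ 2 / 2 + x%:R * (beta * K - D * ln K - D))))); last first.
  by rewrite ler_expR; have := tilted_term beta0 K0 DK (ler0n R x); clear; lra.
rewrite ler_pdivrMr //; have [x0|x0] := posnP x.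
  by rewrite x0 g0 expr0 mulr1 fact0 mulr1 -[leLHS]expR0 ler_expR !mul0r mulr0 expr0n /= mulr0 mul0r subrr !addr0.
rewrite gS // -expRM_natl -expRD -[x`!%:R]lnK ?posrE // -expRD ler_expR.
have := ln_fact_ge R x; rewrite /stable_rate lamE DE; clear.
lra.
Qed.

(** Gives one bound for all admissible [j]: as [y <= F], [(F / y) ^ j] is largest at [j = y], and
    [y ^ j / j!] is a term of the series of [exp y]. *)
Lemma first_moment_bound (R : realType) (F y : R) (j : nat) : 0 < y -> y <= F -> j%:R <= y ->
  F ^+ j / j`!%:R <= expR (y * (ln F - ln y) + y).
Proof.
move=> y0 yF jy; have F0 := lt_le_trans y0 yF.
have -> : F ^+ j / j`!%:R = (F / y) ^+ j * (y ^+ j / j`!%:R).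
  by rewrite expr_div_n mulrA divfK // expf_neq0 // gt_eqF.
rewrite expRD; apply: ler_pM.
- by rewrite exprn_ge0 // divr_ge0 // ltW.
- by rewrite divr_ge0 // exprn_ge0 // ltW.
- rewrite -[F / y]lnK ?posrE ?divr_gt0 // -expRM_natl ler_expR ln_div ?posrE //.
  by rewrite ler_wpM2r // subr_ge0 ler_ln ?posrE.
by apply: exp_term; apply: ltW.
Qed.

(** Markov's inequality at the threshold [j!], which every partition into [j] stable blocks
    reaches. *)
Lemma covers_prob_le (R : realType) (p : R) (t n : nat) (g : nat -> R) (lam F : R) (j : nat) :
  0 < p < 1 -> (forall S : {set 'I_n}, stable_prob p t S <= g #|S|) ->
  (forall x, 0 <= g x) ->
  \sum_(x < n.+1) g x * expR lam ^+ x / x`!%:R <= F ->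
  Gnp_prob p (fun G : sgraph 'I_n => (j`! <= stable_covers t j [set: 'I_n] (edges G))%N) <=
  n`!%:R * expR (- (lam * n%:R)) * (F ^+ j / j`!%:R).
Proof.
move=> p01 gge g0 gF; have p01' : 0 <= p <= 1 by case/andP: p01 => /ltW -> /ltW ->.
have j0 : 0 < j`!%:R :> R by rewrite ltr0n fact_gt0.
rewrite (Gnp_probE p (f := fun X => (j`! <= stable_covers t j [set: 'I_n] X)%N)) //.
have := @stable_covers_expectation _ t R p g (expR lam) F n p01' (expR_gt0 lam) gge gF g0 j [set: 'I_n].
rewrite cardsT card_ord => /(_ (leqnn n)); rewrite -expRM_natr -expRN => h.
rewrite mulrA ler_pdivlMr // mulrC -bexpZ; apply: le_trans h; apply: ler_bexp => // X _.
by rewrite -natrM ler_nat; case: (leqP j`! _) => h; rewrite ?muln1 ?muln0.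
Qed.

Lemma chromatic_lower (R : realType) (p : R) (t : nat) (e eta : R) :
  0 < p < 1 -> 0 < e <= 1 -> 0 < eta ->
  exists N : nat, forall n, (N <= n)%N ->
    Gnp_prob p (fun G : sgraph 'I_n => ~~ (n%:R / (alpha t p n - 2 / ln (base p) - 1 + e) <=
      (improper_chromatic G t)%:R)) <= eta.
Proof.
move=> p01 e01 eta0; case/andP: (e01) => e0 e1.
pose q := 1 - p; pose th := p / q; pose beta := - ln q.
have beta0 := @beta_gt0 R p q beta p01 erefl erefl.
set a := alpha_log beta th t; pose D : R := t%:R / 2 - 1; pose c := 2 / beta.
have c0 : 0 < c by rewrite divr_gt0.
have cb : c * beta = 2 by rewrite /c divfK // gt_eqF.
have be0 : 0 < beta * e by rewrite mulr_gt0.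
have be1 : beta * e <= beta by rewrite ler_piMr // ltW.
pose d := beta * e / 32; have d0 : 0 < d by rewrite divr_gt0.
have [C [C0 hC]] := @stable_prob_le R p q th beta t p01 erefl erefl erefl d d0.
have D1 : 0 < `|D| + 1 by rewrite ltr_wpDl.
pose g := Num.min (2^-1) (Num.min (e / 16) (beta * e / (64 * (`|D| + 1)))).
have g0 : 0 < g by rewrite !lt_min invr_gt0 ltr0n !divr_gt0 ?mulr_gt0.
have g2 : g <= 2^-1 by rewrite ge_min lexx.
have ge : g <= e / 16 by rewrite !ge_min lexx orbT.
have gD : `|D| * (2 * g) <= beta * e / 32.
  have : g * (64 * (`|D| + 1)) <= beta * e by rewrite -ler_pdivlMr ?mulr_gt0 // !ge_min lexx !orbT.
  by clear - g0; have := normr_ge0 D; nra.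
have E1 := @alpha_log_linear _ p q th beta t p01 erefl erefl g (2 * beta + 1) g0.
have e32 : 0 < e / 32 by rewrite divr_gt0.
have M2 : 0 <= 2 :> R by [].
have E2 := @ev_lnM R 2 (e / 32) (2 * ln (4 / beta) + C + 1 + ln 4) M2 e32.
have be64 : 0 < beta * e / 64 by rewrite divr_gt0.
have E3 := @ev_linear R (beta * e / 64) 7 be64.
have be4 : 0 < beta * e / 4 by rewrite divr_gt0.
have E6 := @ev_linear R (beta * e / 4) (- ln eta) be4.
have Eall := ev_and (ev_ge 1) (ev_and E1 (ev_and E2 (ev_and E3 (ev_and (ev_ge (4 * `|D|)) (ev_and (ev_ge (8 * beta)) E6))))).
have [N hN] := ev_ln_nat Eall; exists (maxn N 3) => n; rewrite geq_max => /andP[Nn n3].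
have [L1 [{}E1 [{}E2 [{}E3 [E4 [E5 {}E6]]]]]] := hN n Nn.
have n0 : (0 < n)%N by apply: leq_trans n3.
have n0R : 0 < n%:R :> R by rewrite ltr0n.
set L := ln n%:R in L1 E1 E2 E3 E4 E5 E6.
have L0 : 0 < L by clear - L1; lra.
rewrite (@alphaE R p q th beta t p01 erefl erefl erefl n n3) (@ln_base R p q beta p01 erefl erefl) -/L -/a -/c.
(* The final exponent contains [n beta (a L - K) / 2], that is [n] from [c], [n beta / 2] from the 1
   and [- n beta e / 2] from [e]. The first is cancelled by the [- n] of [ln n!], the second by
   [- y L], which stems from the division by [j!]; the third remains. *)
pose K := a L - c - 1 + e; rewrite -/K.
have nE : n%:R = expR L by rewrite lnK.
pose u := beta * K / 2.
have uE : u = beta * a L / 2 - 1 - beta / 2 + beta * e / 2.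
  have -> : u = (beta * a L - c * beta - beta + beta * e) / 2 by rewrite /u /K; field.
  by rewrite cb; clear; lra.
have aL1 := ler_norm (beta * a L / 2 - L); have aL2 := lerNnormlW (lexx `|beta * a L / 2 - L|).
rewrite -/a in E1.
have u1 : L - g * L <= u by rewrite uE; clear - E1 aL1 aL2 beta0 be0 be1; lra.
have u2 : u <= L + g * L by rewrite uE; clear - E1 aL1 aL2 beta0 be0 be1; lra.
have gL : g * L <= L / 2 by rewrite mulrC ler_pM2l.
have uL : L / 2 <= u by clear - u1 gL; lra.
have KE : beta * K = 2 * u by rewrite /u; clear; lra.
have bK : L <= beta * K by rewrite KE; clear - uL; lra.
have K1 : 1 <= K.
  by rewrite -(ler_pM2l beta0) mulr1; clear - bK E5 beta0; lra.
have K0 : 0 < K by clear - K1; lra.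
have hr := ln_ratio_le L0 g0 g2 u1 u2.
have lnr : ln (u / L) = ln K - ln (2 * L / beta).
  rewrite -ln_div ?posrE ?divr_gt0 ?mulr_gt0 //; congr ln; rewrite /u.
  by field; rewrite !gt_eqF.
have hDr : D * (ln K - ln (2 * L / beta)) <= beta * e / 32.
  rewrite -lnr; apply: le_trans (ler_norm _) _; rewrite normrM.
  by apply: le_trans gD; rewrite ler_wpM2l.
have inv := @alpha_log_inv _ p q th beta t p01 erefl erefl L.
rewrite -/a -/D in inv.
have DK : `|D| <= beta / 4 * K.
  have -> : beta / 4 * K = u / 2 by rewrite /u; clear; lra.
  by clear - E4 uL; lra.
have lnn1 : ln n.+1%:R <= L + 1.
  have h2 : ln 2 <= 1 :> R by have := @ln_le_sub1 R 2 (ltr0Sn _ 1); clear; lra.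
  apply: (@le_trans _ _ (L + ln 2)); last by rewrite lerD2l.
  rewrite -lnM ?posrE // ler_ln ?posrE ?mulr_gt0 // -natrM ler_nat.
  by rewrite muln2 -addnn -addn1 leq_add2l.
have LLK : 2 * L <= u * K / 2.
  have h : L * (8 * beta) <= L * L by rewrite ler_pM2l.
  have h2 : L / 2 * L <= u * (beta * K) by apply: ler_pM => //; rewrite ?divr_ge0 // ltW.
  rewrite -(ler_pM2l beta0); move: h h2; clear; lra.
have hn : ln n.+1%:R <= beta / 4 * K ^+ 2.
  have -> : beta / 4 * K ^+ 2 = u * K / 2 by rewrite /u; field.
  by clear - lnn1 LLK L1; lra.
pose lam := beta * K - beta / 2 - D * ln K - kap th t - 1 - d - D.
(* The empty block is set apart because [hC] concerns nonempty sets. *)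
pose gx (x : nat) : R := if x is 0%N then 1 else expR (stable_rate beta th t x%:R + d * x%:R + C).
pose F := expR (beta * K ^+ 2 / 2 - D * K + C) * (2 * K + 2).
have gF : \sum_(x < n.+1) gx x * expR lam ^+ x / x`!%:R <= F.
  by apply: (@tilted_sum_le R beta th d D C K lam t n gx) => //; case.
have p01' : 0 <= p <= 1 by case/andP: p01 => /ltW -> /ltW ->.
have gge (S : {set 'I_n}) : stable_prob p t S <= gx #|S|.
  rewrite /gx; case: (posnP #|S|) => [->|S0].
    rewrite -[leRHS](bexp_cst p (pairs S)); apply: ler_bexp => // X _.
    by rewrite lern1 leq_b1.
  by have := hC _ S S0; case: (#|S|) S0.
have gx0 x : 0 <= gx x by case: x => //= x; apply: expR_ge0.
pose y := n%:R / K.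
have y0 : 0 < y by rewrite divr_gt0.
have nyK : n%:R = y * K by rewrite divfK // gt_eqF.
have F0 : 0 < F by rewrite mulr_gt0 ?expR_gt0 //; clear - K0; lra.
have lnF : ln F = beta * K ^+ 2 / 2 - D * K + C + ln (2 * K + 2).
  by rewrite lnM ?posrE ?expR_gt0 ?expRK //; clear - K0; lra.
have lny : ln y = L - ln K by rewrite ln_div ?posrE.
have lnK0 : 0 <= ln K by rewrite ln_ge0.
have ln2K0 : 0 <= ln (2 * K + 2) by rewrite ln_ge0 //; clear - K0; lra.
have yF : y <= F.
  rewrite -ler_ln ?posrE // lny lnF.
  have h : D * K <= beta / 4 * K * K.
    by rewrite ler_pM2r //; apply: le_trans (ler_norm _) DK.
  have h2 : beta * K ^+ 2 / 2 - beta / 4 * K * K = u * K / 2 by rewrite /u; field.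
  by clear - h h2 LLK lnK0 ln2K0 C0 L0; lra.
have yn : y <= n%:R by rewrite nyK ler_peMr // ltW.
pose Q (j : 'I_n.+1) := j%:R <= y.
have union (G : sgraph 'I_n) : ~~ (n%:R / K <= (improper_chromatic G t)%:R) ->
    [exists j : 'I_n.+1, Q j && (j`! <= stable_covers t j [set: 'I_n] (edges G))%N].
  rewrite -ltNge -/y => chi.
  have [P [Ppart Pm Pst]] := colourable_partition (improper_chromatic_colourable t G).
  have Py : (#|P|)%:R <= y by apply: le_trans (ltW chi); rewrite ler_nat.
  have Pn : (#|P| < n.+1)%N by rewrite ltnS -(ler_nat R) (le_trans Py).
  apply/existsP; exists (Ordinal Pn); rewrite /Q /= Py.
  exact: stable_covers_partition.
apply: (le_trans (Gnp_prob_union p01' (Q := Q) union)).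
pose B := n`!%:R * expR (- (lam * n%:R)) * expR (y * (ln F - ln y) + y).
apply: (@le_trans _ _ (\sum_(j < n.+1) B)).
  rewrite big_mkcond; apply: ler_sum => j _.
  have pre0 : 0 <= n`!%:R * expR (- (lam * n%:R)) by rewrite mulr_ge0 ?expR_ge0.
  case: ifP => [Qj|_]; last by rewrite mulr_ge0 ?expR_ge0.
  apply: le_trans (covers_prob_le j p01 gge gx0 gF) _; rewrite ler_wpM2l //.
  exact: first_moment_bound.
rewrite sumr_const card_ord -[leLHS]mulr_natl /B.
have n10 : 0 < n.+1%:R :> R by rewrite ltr0n.
have nf0 : 0 < n`!%:R :> R by rewrite ltr0n fact_gt0.
rewrite -[n.+1%:R]lnK ?posrE // -[n`!%:R]lnK ?posrE // -[eta]lnK ?posrE // -!expRD ler_expR.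
have nL : L <= n%:R by rewrite ltW // ln_sublinear.
have nL2 : L ^+ 2 / 2 <= n%:R.
  by have := expR_ge1Dxn 1 (ltW L0); rewrite -nE (_ : 2`! = 2)%N //; clear; lra.
have hlast : - (n%:R * (beta * e) / 4) <= ln eta.
  have : beta * e / 4 * L <= beta * e / 4 * n%:R by rewrite ler_pM2l.
  by clear - E6; lra.
apply: le_trans hlast.
have fle := ln_fact_le R n; rewrite -/L in fle.
have err1 : 3 * ln n.+1%:R + 1 <= n%:R * (beta * e) / 32.
  have h : beta * e / 32 * (L ^+ 2 / 2) <= beta * e / 32 * n%:R.
    by rewrite ler_pM2l // divr_gt0.
  have h2 : L * 7 <= L * (beta * e / 64 * L) by rewrite ler_pM2l.
  by move: h h2; rewrite expr2; clear - lnn1 L1; lra.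
have err2 : y * (C + 1 + ln (2 * K + 2) + ln K) <= n%:R * (beta * e) / 32.
  have -> : n%:R * (beta * e) / 32 = y * (beta * K * e / 32) by rewrite nyK; field.
  rewrite ler_pM2l // KE.
  have b4 : 0 < 4 / beta by rewrite divr_gt0.
  have lK : ln K <= ln L + ln (4 / beta).
    rewrite -lnM ?posrE // ler_ln ?posrE ?(mulr_gt0 L0 b4) //.
    have -> : K = u * (2 / beta) by rewrite /u; field; rewrite gt_eqF.
    have -> : L * (4 / beta) = (2 * L) * (2 / beta) by field; rewrite gt_eqF.
    by rewrite ler_pM2r //; clear - u2 gL L0; lra.
  have l4K : ln (2 * K + 2) <= ln 4 + ln K.
    rewrite -lnM ?posrE // ler_ln ?posrE ?mulr_gt0 //; clear - K1 K0; lra.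
  have ue : L / 2 * e <= u * e by rewrite ler_pM2r.
  by clear - lK l4K E2 ue; lra.
have yL : n%:R * (beta / 2 * (1 - g)) <= y * L.
  rewrite nyK -(mulrA y) ler_pM2l //.
  have -> : K * (beta / 2 * (1 - g)) = u * (1 - g) by rewrite /u; field.
  have g1 : 0 <= 1 - g by clear - g2; lra.
  apply: le_trans (ler_wpM2r g1 u2) _.
  have : 0 <= g * g * L by rewrite !mulr_ge0 // ltW.
  by clear; lra.
have main : n%:R * (L - 1 - lam + beta * K / 2 - D) <= n%:R * (beta / 2 - beta * e / 2 + 2 * (beta * e / 32)).
  rewrite ler_pM2l // /lam.
  have hK : beta * (a L - 1) / 2 - beta * K / 2 = 1 + beta / 2 - beta * e / 2 - beta / 2.
    have -> : beta * (a L - 1) / 2 - beta * K / 2 = (c * beta - beta * e) / 2 by rewrite /K; field.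
    by rewrite cb; clear; lra.
  by move: hDr inv; rewrite mulrBr /d; clear - hK; lra.
have gb : n%:R * (beta / 2 * g) <= n%:R * (beta * e / 32).
  rewrite ler_pM2l //; have := ler_wpM2l (ltW beta0) ge; clear; lra.
have yF' : y * (ln F - ln y) + y = n%:R * (beta * K / 2 - D) + y * (C + 1 + ln (2 * K + 2) + ln K) - y * L.
  by rewrite lnF lny nyK; field.
rewrite yF'.
have nbe : 0 < n%:R * (beta * e) by rewrite mulr_gt0.
by clear - fle err1 err2 yL main gb nbe; lra.
Qed.

(** * Combining the two bounds and extracting the error functions *)

Lemma chromatic_window (R : realType) (p : R) (t : nat) (d : R) :
  0 < p < 1 -> 0 < d <= 1 ->
  exists N : nat, forall n, (N <= n)%N ->
    1 - 2 * d <= Gnp_prob p (fun G : sgraph 'I_n =>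
      n%:R / (alpha t p n - 2 / ln (base p) - 1 + d) <= (improper_chromatic G t)%:R
        <= n%:R / (alpha t p n - 2 / ln (base p) - 2 - d)).
Proof.
move=> p01 /andP[d0 d1]; have p01' : 0 <= p <= 1 by case/andP: p01 => /ltW -> /ltW ->.
have d01 : 0 < d <= 1 by rewrite d0.
(* [chromatic_upper] loses three times its parameter. *)
have d3 : 0 < d / 3 <= 1 by apply/andP; split; lra.
have [N1 h1] := chromatic_lower t p01 d01 d0.
have [N2 h2] := chromatic_upper t p01 d3 d0.
exists (maxn N1 N2) => n; rewrite geq_max => /andP[/h1 {}h1 /h2 {}h2].
have d3E : 3 * (d / 3) = d by field.
rewrite d3E in h2.
set A := fun G : sgraph 'I_n => _ <= _ <= _.
have AC := Gnp_probC p A.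
suff : Gnp_prob p (predC A) <= d + d by move: AC; lra.
pose B (b : bool) (G : sgraph 'I_n) := if b
  then ~~ (n%:R / (alpha t p n - 2 / ln (base p) - 1 + d) <= (improper_chromatic G t)%:R)
  else ~~ ((improper_chromatic G t)%:R <= n%:R / (alpha t p n - 2 / ln (base p) - 2 - d)).
apply: (@le_trans _ _ (\sum_(b : bool | true) Gnp_prob p (B b))).
  apply: Gnp_prob_union => // G; rewrite /A /= negb_and => /orP[h|h]; apply/existsP.
    by exists true.
  by exists false.
by rewrite big_bool lerD.
Qed.

Local Open Scope classical_set_scope.

(* [lvl n] is the largest [j <= n] such that [P] already holds from [n] on at [1 / (j + 1)]. *)
Lemma diagonal_sequence (R : realType) (P : nat -> R -> Prop) :
  (forall d, 0 < d <= 1 -> exists N, forall n, (N <= n)%N -> P n d) ->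
  exists2 eps : nat -> R, eps n @[n --> \oo] --> (0 : R) &
    exists N, forall n, (N <= n)%N -> P n (eps n).
Proof.
move=> hP.
have hj (j : nat) : exists N, forall n, (N <= n)%N -> P n (j.+1%:R^-1).
  by apply: hP; rewrite invr_gt0 ltr0n /= invf_le1 ?ltr0n // ler1n.
have [Nf hNf] := choice hj.
pose lvl n := (\max_(j < n.+1 | (Nf j <= n)%N) j)%N.
exists (fun n => (lvl n).+1%:R^-1).
  apply/cvgrPdist_le => e e0.
  pose J := Num.truncn e^-1.
  have Je : J.+1%:R^-1 <= e.
    by rewrite invf_ple ?posrE ?ltr0n // ltW // truncnS_gt.
  exists (maxn J (Nf J)) => // n /=; rewrite geq_max => /andP[Jn NJ].
  rewrite sub0r normrN ger0_norm ?invr_ge0 //; apply: le_trans Je.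
  rewrite lef_pV2 ?posrE ?ltr0n // ler_nat ltnS.
  have Jn' : (J < n.+1)%N by [].
  exact: (@leq_bigmax_cond _ (fun j : 'I_n.+1 => Nf j <= n)%N (fun j => j : nat) (Ordinal Jn') NJ).
(* An empty maximum would be 0 without [P] being known at level 0; from [Nf 0] on, the range
   contains [j = 0]. *)
exists (Nf 0%N) => n N0; apply: hNf.
have [|i iN hi] := @eq_bigmax_cond _ (fun j : 'I_n.+1 => Nf j <= n)%N (fun j => j : nat).
  by apply/card_gt0P; exists ord0.
have -> : lvl n = i by exact: hi.
exact: iN.
Qed.

Theorem theorem3 (R : realType) (p : R) (t : nat) (hp : 0 < p < 1) :
  exists eps1 eps2 : nat -> R,
    [/\ eps1 n @[n --> \oo] --> (0 : R),
        eps2 n @[n --> \oo] --> (0 : R) &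
        Gnp_aas p (fun n (G : sgraph 'I_n) =>
          let chi : R := (improper_chromatic G t)%:R in
          n%:R / (alpha t p n - 2 / ln (base p) - 1 + eps1 n) <= chi
            <= n%:R / (alpha t p n - 2 / ln (base p) - 2 - eps2 n))].
Proof.
have p01' : 0 <= p <= 1 by case/andP: hp => /ltW -> /ltW ->.
have [eps eps0 [N hN]] := diagonal_sequence (fun d => @chromatic_window R p t d hp).
(* One sequence serves both bounds, and the probability is at least [1 - 2 * eps n], which yields
   the limit. *)
exists eps, eps; split=> //; apply/cvgrPdist_le => e e0.
have e2 : 0 < e / 2 by rewrite divr_gt0.
have [M _ hM] := (cvgrPdist_le _ _).1 eps0 _ e2.
exists (maxn N M) => // n /=; rewrite geq_max => /andP[/hN {}hN /hM {}hM].
set A := fun G : sgraph 'I_n => _ <= _ <= _ in hN *.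
have := Gnp_prob_ge0 p01' (predC A); have := Gnp_probC p A.
move: hM; rewrite sub0r normrN => /(le_trans (ler_norm _)) hM AC C0.
by rewrite ger0_norm; lra.
Qed.
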